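(* Let $L$ be a smooth, non-null, minimal Lagrangian surface of $(T\Sigma,\mathbb{J},\mathbb{G},\Omega)$ such that the rank of $d\pi|_{TL}$ is constant on $L$. Then at least one of the following holds: (i) $L$ is locally an affine normal bundle over a geodesic of $(\Sigma,g)$, i.e. every point of $L$ has a neighbourhood in $L$ which is an open piece of an affine normal bundle over a geodesic; or (ii) the metric $g$ is flat on the open set $\pi(L)\subset\Sigma$ (in this case $\pi|_L$ has rank two).
   Context: $(\Sigma,g)$ is an oriented Riemannian surface, $\nabla$ its Levi-Civita connection, $j$ its canonical complex structure (rotation by $+\pi/2$ in each tangent plane), and $\pi:T\Sigma\to\Sigma$ the projection. For $\xi\in T_{(p,V)}T\Sigma$ put $P\xi=d\pi(\xi)\in T_p\Sigma$, and let $K\xi\in T_p\Sigma$ be the image of $\xi$ under the connection map: if $\alpha(s)=(p(s),V(s))$ is a curve in $T\Sigma$ with $\alpha'(0)=\xi$, then $K\xi$ is the covariant derivative at $s=0$ of $V(s)$ along $p(s)$ (which is the ordinary derivative $V'(0)$ in the fibre if $p$ is constant). The map $\xi\mapsto(P\xi,K\xi)$ is an isomorphism $T_{(p,V)}T\Sigma\simeq T_p\Sigma\oplus T_p\Sigma$. Define on $T\Sigma$ the symplectic form $\Omega(X,Y)=g(KX,PY)-g(PX,KY)$, the almost complex structure $\mathbb{J}=j\oplus j$ (i.e. $P\mathbb{J}X=jPX$, $K\mathbb{J}X=jKX$) and the neutral (signature $(2,2)$) pseudo-Riemannian metric $\mathbb{G}(X,Y)=\Omega(\mathbb{J}X,Y)$.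 A surface $L$ of $T\Sigma$ is an immersed 2-dimensional submanifold; it is Lagrangian if $\Omega$ restricts to zero on $L$; non-null if the metric induced by $\mathbb{G}$ on $L$ is non-degenerate. For a non-null surface the mean curvature vector $\vec H$ is one half of the trace (with respect to the induced metric) of the second fundamental form, and $L$ is minimal if $\vec H=0$. Given a regular curve $\gamma:I\to\Sigma$ parametrized by arclength and a real function $a$ on $I$, the image of $X(s,t)=(\gamma(s),\,a(s)\gamma'(s)+t\,j\gamma'(s))$ is called an affine normal bundle over $\gamma$. *)

(* Defs.v *)
(* Tangent vectors and coordinate tuples are row vectors. *)
From HB Require Import structures.
From mathcomp Require Import all_boot all_order all_algebra.
From mathcomp Require Import all_classical all_reals all_analysis.

Set Implicit Arguments.
Unset Strict Implicit.
Unset Printing Implicit Defensive.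

Import Order.TTheory GRing.Theory Num.Theory numFieldNormedType.Exports.

Local Open Scope classical_set_scope.
Local Open Scope ring_scope.

Section Smooth.
Context {R : realType} {V W : normedModType R}.

(* Meant for open U; the values of f outside U are then irrelevant. *)
Fixpoint Ck (k : nat) (U : set V) (f : V -> W) : Prop :=
  match k with
  | 0%N => forall x, U x -> {for x, continuous f}
  | k'.+1 => (forall x, U x -> differentiable f x) /\
             (forall v, Ck k' U ('D_v f))
  end.

Definition smooth_on (U : set V) (f : V -> W) : Prop := forall k, Ck k U f.

End Smooth.

(* A Hausdorff second countable space with a (not necessarily maximal) smooth
   atlas. The chart cmap i is meaningful only on cdom i, and cinv i, its
   inverse, only on the image of cdom i. *)
Record manifold (R : realType) (n : nat) := Manifold {
  mspace :> topologicalType;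
  chart : Type;
  cdom : chart -> set mspace;
  cmap : chart -> mspace -> 'rV[R]_n;
  cinv : chart -> 'rV[R]_n -> mspace;
  mspace_hausdorff : hausdorff_space mspace;
  mspace_second_countable : @second_countable mspace;
  cdom_open : forall i, open (cdom i);
  cdom_cover : forall p, exists i, cdom i p;
  ccod_open : forall i, open (cmap i @` cdom i);
  cmapK : forall i p, cdom i p -> cinv i (cmap i p) = p;
  cmap_continuous : forall i p, cdom i p -> {for p, continuous (cmap i)};
  cinv_continuous : forall i p,
    cdom i p -> {for cmap i p, continuous (cinv i)};
  trans_smooth : forall i j,
    smooth_on (cmap i @` (cdom i `&` cdom j)) (cmap j \o cinv i) }.

Section Manifolds.
Context {R : realType} {n : nat}.
Implicit Type M : manifold R n.

Definition trans M (i j : chart M) : 'rV[R]_n -> 'rV[R]_n :=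
  cmap j \o cinv i.

Definition oriented M : Prop :=
  forall (i j : chart M) p, cdom i p -> cdom j p ->
    0 < \det ('J (trans i j) (cmap i p)).

(* A point of the tangent bundle: a foot p together with the components of a
   vector of T_p M in all the charts around p. The components in the other
   charts are set to 0 so that equality of records is equality in TM. *)
Record tangent M := Tangent {
  foot : M;
  tcoord : chart M -> 'rV[R]_n;
  tcoord_out : forall i, ~ cdom i foot -> tcoord i = 0;
  tcoord_trans : forall i j, cdom i foot -> cdom j foot ->
    tcoord j = 'd (trans i j) (cmap i foot) (tcoord i) }.

Definition bil m (A : 'M[R]_m) (v w : 'rV[R]_m) : R := (v *m A *m w^T) 0 0.

(* gram i x is the Gram matrix of the coordinate frame of the chart i at the
   point of coordinates x. *)
Record riemannian_metric M := RiemannianMetric {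
  gram : chart M -> 'rV[R]_n -> 'M[R]_n;
  gram_smooth : forall i, smooth_on (cmap i @` cdom i) (gram i);
  gram_sym : forall i p, cdom i p -> (gram i (cmap i p))^T = gram i (cmap i p);
  gram_posdef : forall i p, cdom i p ->
    forall v, v != 0 -> 0 < bil (gram i (cmap i p)) v v;
  gram_trans : forall i j p, cdom i p -> cdom j p -> forall v w,
    bil (gram j (cmap j p)) ('d (trans i j) (cmap i p) v)
                            ('d (trans i j) (cmap i p) w) =
    bil (gram i (cmap i p)) v w }.

End Manifolds.

Section LeviCivita.
Context {R : realType} {n : nat}.
Variable G : 'rV[R]_n -> 'M[R]_n.

Definition basis_vec m (a : 'I_m) : 'rV[R]_m := delta_mx 0 a.

(* Gamma^k_ij of the metric with Gram matrix G, of any signature. *)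
Definition christoffel (x : 'rV[R]_n) (k i j : 'I_n) : R :=
  2^-1 * \sum_(l < n) invmx (G x) k l *
    ('D_(basis_vec i) (fun y => G y j l) x +
     'D_(basis_vec j) (fun y => G y i l) x -
     'D_(basis_vec l) (fun y => G y i j) x).

Definition Gam (x v w : 'rV[R]_n) : 'rV[R]_n :=
  \row_k \sum_(i < n) \sum_(j < n) christoffel x k i j * v 0 i * w 0 j.

(* Covariant derivative of a vector field V(s) along a curve p(s), at a value
   of s where p = x, p' = v, V = w and V' = w'. *)
Definition cov_deriv (x v w w' : 'rV[R]_n) : 'rV[R]_n := w' + Gam x v w.

(* The component R^l_kij of R(d_i, d_j) d_k. *)
Definition riemann (x : 'rV[R]_n) (l k i j : 'I_n) : R :=
  'D_(basis_vec i) (fun y => christoffel y l j k) x -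
  'D_(basis_vec j) (fun y => christoffel y l i k) x +
  \sum_(m < n) (christoffel x l i m * christoffel x m j k -
                christoffel x l j m * christoffel x m i k).

End LeviCivita.

Definition flat_at (R : realType) (n : nat) (M : manifold R n)
    (g : riemannian_metric M) (p : M) : Prop :=
  forall i, cdom i p -> forall l k a b, riemann (gram g i) (cmap i p) l k a b = 0.

(* F is a parametrized surface in a domain of R^N carrying the
   pseudo-Riemannian metric with Gram matrix H. *)
Section SurfaceGeometry.
Context {R : realType} {N : nat}.
Variables (H : 'rV[R]_N -> 'M[R]_N) (F : 'rV[R]_2 -> 'rV[R]_N).

Definition pderiv (a : 'I_2) : 'rV[R]_2 -> 'rV[R]_N := 'D_(basis_vec a) F.

Definition induced_metric (u : 'rV[R]_2) : 'M[R]_2 :=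
  \matrix_(a, b) bil (H (F u)) (pderiv a u) (pderiv b u).

Definition normal_part (u : 'rV[R]_2) (w : 'rV[R]_N) : 'rV[R]_N :=
  w - \sum_(a < 2) \sum_(b < 2)
        (invmx (induced_metric u) a b * bil (H (F u)) w (pderiv a u))
          *: pderiv b u.

Definition second_fundamental_form (u : 'rV[R]_2) (a b : 'I_2) : 'rV[R]_N :=
  normal_part u
    (cov_deriv H (F u) (pderiv a u) (pderiv b u)
       ('D_(basis_vec a) (pderiv b) u)).

Definition mean_curvature (u : 'rV[R]_2) : 'rV[R]_N :=
  2^-1 *: \sum_(a < 2) \sum_(b < 2)
    invmx (induced_metric u) a b *: second_fundamental_form u a b.

End SurfaceGeometry.

(* G is the Gram matrix of the metric in a positively oriented chart. The
   induced chart of the tangent bundle has coordinates z = (x, V), and a vector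
   X tangent to the bundle at z has components (dx, dV). *)
Section TangentBundle.
Context {R : realType}.
Variable G : 'rV[R]_2 -> 'M[R]_2.
Implicit Types z X Y : 'rV[R]_(2 + 2).

(* Rotation by +pi/2: with w = v A the components of the covector g(v, .), it
   is (- w_2, w_1) / sqrt (det A), which is orthogonal to v, has the length of
   v, and forms a positively oriented frame with v when v != 0. *)
Definition jrot (A : 'M[R]_2) (v : 'rV[R]_2) : 'rV[R]_2 :=
  (Num.sqrt (\det A))^-1 *:
    (v *m A *m \matrix_(a < 2, b < 2) ((b : nat)%:R - (a : nat)%:R)).

Definition Pmap X : 'rV[R]_2 := lsubmx X.

Definition Kmap z X : 'rV[R]_2 :=
  cov_deriv G (lsubmx z) (lsubmx X) (rsubmx z) (rsubmx X).

(* The vector X such that Pmap X = p and Kmap z X = k. *)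
Definition PKinv z (p k : 'rV[R]_2) : 'rV[R]_(2 + 2) :=
  row_mx p (k - Gam G (lsubmx z) p (rsubmx z)).

Definition JJ z X : 'rV[R]_(2 + 2) :=
  PKinv z (jrot (G (lsubmx z)) (Pmap X)) (jrot (G (lsubmx z)) (Kmap z X)).

Definition Omega z X Y : R :=
  bil (G (lsubmx z)) (Kmap z X) (Pmap Y) -
  bil (G (lsubmx z)) (Pmap X) (Kmap z Y).

Definition GG z X Y : R := Omega z (JJ z X) Y.

Definition GGmx z : 'M[R]_(2 + 2) :=
  \matrix_(a, b) GG z (basis_vec a) (basis_vec b).

End TangentBundle.

(* An immersed surface is given by a 2-manifold L and an immersion of L into
   the tangent bundle. *)
Section Surfaces.
Context {R : realType} {S : manifold R 2} (g : riemannian_metric S).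
Context {L : manifold R 2} (f : L -> tangent S).

Definition local_dom (k : chart L) (i : chart S) : set 'rV[R]_2 :=
  cmap k @` (cdom k `&` [set q | cdom i (foot (f q))]).

Definition local_rep (k : chart L) (i : chart S) (u : 'rV[R]_2) :
    'rV[R]_(2 + 2) :=
  row_mx (cmap i (foot (f (cinv k u)))) (tcoord (f (cinv k u)) i).

Definition smooth_immersion : Prop :=
  continuous (fun q => foot (f q)) /\
  forall k i, smooth_on (local_dom k i) (local_rep k i) /\
    forall u, local_dom k i u -> \rank ('J (local_rep k i) u) = 2%N.

Definition lagrangian : Prop :=
  forall k i u, local_dom k i u -> forall v w : 'rV[R]_2,
    Omega (gram g i) (local_rep k i u)
      ('d (local_rep k i) u v) ('d (local_rep k i) u w) = 0.

Definition non_null : Prop :=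
  forall k i u, local_dom k i u ->
    induced_metric (GGmx (gram g i)) (local_rep k i) u \in unitmx.

Definition minimal : Prop :=
  forall k i u, local_dom k i u ->
    mean_curvature (GGmx (gram g i)) (local_rep k i) u = 0.

(* The differential of the projection, restricted to the tangent planes of the
   surface, has rank r everywhere. *)
Definition projection_rank (r : nat) : Prop :=
  forall k i u, local_dom k i u ->
    \rank ('J (fun y => lsubmx (local_rep k i y)) u) = r.

Section Curves.
Variables (I : set R) (gamma : R -> S).

Definition smooth_curve : Prop :=
  (forall s, I s -> {for s, continuous gamma}) /\
  forall i, smooth_on (I `&` [set s | cdom i (gamma s)])
              (cmap i \o gamma).

Definition velocity (i : chart S) : R -> 'rV[R]_2 := derive1 (cmap i \o gamma).

Definition arclength_param : Prop :=
  forall s, I s -> forall i, cdom i (gamma s) ->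
    bil (gram g i (cmap i (gamma s))) (velocity i s) (velocity i s) = 1.

Definition geodesic : Prop :=
  forall s, I s -> forall i, cdom i (gamma s) ->
    cov_deriv (gram g i) (cmap i (gamma s)) (velocity i s) (velocity i s)
      (derive1 (velocity i) s) = 0.

(* xi = (gamma s, a(s) gamma'(s) + t j gamma'(s)). *)
Definition affine_normal_point (a : R -> R) (s t : R) (xi : tangent S) : Prop :=
  foot xi = gamma s /\
  forall i, cdom i (gamma s) ->
    tcoord xi i = a s *: velocity i s +
                  t *: jrot (gram g i (cmap i (gamma s))) (velocity i s).

End Curves.

(* Near q, the immersion f is X \o phi, where X is the affine normal bundle
   over a geodesic gamma defined on an open interval I, and phi = (s, t) is a
   homeomorphism of a neighbourhood of q onto an open subset of I * R. *)
Definition affine_normal_near (q : L) : Prop :=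
  exists (U : set L) (I : set R) (gamma : R -> S) (a : R -> R)
         (phi : L -> R * R),
    [/\ open U /\ U q,
        open I /\ is_interval I,
        [/\ smooth_curve I gamma, arclength_param I gamma, geodesic I gamma
          & smooth_on I a],
        [/\ forall p, U p -> {for p, continuous phi},
            forall p p', U p -> U p' -> phi p = phi p' -> p = p'
          & forall O : set L, open O -> O `<=` U -> open (phi @` O)]
      & forall p, U p ->
          I (phi p).1 /\ affine_normal_point gamma a (phi p).1 (phi p).2 (f p)].

End Surfaces.

(* Main.v *)
From HB Require Import structures.
Require Import Defs.
From mathcomp Require Import all_boot all_order all_algebra.
From mathcomp Require Import all_classical all_reals all_analysis.
From mathcomp Require Import ring lra.

Set Implicit Arguments.
Unset Strict Implicit.
Unset Printing Implicit Defensive.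

Import Order.TTheory GRing.Theory Num.Theory numFieldNormedType.Exports.

Local Open Scope classical_set_scope.
Local Open Scope ring_scope.

(* In an oriented orthonormal frame of the surface, tangent vectors become complex
   numbers, the Levi-Civita connection a single 1-form omega, and a tangent
   vector of the bundle a pair (z, k) of complex numbers, its horizontal and
   vertical parts. For a Lagrangian surface with tangent frame (z_1, k_1),
   (z_2, k_2), the number lag = z_1 k_2 - z_2 k_1 has |lag|^2 = - det of the induced
   metric, and vanishing of the mean curvature says that
   d arg lag = - 2 * (pull-back of omega). Hence the pull-back of d omega vanishes,
   so the metric is flat where the projection has rank two. If it has rank one,
   z_a = mu_a e with e a unit vector, and the Lagrangian condition makes lag a real
   multiple of i e^2; thus e is parallel along the surface, the projection is a
   geodesic with velocity e, and the component of the fibre along e is constant on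
   the level sets of the arclength. Rank zero would make the metric null. *)

(** * Smooth functions *)

(** The number [lag] is the value on the tangent frame of the complex area form dz ^ dk. In the
    lifted frame the Levi-Civita connection of the neutral metric sends (z, k) to (i omega z, lambda
    z + i omega k): it is complex linear, so it acts on this form through its complex trace 2 i
    omega. This is where the factor 2 comes from, and why the curvature term lambda, which is off
    the diagonal, has no influence on the angle. No argument function is ever chosen. With lag = p +
    i q, the angle equation is used as p dq - q dp + 2 omega (p^2 + q^2) = 0, which needs no branch
    and can be differentiated again. Christoffel symbols are reached through one characterization of
    the Levi-Civita connection in a moving frame, applied to the surface and then to its tangent
    bundle. In rank one the conclusion demands an actual curve and actual coordinates (s, t). The
    arclength s is a primitive of a 1-form; it is obtained by integrating a function of one
    variable, after a first change of coordinates in which a coordinate of the projected point is an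
    independent variable. A second change of coordinates then replaces this variable by s. *)

Section Calculus.
Context {R : realType}.
Implicit Types V W : normedModType R.

Lemma near_eq_differentiable V W (f g : V -> W) (x : V) :
  (\near x, f x = g x) -> differentiable f x -> differentiable g x.
Proof.
move=> fg df; have fgx := nbhs_singleton fg.
have dfc : continuous ('d f x) by exact: diff_continuous.
suff gE : g \o shift x = cst (g x) + 'd f x +o_ 0 id.
  by apply/diff_locallyP; rewrite (diff_unique dfc gE).
have /eqaddoP fE := diff_locally df.
apply/eqaddoP => e /fE H.
have fg0 : \forall h \near (0 : V), f (h + x) = g (h + x).
  by move: fg; rewrite (near_shift 0) subr0.
apply: filterS2 fg0 H => h; rewrite !fctE /= => ->.
by rewrite fgx.
Qed.

Lemma differentiable_mx V m n (f : V -> 'M[R]_(m, n)) x :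
  (forall i j, differentiable (fun y => f y i j) x) -> differentiable f x.
Proof.
move=> df.
have -> : f = \sum_i \sum_j (fun y => f y i j *: delta_mx i j).
  apply/funext => y; rewrite [LHS]matrix_sum_delta fct_sumE.
  by apply: eq_bigr => i _; rewrite fct_sumE.
apply: differentiable_sum => i; apply: differentiable_sum => j.
exact: differentiableZl.
Qed.

Lemma differentiable_entry V m n (f : V -> 'M[R]_(m, n)) x i j :
  differentiable f x -> differentiable (fun y => f y i j) x.
Proof.
move=> df; rewrite (_ : (fun y => _) = (fun N : 'M[R]_(m, n) => N i j : R) \o f)//.
by apply: differentiable_comp => //; exact: differentiable_coord.
Qed.

Lemma derive_entry V m n (f : V -> 'M[R]_(m, n)) x v i j :
  differentiable f x -> ('D_v f x) i j = 'D_v (fun y => f y i j) x.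
Proof. by move=> df; rewrite derive_mx ?mxE//; exact: diff_derivable. Qed.

Lemma continuous_entry V m n (f : V -> 'M[R]_(m, n)) x i j :
  {for x, continuous f} -> {for x, continuous (fun y => f y i j)}.
Proof.
move=> cf; apply: (@continuous_comp _ _ _ f (fun N : 'M[R]_(m, n) => N i j)) => //.
exact: coord_continuous.
Qed.

Lemma continuous_mx V m n (f : V -> 'M[R]_(m, n)) x :
  (forall i j, {for x, continuous (fun y => f y i j)}) -> {for x, continuous f}.
Proof.
move=> cf; apply/cvgrPdist_le => /= e e0; near=> y.
rewrite /Num.Def.normr/= mx_normrE (bigmax_le _ (ltW e0))//= => i _.
rewrite !mxE; move: i; near: y; apply: filter_forall => /= i.
exact: ((@cvgrPdist_le _ R^o _ _ _ _ _).1 (cf i.1 i.2)).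
Unshelve. all: by end_near. Qed.

Lemma derive_comp V V' W (g : V -> V') (f : V' -> W) x v :
  differentiable g x -> differentiable f (g x) ->
  'D_v (f \o g) x = 'D_('D_v g x) f (g x).
Proof.
move=> dg df; rewrite (deriveE v (differentiable_comp dg df)).
by rewrite (diff_comp dg df) /= (deriveE v dg) (deriveE _ df).
Qed.

Lemma derive_scalev V W (f : V -> W) x (c : R) v :
  differentiable f x -> 'D_(c *: v) f x = c *: 'D_v f x.
Proof. by move=> df; rewrite !(deriveE _ df) linearZ. Qed.

Lemma derive_sumv V W n (f : V -> W) x (c : 'I_n -> R) (e : 'I_n -> V) :
  differentiable f x ->
  'D_(\sum_i c i *: e i) f x = \sum_i c i *: 'D_(e i) f x.
Proof.
move=> df; rewrite deriveE// linear_sum; apply: eq_bigr => i _.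
by rewrite linearZ deriveE.
Qed.

End Calculus.

(** * Stability of the classes C^k under the usual operations *)

Section CkTheory.
Context {R : realType}.
Implicit Types V W : normedModType R.

Lemma Ck_diff V W k U (f : V -> W) x : Ck k.+1 U f -> U x -> differentiable f x.
Proof. by case=> + _; apply. Qed.

(** Openness lets an equality on [U] pass to derivatives: near a point of [U] only values on [U] are
    seen. *)
Lemma Ck_ext V W k U (f g : V -> W) : open U ->
  (forall x, U x -> f x = g x) -> Ck k U f -> Ck k U g.
Proof.
move=> oU; elim: k f g => [|k IH] f g fg /=.
  move=> cf x Ux; suff : g @ x --> f x by rewrite (fg x Ux).
  apply: cvg_trans (cf x Ux); apply: near_eq_cvg.
  by near=> y; apply: fg; near: y; exact: open_nbhs_nbhs.
have nfg x : U x -> \near x, f x = g x.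
  by move=> Ux; near=> y; apply: fg; near: y; exact: open_nbhs_nbhs.
move=> [df Df]; split=> [x Ux|v].
  by apply: near_eq_differentiable (df x Ux); exact: nfg.
apply: IH (Df v) => x Ux; apply: near_eq_derive; exact: nfg.
Unshelve. all: by end_near. Qed.

Lemma CkW V W k U (f : V -> W) : Ck k.+1 U f -> Ck k U f.
Proof.
elim: k f => [|k IH] f /= [df Df].
  by move=> x Ux; apply: differentiable_continuous; exact: df.
by split=> // v; exact/IH/Df.
Qed.

Lemma Ck_subset V W k (U U' : set V) (f : V -> W) :
  U' `<=` U -> Ck k U f -> Ck k U' f.
Proof.
move=> sU; elim: k f => [|k IH] f /=; first by move=> cf x /sU/cf.
by move=> [df Df]; split=> [x /sU/df//|v]; exact/IH/Df.
Qed.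

Lemma Ck_cst V W k U (c : W) : Ck k U (fun _ : V => c).
Proof.
elim: k c => [|k IH] c /=; first by move=> x _; exact: cvg_cst.
split=> [x _|v]; first exact: differentiable_cst.
rewrite (_ : 'D_v _ = fun _ => 0); first exact: IH.
by apply/funext => x; rewrite derive_cst.
Qed.

Lemma Ck_add V W k U (f g : V -> W) : open U ->
  Ck k U f -> Ck k U g -> Ck k U (fun x => f x + g x).
Proof.
move=> oU; elim: k f g => [|k IH] f g /=.
  by move=> cf cg x Ux; apply: cvgD; [exact: cf|exact: cg].
move=> [df Df] [dg Dg]; split=> [x Ux|v].
  by apply: differentiableD; [exact: df|exact: dg].
apply: Ck_ext oU _ (IH _ _ (Df v) (Dg v)) => x Ux.
by rewrite -deriveD//; apply: diff_derivable; [exact: df|exact: dg].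
Qed.

Lemma Ck_sum V W (I : Type) (r : seq I) (P : pred I) k U (f : I -> V -> W) :
  open U -> (forall i, P i -> Ck k U (f i)) ->
  Ck k U (fun x => \sum_(i <- r | P i) f i x).
Proof.
move=> oU H; elim: r => [|i r IH].
  by under eq_fun do rewrite big_nil; exact: Ck_cst.
have [Pi|nPi] := boolP (P i); under eq_fun do rewrite big_cons ?Pi ?(negbTE nPi).
  by apply: Ck_add => //; exact: H.
exact: IH.
Qed.

Lemma Ck_mul V k U (f g : V -> R) : open U ->
  Ck k U f -> Ck k U g -> Ck k U (fun x => f x * g x).
Proof.
move=> oU; elim: k f g => [|k IH] f g.
  by move=> cf cg x Ux; apply: cvgM; [exact: cf|exact: cg].
move=> sf sg; have [df Df] := sf; have [dg Dg] := sg; split=> [x Ux|v].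
  by apply: differentiableM; [exact: df|exact: dg].
apply: (@Ck_ext _ _ _ _ (fun x => f x * 'D_v g x + g x * 'D_v f x)) => //.
  move=> x Ux; rewrite [RHS](@deriveM _ _ f g)//; apply: diff_derivable;
    [exact: df|exact: dg].
by apply: Ck_add => //; apply: IH;
  [exact: CkW sf|exact: Dg|exact: CkW sg|exact: Df].
Qed.

Lemma Ck_opp V k U (f : V -> R) : open U ->
  Ck k U f -> Ck k U (fun x => - f x).
Proof.
move=> oU sf; under eq_fun do rewrite -mulN1r.
by apply: Ck_mul => //; exact: Ck_cst.
Qed.

Lemma Ck_sub V k U (f g : V -> R) : open U ->
  Ck k U f -> Ck k U g -> Ck k U (fun x => f x - g x).
Proof. by move=> oU sf sg; apply: Ck_add => //; exact: Ck_opp. Qed.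

(** The induction closes because the derivative - f^-2 f' contains only f^-1, already of class C^k,
    and f'. The square root below is treated in the same way. *)
Lemma Ck_inv V k U (f : V -> R) : open U -> (forall x, U x -> f x != 0) ->
  Ck k U f -> Ck k U (fun x => (f x)^-1).
Proof.
move=> oU f0; elim: k => [|k IH] sf.
  by move=> x Ux; apply: cvgV; [exact: f0|exact: sf].
have [df Df] := sf; split=> [x Ux|v].
  by apply: differentiableV; [exact: df|exact: f0].
apply: (@Ck_ext _ _ _ _ (fun x => - ((f x)^-1 * (f x)^-1) * 'D_v f x)) => //.
  move=> x Ux; rewrite [RHS](@deriveV _ _ f) ?f0//.
    by rewrite expr2 invfM.
  by apply: diff_derivable; exact: df.
have sf' := IH (CkW sf).
by apply: Ck_mul; [|apply: Ck_opp; [|exact: Ck_mul]|exact: Df].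
Qed.

Lemma Ck_sqrt V k U (f : V -> R) : open U -> (forall x, U x -> 0 < f x) ->
  Ck k U f -> Ck k U (fun x => Num.sqrt (f x)).
Proof.
move=> oU f0; elim: k => [|k IH] sf.
  move=> x Ux; apply: (@continuous_comp _ _ _ f Num.sqrt); first exact: sf.
  exact: sqrt_continuous.
have dsqrt x : U x -> differentiable (Num.sqrt : R -> R) (f x).
  by move=> Ux; apply/derivable1_diffP; have [] := is_derive1_sqrt (f0 _ Ux).
have [df Df] := sf; split=> [x Ux|v].
  by apply: (@differentiable_comp _ _ _ _ f Num.sqrt); [exact: df|exact: dsqrt].
apply: (@Ck_ext _ _ _ _ (fun x => 2^-1 * (Num.sqrt (f x))^-1 * 'D_v f x)) => //.
  move=> x Ux; rewrite [RHS](@derive_comp _ _ _ _ f Num.sqrt); [|exact: df|exact: dsqrt].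
  rewrite (deriveE _ (dsqrt x Ux)).
  rewrite -[X in 'd _ _ X]mulr1 -[X in 'd _ _ X]/(_ *: 1) linearZ /=.
  by rewrite -(deriveE _ (dsqrt x Ux)) derive_sqrt ?f0// invfM mulrC.
have si : Ck k U (fun x => (Num.sqrt (f x))^-1).
  apply: Ck_inv => //; last by apply: IH; exact: CkW.
  by move=> x /f0 fx0; rewrite gt_eqF// sqrtr_gt0.
by apply: Ck_mul; [|apply: Ck_mul; [|exact: Ck_cst|]|exact: Df].
Qed.

Lemma Ck_mx V m n k U (f : V -> 'M[R]_(m, n)) : open U ->
  (forall i j, Ck k U (fun x => f x i j)) -> Ck k U f.
Proof.
move=> oU; elim: k f => [|k IH] f sf.
  by move=> x Ux; apply: continuous_mx => i j; exact: sf.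
have df x : U x -> differentiable f x.
  by move=> Ux; apply: differentiable_mx => i j; exact: Ck_diff (sf i j) Ux.
split=> // v; apply: IH => i j; have [_ /(_ v)] := sf i j.
by apply: Ck_ext => // x Ux; rewrite derive_entry//; exact: df.
Qed.

Lemma Ck_entry V m n k U (f : V -> 'M[R]_(m, n)) i j : open U ->
  Ck k U f -> Ck k U (fun x => f x i j).
Proof.
move=> oU; elim: k f => [|k IH] f sf.
  by move=> x Ux; apply: continuous_entry; exact: sf.
have [df Df] := sf; split=> [x Ux|v].
  by apply: differentiable_entry; exact: df.
by apply: Ck_ext (IH _ (Df v)) => // x Ux; rewrite derive_entry//; exact: df.
Qed.

Lemma Ck_lin V W k U (f : {linear V -> W}) : continuous f -> Ck k U f.
Proof.
move=> cf; case: k => [x _|k]; first exact: cf.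
split=> [x _|v]; first exact: linear_differentiable.
rewrite (_ : 'D_v f = fun _ => f v); first exact: Ck_cst.
by apply/funext => x; rewrite deriveE ?diff_lin//; exact: linear_differentiable.
Qed.

(** In the chain rule the direction ['D_v g x] varies with [x], while [Ck] speaks of derivatives in
    fixed directions only. The derivative is therefore expanded over the standard basis, with
    coefficients of class C^k. *)
Lemma Ck_comp V n k U U' (g : V -> 'rV[R]_n) (f : 'rV[R]_n -> R) : open U ->
  (forall x, U x -> U' (g x)) -> Ck k U g -> Ck k U' f ->
  Ck k U (fun x => f (g x)).
Proof.
move=> oU gU; elim: k f => [|k IH] f sg sf.
  move=> x Ux; apply: (@continuous_comp _ _ _ g f); first exact: sg.
  by apply: sf; exact: gU.
have [df Df] := sf; have [dg Dg] := sg; split=> [x Ux|v].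
  by apply: (@differentiable_comp _ _ _ _ g f); [exact: dg|exact/df/gU].
apply: (@Ck_ext _ _ _ _ (fun x => \sum_(i < n)
   ('D_v g x) 0 i * 'D_(delta_mx 0 i) f (g x))) => //.
  move=> x Ux; rewrite [RHS](@derive_comp _ _ _ _ g f); [|exact: dg|exact/df/gU].
  by rewrite [in RHS](row_sum_delta ('D_v g x)) derive_sumv//; exact/df/gU.
apply: Ck_sum => // i _; apply: Ck_mul; first exact: oU.
  exact: Ck_entry oU (Dg v).
by apply: IH (Df _); exact: CkW.
Qed.

Lemma Ck_comp1 V k U U' (g : V -> R) (f : R -> R) : open U ->
  (forall x, U x -> U' (g x)) -> Ck k U g -> Ck k U' f ->
  Ck k U (fun x => f (g x)).
Proof.
move=> oU gU; elim: k f => [|k IH] f sg sf.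
  move=> x Ux; apply: (@continuous_comp _ _ _ g f); first exact: sg.
  by apply: sf; exact: gU.
have [df Df] := sf; have [dg Dg] := sg; split=> [x Ux|v].
  by apply: (@differentiable_comp _ _ _ _ g f); [exact: dg|exact/df/gU].
apply: (@Ck_ext _ _ _ _ (fun x => 'D_v g x * 'D_1 f (g x))) => //.
  move=> x Ux; rewrite [RHS](@derive_comp _ _ _ _ g f); [|exact: dg|exact/df/gU].
  rewrite !(deriveE _ (df _ (gU x Ux))).
  rewrite -[X in _ = 'd _ _ X]mulr1 -[X in _ = 'd _ _ X]/('D_v g x *: 1).
  by rewrite linearZ.
by apply: Ck_mul; [|exact: Dg|apply: IH (Df _); exact: CkW].
Qed.

Lemma smooth_ext V W U (f g : V -> W) : open U ->
  (forall x, U x -> f x = g x) -> smooth_on U f -> smooth_on U g.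
Proof. by move=> oU fg sf k; exact: Ck_ext (sf k). Qed.

Lemma smooth_diff V W U (f : V -> W) x : smooth_on U f -> U x ->
  differentiable f x.
Proof. by move=> sf; exact: Ck_diff (sf 1%N). Qed.

Lemma smooth_derive V W U (f : V -> W) v : smooth_on U f -> smooth_on U ('D_v f).
Proof. by move=> sf k; have [_] := sf k.+1; exact. Qed.

Lemma smooth_subset V W (U U' : set V) (f : V -> W) :
  U' `<=` U -> smooth_on U f -> smooth_on U' f.
Proof. by move=> sU sf k; exact: Ck_subset (sf k). Qed.

Lemma smooth_comp V n m p U U' (g : V -> 'rV[R]_n) (f : 'rV[R]_n -> 'M[R]_(m, p)) :
  open U -> open U' -> (forall x, U x -> U' (g x)) -> smooth_on U g ->
  smooth_on U' f -> smooth_on U (f \o g).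
Proof.
move=> oU oU' gU sg sf k; apply: Ck_mx => // i j.
by apply: (@Ck_comp _ _ _ _ U' g (fun x => f x i j)) => //; exact: Ck_entry.
Qed.

End CkTheory.

(** * Mean value theorem and symmetry of second derivatives *)

Section MeanValue.
Context {R : realType}.
Implicit Types V : normedModType R.

Lemma is_derive_line V (W : normedModType R) (f : V -> W) (x v : V) (t : R) :
  differentiable f (x + t *: v) ->
  is_derive t 1 (fun s => f (x + s *: v)) ('D_v f (x + t *: v)).
Proof.
move=> df.
have dl : is_diff t (fun s : R => x + s *: v) ( *:%R^~ v).
  have -> : ( *:%R^~ v) = (0 + *:%R^~ v) :> (R -> V) by rewrite add0r.
  rewrite -[fun s : R => _]/(cst x + ( *:%R^~ v)).
  exact: is_diffD.
have dc : differentiable (f \o (fun s : R => x + s *: v)) t.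
  exact: differentiable_comp.
apply: DeriveDef; first exact: diff_derivable.
rewrite (deriveE _ dc) diff_comp//= (deriveE _ df).
by rewrite diff_val scale1r.
Qed.

Lemma mvt_line V (f : V -> R) (x v : V) :
  (forall t : R, 0 <= t <= 1 -> differentiable f (x + t *: v)) ->
  exists2 t : R, 0 <= t <= 1 & f (x + v) - f x = 'D_v f (x + t *: v).
Proof.
move=> df.
have [||t t01] := @MVT_segment R (fun t => f (x + t *: v))
    (fun t => 'D_v f (x + t *: v)) 0 1 ler01.
- move=> t; rewrite in_itv /= => /andP[t0 t1]; apply: is_derive_line.
  by apply: df; rewrite !ltW.
- apply: derivable_within_continuous => t; rewrite in_itv /= => t01.
  by have [] := is_derive_line (df t t01).
by rewrite scale1r scale0r addr0 subr0 mulr1 => ->; exists t.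
Qed.

Lemma diff_eps V (W : normedModType R) (f : V -> W) x : differentiable f x ->
  forall e : R, 0 < e ->
  \forall h \near 0, `|f (x + h) - f x - 'd f x h| <= e * `|h|.
Proof.
move=> df e e0; have /eqaddoP/(_ e e0) := diff_locally df.
apply: filterS => h; rewrite !fctE /= (addrC h); apply: le_trans.
by rewrite opprD addrA.
Qed.

Lemma is_diff_eps V (W : normedModType R) (f : V -> W) x (L : {linear V -> W}) :
  continuous L ->
  (forall e : R, 0 < e ->
    \forall h \near 0, `|f (x + h) - f x - L h| <= e * `|h|) ->
  is_diff x f L.
Proof.
move=> cL H.
suff gE : f \o shift x = cst (f x) + L +o_ 0 id.
  have dE := diff_unique cL gE.
  by apply: DiffDef => //; apply/diff_locallyP; rewrite dE.
apply/eqaddoP => e /H; apply: filterS => h; rewrite !fctE /= (addrC h).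
by apply: le_trans; rewrite opprD addrA.
Qed.

(** Mean value theorem for y |-> f (y + s w) - f y along s v, followed by the first-order expansion
    of ['D_v f] at [x], used at both points that the mean value theorem produces. *)
Lemma second_difference V (U : set V) (f : V -> R) x v w :
  open U -> U x -> (forall y, U y -> differentiable f y) ->
  differentiable ('D_v f) x ->
  forall e : R, 0 < e -> \forall s \near 0^'+,
   `|f (x + s *: v + s *: w) - f (x + s *: v) - f (x + s *: w) + f x
     - s ^+ 2 * 'D_w ('D_v f) x| <= e * s ^+ 2.
Proof.
move=> oU Ux df ddf e e0.
(* [s * c] bounds all offsets t s v + b s w with t, b in [0, 1]; the summand 1 makes [c] positive.
   Each of the two expansions errs by at most e / (2 c) times s c, whence e s^2 in total after the
   factor s. *)
pose c := `|v| + `|w| + 1.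
have c0 : 0 < c by rewrite ltr_wpDl ?addr_ge0.
have e2 : 0 < e / (2 * c) by rewrite divr_gt0 ?mulr_gt0.
have H := diff_eps ddf e2.
have HU : \forall h \near (0 : V), U (x + h).
  have : \forall y \near x, U y by exact: open_nbhs_nbhs.
  by rewrite (near_shift 0) subr0; apply: filterS => h /=; rewrite addrC.
have : \forall h \near (0 : V), U (x + h) /\
   `|'D_v f (x + h) - 'D_v f x - 'd ('D_v f) x h| <= e / (2 * c) * `|h|.
  exact: filterI.
case/nbhs_ballP => r /= r0 Hr.
near=> s.
have s0 : 0 < s by near: s; exact: nbhs_right_gt.
have sc : s * c < r.
  by rewrite -ltr_pdivlMr//; near: s; apply: nbhs_right_lt; rewrite divr_gt0.
have small (t b : R) : 0 <= t <= 1 -> 0 <= b <= 1 ->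
    `|t *: (s *: v) + b *: (s *: w)| <= s * c.
  move=> /andP[t0 t1] /andP[b0 b1].
  apply: (le_trans (ler_normD _ _)).
  rewrite !normrZ !(ger0_norm t0, ger0_norm b0, gtr0_norm s0) /c.
  rewrite mulrDr mulr1 mulrDr; apply: ler_wpDr; [exact: ltW|apply: lerD].
    by rewrite ler_piMl// mulr_ge0// ltW.
  by rewrite ler_piMl// mulr_ge0// ltW.
have inball (t b : R) : 0 <= t <= 1 -> 0 <= b <= 1 ->
    ball (0 : V) r (t *: (s *: v) + b *: (s *: w)).
  move=> t01 b01; rewrite -ball_normE /= sub0r normrN.
  exact: le_lt_trans (small _ _ t01 b01) sc.
have o01 : 0 <= (1 : R) <= 1 by rewrite lexx ler01.
have z01 : 0 <= (0 : R) <= 1 by rewrite lexx ler01.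
pose T (y : V) := s *: w + y.
have dT y : differentiable T y.
  by apply: differentiableD => //; exact: differentiable_cst.
have DT y u : 'D_u T y = u.
  rewrite [LHS](@deriveD _ _ _ (cst (s *: w)) id)//.
  by rewrite derive_cst derive_id add0r.
have TE t : T (x + t *: (s *: v)) = x + (t *: (s *: v) + 1 *: (s *: w)).
  by rewrite /T scale1r addrCA [s *: w + _]addrC.
have dfT t : 0 <= t <= 1 -> differentiable f (T (x + t *: (s *: v))).
  by move=> t01; apply: df; have [] := Hr _ (inball _ _ t01 o01); rewrite TE.
have dphi1 t : 0 <= t <= 1 -> differentiable (f \o T) (x + t *: (s *: v)).
  by move=> t01; apply: differentiable_comp => //; exact: dfT.
have df' t : 0 <= t <= 1 -> differentiable f (x + t *: (s *: v)).
  move=> t01; apply: df; have [] := Hr _ (inball _ _ t01 z01).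
  by rewrite scale0r addr0.
pose phi := (f \o T) - f.
have dphi t : 0 <= t <= 1 -> differentiable phi (x + t *: (s *: v)).
  by move=> t01; apply: differentiableB; [exact: dphi1|exact: df'].
have [t t01 phiE] := mvt_line dphi.
have Dphi : 'D_(s *: v) phi (x + t *: (s *: v)) =
   s * ('D_v f (x + (t *: (s *: v) + 1 *: (s *: w))) -
        'D_v f (x + (t *: (s *: v) + 0 *: (s *: w)))).
  rewrite deriveB; last 2 first.
  - by apply: diff_derivable; exact: dphi1.
  - by apply: diff_derivable; exact: df'.
  rewrite (derive_comp _ (dT _) (dfT _ t01)) DT.
  rewrite (derive_scalev _ _ (df' _ t01)) (derive_scalev _ _ (dfT _ t01)) TE.
  by rewrite -scalerBr scale0r addr0.
have [_ H1] := Hr _ (inball _ _ t01 o01).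
have [_ H0] := Hr _ (inball _ _ t01 z01).
have -> : f (x + s *: v + s *: w) - f (x + s *: v) - f (x + s *: w) + f x =
   phi (x + s *: v) - phi x.
  rewrite /phi !fctE /= /T [s *: w + _]addrC [s *: w + x]addrC.
  move: (f _) (f _) (f _) (f _) => a1 a2 a3 a4; ring.
rewrite phiE Dphi.
move: H1 H0.
set p1 := 'D_v f (_ + (_ + 1 *: _)); set p0 := 'D_v f (_ + (_ + 0 *: _)).
set q := 'D_v f x.
set h1 := _ + 1 *: _; set h0 := _ + 0 *: _ => H1 H0.
have dd : 'd ('D_v f) x h1 - 'd ('D_v f) x h0 = s * 'D_w ('D_v f) x.
  rewrite -linearB /h1 /h0 scale0r addr0 addrAC subrr add0r scale1r linearZ /=.
  by rewrite -(deriveE _ ddf).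
have Hh1 : `|h1| <= s * c by exact: small.
have Hh0 : `|h0| <= s * c by exact: small.
have -> : s * (p1 - p0) - s ^+ 2 * 'D_w ('D_v f) x =
   s * ((p1 - q - 'd ('D_v f) x h1) - (p0 - q - 'd ('D_v f) x h0)).
  rewrite expr2 -mulrA -dd.
  move: ('d _ _ _) ('d _ _ _) => a1 a2; ring.
rewrite normrM (gtr0_norm s0).
rewrite (_ : e * s ^+ 2 = s * (e / (2 * c) * (s * c) + e / (2 * c) * (s * c))); last first.
  by field; rewrite gt_eqF.
apply: ler_wpM2l; first exact: ltW.
apply: (le_trans (ler_normB _ _)); apply: lerD.
  by apply: (le_trans H1); apply: ler_wpM2l => //; exact: ltW.
by apply: (le_trans H0); apply: ler_wpM2l => //; exact: ltW.
Unshelve. all: by end_near. Qed.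

(** The second difference is symmetric in [v] and [w]; divided by s^2, it is within e / 2 of both
    mixed derivatives. *)
Lemma derive_commute V (U : set V) (f : V -> R) x v w :
  open U -> U x -> (forall y, U y -> differentiable f y) ->
  differentiable ('D_v f) x -> differentiable ('D_w f) x ->
  'D_v ('D_w f) x = 'D_w ('D_v f) x.
Proof.
move=> oU Ux df dv dw; apply/eqP; rewrite -subr_eq0 -normr_le0.
apply/ler_addgt0Pr => e e0; rewrite add0r.
have e2 : 0 < e / 2 by rewrite divr_gt0.
have H1 := second_difference w oU Ux df dv e2.
have H2 := second_difference v oU Ux df dw e2.
have H0 : \forall s \near (0 : R)^'+, 0 < s by exact: nbhs_right_gt.
have [s [[{}H1 {}H2] s0]] := filter_ex (filterI (filterI H1 H2) H0).
have s20 : 0 < s ^+ 2 by rewrite exprn_gt0.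
rewrite -(ler_pM2r s20) -[X in _ * X <= _]gtr0_norm// -normrM.
move: H1 H2; rewrite [x + s *: w + _]addrAC.
move: ('D_v _ _) ('D_w _ _) => b a.
move: (f _) (f _) (f _) (f _) => a4 a3 a2 a1 H1 H2.
rewrite (_ : (b - a) * s ^+ 2 =
  (a1 - a2 - a3 + a4 - s ^+ 2 * a) - (a1 - a3 - a2 + a4 - s ^+ 2 * b)); last by ring.
apply: (le_trans (ler_normB _ _)).
rewrite (_ : e * s ^+ 2 = e / 2 * s ^+ 2 + e / 2 * s ^+ 2); last by field.
exact: lerD.
Qed.

Lemma smooth_derive_commute V (U : set V) (f : V -> R) x v w :
  open U -> U x -> smooth_on U f -> 'D_v ('D_w f) x = 'D_w ('D_v f) x.
Proof.
move=> oU Ux sf; apply: (derive_commute oU Ux).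
- by move=> y; exact: smooth_diff.
- exact: smooth_diff (smooth_derive v sf) Ux.
- exact: smooth_diff (smooth_derive w sf) Ux.
Qed.

End MeanValue.

(** * Inverse function theorem *)

Section MatrixNorm.
Context {R : realType}.

Lemma in_ballE (V : normedModType R) (x y : V) (r : R) :
  ball x r y = (`|x - y| < r) :> Prop.
Proof. by rewrite -ball_normE. Qed.

Lemma ball_segment (V : normedModType R) (c x y : V) (r t : R) :
  ball c r x -> ball c r y -> 0 <= t <= 1 -> ball c r (x + t *: (y - x)).
Proof.
rewrite !in_ballE => Bx By /andP[t0 t1].
have -> : c - (x + t *: (y - x)) = (1 - t) *: (c - x) + t *: (c - y).
  rewrite !scalerBr !scalerBl !scale1r addrACA -!opprD; congr (_ - _).
    by rewrite subrK.
  by rewrite addrAC -addrA.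
apply: (le_lt_trans (ler_normD _ _)).
rewrite !normrZ (ger0_norm t0) ger0_norm ?subr_ge0//.
have [->|tn0] := eqVneq t 0; first by rewrite subr0 mul1r mul0r addr0.
have t0' : 0 < t by rewrite lt_neqAle eq_sym tn0.
rewrite (_ : r = (1 - t) * r + t * r); last by ring.
apply: ler_ltD; last by rewrite ltr_pM2l.
by apply: ler_wpM2l; [rewrite subr_ge0|exact: ltW].
Qed.

Lemma normr_entry_le m n (v : 'M[R]_(m, n)) i j : `|v i j| <= `|v|.
Proof.
rewrite [leRHS]/Num.Def.normr/= mx_normrE.
exact: (le_bigmax _ (fun ij : 'I_m * 'I_n => `|v ij.1 ij.2|) (i, j)).
Qed.

Lemma normr_le_entry m n (v : 'M[R]_(m, n)) (c : R) :
  0 <= c -> (forall i j, `|v i j| <= c) -> `|v| <= c.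
Proof.
by move=> c0 H; rewrite /Num.Def.normr/= mx_normrE (bigmax_le _ c0).
Qed.

Lemma normr_mulmx_le n p (v : 'rV[R]_n) (A : 'M[R]_(n, p)) (c : R) :
  0 <= c -> (forall i j, `|A i j| <= c) -> `|v *m A| <= n%:R * c * `|v|.
Proof.
move=> c0 H; apply: normr_le_entry => [|i j]; first by rewrite !mulr_ge0.
rewrite mxE; apply: (le_trans (ler_norm_sum _ _ _)).
rewrite -mulrA mulr_natl -[n in _ *+ n]card_ord -sumr_const.
apply: ler_sum => k _; rewrite normrM mulrC; apply: ler_pM => //.
exact: normr_entry_le.
Qed.

Lemma continuous_mulmxr n p (A : 'M[R]_(n, p)) :
  continuous (fun v : 'rV[R]_n => v *m A).
Proof.
move=> v; apply: continuous_mx => i j.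
have H : Ck 0 setT (fun w : 'rV[R]_n => \sum_k w 0 k * A k j).
  apply: Ck_sum => [|k _]; first exact: openT.
  apply: Ck_mul; [exact: openT| |exact: Ck_cst].
  by move=> x _; exact: coord_continuous.
rewrite (_ : (fun w => _) = (fun w : 'rV[R]_n => \sum_k w 0 k * A k j)).
  exact: H.
by apply/funext => w; rewrite mxE !ord1.
Qed.

Lemma jacobian_entry n p (f : 'rV[R]_n -> 'rV[R]_p) x i j :
  differentiable f x ->
  ('J f x) i j = 'D_(delta_mx 0 i) (fun y => f y 0 j) x.
Proof.
by move=> df; rewrite mxE -(deriveE _ df) derive_entry.
Qed.

Lemma Ck_prod (V : normedModType R) (I : Type) (r : seq I) (P : pred I) k U
    (f : I -> V -> R) : open U -> (forall i, P i -> Ck k U (f i)) ->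
  Ck k U (fun x => \prod_(i <- r | P i) f i x).
Proof.
move=> oU H; elim: r => [|i r IH].
  by under eq_fun do rewrite big_nil; exact: Ck_cst.
have [Pi|nPi] := boolP (P i); under eq_fun do rewrite big_cons ?Pi ?(negbTE nPi).
  by apply: Ck_mul => //; exact: H.
exact: IH.
Qed.

Lemma Ck_det (V : normedModType R) n k U (A : V -> 'M[R]_n) : open U ->
  (forall i j, Ck k U (fun x => A x i j)) -> Ck k U (fun x => \det (A x)).
Proof.
move=> oU H; rewrite /determinant; apply: Ck_sum => // s _.
by apply: Ck_mul => //; [exact: Ck_cst|apply: Ck_prod].
Qed.

Lemma Ck_invmx (V : normedModType R) n k U (A : V -> 'M[R]_n) i j : open U ->
  (forall x, U x -> A x \in unitmx) ->
  (forall i j, Ck k U (fun x => A x i j)) ->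
  Ck k U (fun x => invmx (A x) i j).
Proof.
move=> oU uA H.
apply: (@Ck_ext _ _ _ _ _ (fun x => (\det (A x))^-1 * cofactor (A x) j i)) => //.
  by move=> x /uA Ax; rewrite /invmx Ax !mxE.
apply: Ck_mul => //.
  apply: Ck_inv => //; last exact: Ck_det.
  by move=> x /uA; rewrite unitmxE unitfE.
rewrite /cofactor; apply: Ck_mul => //; first exact: Ck_cst.
apply: Ck_det => // i' j'.
by under eq_fun do rewrite !mxE; exact: H.
Qed.

End MatrixNorm.

(** Completeness of matrices as a normed module, for the fixed point theorem used next. *)
HB.instance Definition _ (R : realType) m n := Complete.on 'M[R]_(m, n).

Section InverseFunction.
Context {R : realType} {n : nat}.
Implicit Types (f g : 'rV[R]_n -> 'rV[R]_n).

(** Solving f x = y amounts to finding a fixed point of x |-> x - f x T + y T, where T inverts the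
    Jacobian at [a]; this map is a contraction of ratio 1/2 near [a]. The image is a full ball, so
    that later its slices and segments stay inside it. *)
Lemma inverse_function (U : set 'rV[R]_n) f a :
  open U -> U a -> smooth_on U f -> 'J f a \in unitmx ->
  exists (N : set 'rV[R]_n) (d : R) (g : 'rV[R]_n -> 'rV[R]_n),
  [/\ [/\ open N, N a, N `<=` U & 0 < d],
      forall y, ball (f a) d y -> N (g y) /\ f (g y) = y,
      forall x, N x -> ball (f a) d (f x) /\ g (f x) = x &
      smooth_on (ball (f a) d) g].
Proof.
move=> oU Ua sf uJ.
have df x : U x -> differentiable f x by move=> Ux; exact: smooth_diff sf Ux.
pose T : 'M[R]_n := invmx ('J f a).
pose E (x : 'rV[R]_n) : 'M[R]_n := 1%:M - 'J f x *m T.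
have sJ i j : smooth_on U (fun x => ('J f x) i j).
  move=> k; apply: (@Ck_ext _ _ _ _ _ ('D_(delta_mx 0 i) (fun y => f y 0 j))) => //.
    by move=> x Ux; rewrite jacobian_entry//; exact: df.
  by have [_ +] := Ck_entry 0 j oU (sf k.+1); apply.
have sE i j : Ck 0 U (fun x => E x i j).
  rewrite (_ : (fun x => _) =
      fun x => (1%:M : 'M[R]_n) i j - \sum_k ('J f x) i k * T k j); last first.
    by apply/funext => x; rewrite !mxE.
  apply: Ck_sub => //; first exact: Ck_cst.
  apply: Ck_sum => // k _; apply: Ck_mul => //; last exact: Ck_cst.
  exact: (sJ _ _ 0%N).
have Ea : E a = 0 by rewrite /E mulmxV// subrr.
(* Entries of [E x], the Jacobian of [phi] below, bounded by [e] give |v E x| <= n e |v| <= |v| / 2.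
   Using n + 1 instead of n keeps [e] meaningful for n = 0. *)
pose e : R := (2 * n.+1%:R)^-1.
have e0 : 0 < e by rewrite invr_gt0 mulr_gt0.
have ne : n%:R * e <= 2^-1.
  by rewrite ler_pdivrMr ?mulr_gt0// mulKf// ler_nat.
have nearE : \forall x \near a, U x /\ forall i j, `|E x i j| <= e.
  apply: filterI; first exact: open_nbhs_nbhs.
  have : \forall x \near a, forall ij : 'I_n * 'I_n, `|E x ij.1 ij.2| <= e.
    apply: (@filter_forall _ _ (fun ij : 'I_n * 'I_n =>
      [set x | `|E x ij.1 ij.2| <= e]) (nbhs a) _) => -[i j] /=.
    have /cvgrPdist_le/(_ e e0) := sE i j a Ua.
    by apply: filterS => x; rewrite Ea mxE sub0r normrN.
  by apply: filterS => x H i j; exact: (H (i, j)).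
have [r /= r0 Hr] := (nbhs_ballP _ _).1 nearE.
have EB (v x : 'rV[R]_n) : ball a r x -> `|v *m E x| <= 2^-1 * `|v|.
  move=> /Hr[_ Hx]; apply: (le_trans (normr_mulmx_le _ (ltW e0) Hx)).
  by rewrite ler_wpM2r.
(* If v J = 0 then v = v E x, whose norm is at most |v| / 2, so v = 0. *)
have uB x : ball a r x -> 'J f x \in unitmx.
  move=> Bx; rewrite -row_free_unit -kermx_eq0; apply/eqP/row_matrixP => i.
  rewrite row0; set v := row i _.
  have vJ : v *m 'J f x = 0 by rewrite -row_mul mulmx_ker row0.
  have := EB v x Bx; rewrite /E mulmxBr mulmx1 mulmxA vJ mul0mx subr0 => vv.
  by apply/eqP; rewrite -normr_le0; have := normr_ge0 v; lra.
pose C := n%:R * `|T|.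
have C0 : 0 <= C by rewrite mulr_ge0.
have CT (v : 'rV[R]_n) : `|v *m T| <= C * `|v|.
  by apply: normr_mulmx_le => // i j; exact: normr_entry_le.
pose phi x := x - f x *m T.
have dT x : differentiable (mulmxr T : 'rV[R]_n -> 'rV[R]_n) x.
  exact/linear_differentiable/continuous_mulmxr.
have df1 x : ball a r x -> differentiable ((mulmxr T : 'rV[R]_n -> 'rV[R]_n) \o f) x.
  by move=> /Hr[Ux _]; apply: differentiable_comp; [exact: df|exact: dT].
have dphi x : ball a r x -> differentiable phi x.
  move=> Bx; apply: (@differentiableB _ _ _ id); first by [].
  exact: df1.
have Dphi (x v : 'rV[R]_n) : ball a r x -> 'D_v phi x = v *m E x.
  move=> Bx; have [Ux _] := Hr _ Bx.
  have dphi1 := @deriveB _ _ _ id _ x v (@derivable_id _ _ x v) (diff_derivable (df1 _ Bx)).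
  rewrite [LHS]dphi1 derive_id (derive_comp _ (df _ Ux) (dT _)).
  rewrite (deriveE _ (dT _)) diff_lin /=; last exact: continuous_mulmxr.
  by rewrite deriveEjacobian ?mulmxBr ?mulmx1 ?mulmxA//; exact: df.
have Lphi x y : ball a r x -> ball a r y -> `|phi y - phi x| <= 2^-1 * `|y - x|.
  move=> Bx By; apply: normr_le_entry => [|i j]; first by rewrite mulr_ge0.
  have dline (t : R) : 0 <= t <= 1 ->
      differentiable (fun z => phi z i j) (x + t *: (y - x)).
    by move=> t01; apply: differentiable_entry; apply: dphi; exact: ball_segment.
  have [t t01] := mvt_line dline; rewrite subrKC => E1.
  have Bt := ball_segment Bx By t01.
  have -> : (phi y - phi x) i j = phi y i j - phi x i j.
    by rewrite [LHS]mxE [X in _ + X]mxE.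
  rewrite E1 -derive_entry; last exact: dphi.
  by rewrite Dphi//; apply: le_trans (EB _ _ Bt); exact: normr_entry_le.
(* The contraction estimate for [phi] absorbs half of |y - x|. This gives both the injectivity of
   [f] on the ball and the Lipschitz bound of its inverse. *)
have Linv x y : ball a r x -> ball a r y -> `|y - x| <= 2 * C * `|f y - f x|.
  move=> Bx By; have := Lphi _ _ Bx By.
  have -> : phi y - phi x = (y - x) - (f y - f x) *m T.
    by rewrite mulmxBl /phi; apply/matrixP => i j; rewrite !mxE; ring.
  move=> H; have := CT (f y - f x).
  have : `|y - x| <= `|(y - x) - (f y - f x) *m T| + `|(f y - f x) *m T|.
    by rewrite -[X in `|X| <= _](subrK ((f y - f x) *m T)); exact: ler_normD.
  move: H; set A := _ - _ *m T; set B := _ *m T; set D := y - x; set F := _ - f x.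
  by move: `|A| `|B| `|D| `|F| => p q s t; lra.
(* This radius makes C |f a - y| at most r / 4. On the closed ball of radius r / 2 the contraction
   contributes at most another r / 4, so [psi] maps that ball to itself. *)
pose d := r / (4 * (C + 1)).
have d0 : 0 < d by rewrite divr_gt0// mulr_gt0// ltr_wpDl.
have Ba : ball a r a by exact: ballxx.
have surj y : ball (f a) d y -> exists2 x, ball a r x & f x = y.
  move=> By; pose K := closed_ball_ Num.norm a (r / 2).
  have KB x : K x -> ball a r x.
    rewrite /K /closed_ball_ /= -ball_normE /= => H; apply: (le_lt_trans H).
    by rewrite ltr_pdivrMr// ltr_pMr// ltr1n.
  pose psi x := phi x + y *m T.
  have psiK x : K x -> K (psi x).
    move=> Kx; rewrite /K /closed_ball_ /=.
    have -> : a - psi x = (phi a - phi x) + (f a - y) *m T.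
      by rewrite /psi /phi mulmxBl; apply/matrixP => i j; rewrite !mxE; ring.
    apply: (le_trans (ler_normD _ _)).
    have H1 := Lphi _ _ (KB _ Kx) Ba.
    have H2 := CT (f a - y).
    have H3 : C * `|f a - y| <= r / 4.
      have : `|f a - y| <= d by move: By; rewrite -ball_normE /= => /ltW.
      move/(ler_wpM2l C0)/le_trans; apply.
      rewrite /d; rewrite [X in _ <= X](_ : _ = (C + 1) * (r / (4 * (C + 1)))).
        by apply: ler_wpM2r; [exact: ltW d0|rewrite lerDl].
      by field; rewrite gt_eqF// ltr_wpDl.
    move: Kx; rewrite /K /closed_ball_ /= => Kx.
    move: H1 H2 H3 Kx; set A := phi _ - _; set B := _ *m T; set D := a - x.
    by move: `|A| `|B| `|D| (C * _) => p q s t; lra.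
  have psiF : set_fun K K psi by move=> x /= Kx; exact: psiK.
  pose Fm := isFun.Build _ _ K K psi psiF.
  pose F : {fun K >-> K} := HB.pack psi Fm.
  have [|||p Kp pF] := @banach_fixed_point R _ K F.
  - have h0 : 0 <= 2^-1 :> R by rewrite invr_ge0.
    exists (NngNum h0).
    split => /=; first by rewrite invf_lt1// ltr1n.
    move=> [x z] [/= Kx Kz].
    rewrite /psi opprD addrACA subrr addr0.
    by apply: Lphi; exact: KB.
  - exact: closed_closed_ball_.
  - by exists a; rewrite /K /closed_ball_ /= subrr normr0 divr_ge0// ltW.
  exists p; first exact: KB.
  move: pF; rewrite /= /psi /phi => /eqP; rewrite -subr_eq0 => /eqP pF.
  have : (f p - y) *m T = 0.
    by rewrite -pF mulmxBl; apply/matrixP => i j; rewrite !mxE; ring.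
  move=> /(congr1 (mulmx^~ ('J f a))); rewrite -mulmxA mulVmx// mulmx1 mul0mx.
  by move/eqP; rewrite subr_eq0 => /eqP.
(* Outside the image of the ball the value is the default [a]; only values on [ball (f a) d] are
   used. *)
pose g y := xget a [set x | ball a r x /\ f x = y].
have gP y : ball (f a) d y -> ball a r (g y) /\ f (g y) = y.
  move=> /surj[x Bx fx].
  by apply: (@xgetPex _ a [set x | ball a r x /\ f x = y]); exists x.
pose N := ball a r `&` f @^-1` ball (f a) d.
have gK x : N x -> g (f x) = x.
  move=> [Bx Bfx]; have [Bg fg] := gP _ Bfx.
  apply/esym/eqP; rewrite -subr_eq0 -normr_le0.
  by have := Linv _ _ Bg Bx; rewrite fg subrr normr0 mulr0.
have oN : open N.
  rewrite openE => x [Bx Bfx]; apply: filterI.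
    by apply: open_nbhs_nbhs; split=> //; exact: ball_open.
  have [Ux _] := Hr _ Bx; apply: (differentiable_continuous (df _ Ux)).
  by apply: open_nbhs_nbhs; split=> //; exact: ball_open.
have gN y : ball (f a) d y -> N (g y).
  by move=> By; have [Bg fg] := gP _ By; split=> //=; rewrite fg.
have dg y : ball (f a) d y -> is_diff y g (mulmxr (invmx ('J f (g y)))).
  move=> By; have [Bx fx] := gP _ By; have [Ux _] := Hr _ Bx.
  set x := g y in Bx fx Ux *; set A := invmx _.
  apply: is_diff_eps => [|e1 e10]; first exact: continuous_mulmxr.
  pose CA := n%:R * `|A|; have CA0 : 0 <= CA by rewrite mulr_ge0.
  (* The increment h of [g] is at most 2 C |k|, the expansion of [f] costs e' |h|, and the inverse
     Jacobian multiplies by at most [CA]; the product is at most e1 |k|. *)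
  pose e' := e1 / (2 * C * CA + 1).
  have den : 0 < 2 * C * CA + 1 by rewrite ltr_wpDl// !mulr_ge0.
  have e'0 : 0 < e' by rewrite divr_gt0.
  have e'E : e' * (2 * C * CA + 1) = e1 by rewrite divfK// gt_eqF.
  clearbody e'.
  have [r1 /= r10 Hr1] := (nbhs_ballP _ _).1 (diff_eps (df _ Ux) e'0).
  have nearB : \forall k \near 0, ball (f a) d (y + k).
    have : \forall z \near y, ball (f a) d z.
      by apply: open_nbhs_nbhs; split=> //; exact: ball_open.
    by rewrite (near_shift 0) subr0; apply: filterS => k /=; rewrite addrC.
  have den1 : 0 < 2 * C + 1.
    by apply: ltr_wpDl; [apply: mulr_ge0 => //; exact: ler0n|exact: ltr01].
  have den2 : 0 < r1 / (2 * C + 1) by exact: divr_gt0.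
  have nears : \forall k \near (0 : 'rV[R]_n), `|k| < r1 / (2 * C + 1).
    have := nbhsx_ballx (0 : 'rV[R]_n) _ den2.
    by apply: filterS => k; rewrite in_ballE sub0r normrN.
  apply: filterS2 nearB nears => k Bk sk.
  have [Bgk fgk] := gP _ Bk.
  set h := g (y + k) - x.
  have hk : `|h| <= 2 * C * `|k|.
    by have := Linv _ _ Bx Bgk; rewrite fgk fx addrAC subrr add0r.
  have hr1 : ball (0 : 'rV[R]_n) r1 h.
    rewrite in_ballE sub0r normrN; apply: (le_lt_trans hk).
    have k0 := normr_ge0 k.
    move: sk; rewrite (ltr_pdivlMr _ _ den1); apply: le_lt_trans.
    by rewrite mulrDr mulr1 [leLHS]mulrC lerDl.
  have xh : x + h = g (y + k) by rewrite /h subrKC.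
  have yk : y + k - y = k by rewrite addrAC subrr add0r.
  have H := Hr1 _ hr1; rewrite xh fgk fx yk in H.
  have hJ : 'd f x h = h *m 'J f x by rewrite -(deriveE _ (df _ Ux)) deriveEjacobian//; exact: df.
  have -> : h - mulmxr A k = - ((k - 'd f x h) *m A).
    by rewrite mulmxBl hJ -mulmxA mulmxV ?uB// mulmx1 opprB.
  rewrite normrN.
  have H2 : `|(k - 'd f x h) *m A| <= CA * `|k - 'd f x h|.
    by apply: normr_mulmx_le => // i j; exact: normr_entry_le.
  move: H H2 hk; move: `|k - _| `|_ *m A| `|h| `|k| (normr_ge0 k) => p q s t t0.
  move=> ps qp st; apply: (le_trans qp).
  have H3 : CA * p <= CA * (e' * (2 * C * t)).
    apply: ler_wpM2l; first exact: CA0.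
    by apply: (le_trans ps); apply: ler_wpM2l; [exact: (ltW e'0)|exact: st].
  apply: (le_trans H3); rewrite -e'E.
  rewrite (_ : CA * _ = e' * (2 * C * CA) * t); last by ring.
  apply: ler_wpM2r; first exact: t0.
  by apply: ler_wpM2l; [exact: (ltW e'0)|rewrite lerDl ler01].
exists N, d, g; split.
- split=> //; first by split=> //=; exact: ballxx.
  by move=> x [/Hr[]].
- by move=> y By; split; [exact: gN|have [] := gP _ By].
- by move=> x Nx; split; [case: Nx|exact: gK].
(* Bootstrap: the derivative of [g] is [v *m invmx ('J f (g y))], where [g] occurs undifferentiated,
   so it is of class C^k as soon as [g] is. *)
move=> k; elim: k => [|k IH].
  by move=> y By; apply: differentiable_continuous; have [] := dg _ By.
split=> [y By|v]; first by have [] := dg _ By.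
apply: (@Ck_ext _ _ _ _ _ (fun y => v *m invmx ('J f (g y)))).
- exact: ball_open.
- move=> y By; have [dgy dgE] := dg _ By.
  by rewrite (deriveE _ dgy) dgE.
apply: Ck_mx => [|i j]; first exact: ball_open.
rewrite (_ : (fun y => _) = fun y => \sum_l v i l * invmx ('J f (g y)) l j); last first.
  by apply/funext => y; rewrite mxE.
apply: Ck_sum => [|l _]; first exact: ball_open.
apply: Ck_mul; [exact: ball_open|exact: Ck_cst|].
apply: (@Ck_comp _ _ _ _ _ N g (fun x => invmx ('J f x) l j)) => //.
  exact: ball_open.
apply: (@Ck_invmx _ _ _ k N (fun x => 'J f x) l j); first exact: oN.
  by move=> x [Bx _]; exact: uB.
move=> l' j'.
by apply: Ck_subset (sJ _ _ k) => x [/Hr[]].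
Qed.

End InverseFunction.

(** * Moving frames *)

Section PointwiseDerivatives.
Context {R : realType} {V : normedModType R}.

Lemma differentiable_fsum n (f : 'I_n -> V -> R) x :
  (forall i, differentiable (f i) x) ->
  differentiable (fun y => \sum_(i < n) f i y) x.
Proof.
move=> df; rewrite (_ : (fun y => _) = \sum_(i < n) f i).
  exact: differentiable_sum.
by apply/funext => y; rewrite fct_sumE.
Qed.

Lemma derive_fsum n (f : 'I_n -> V -> R) x v :
  (forall i, differentiable (f i) x) ->
  'D_v (fun y => \sum_(i < n) f i y) x = \sum_(i < n) 'D_v (f i) x.
Proof.
move=> df; rewrite -derive_sum; last by move=> i; exact: diff_derivable.
by congr ('D_v _ x); apply/funext => y; rewrite fct_sumE.
Qed.

Lemma derive_fmul (f g : V -> R) x v :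
  differentiable f x -> differentiable g x ->
  'D_v (fun y => f y * g y) x = 'D_v f x * g x + f x * 'D_v g x.
Proof.
move=> df dg; rewrite [LHS](@deriveM _ _ f g).
- by rewrite addrC; congr (_ + _); exact: mulrC.
- exact: diff_derivable.
- exact: diff_derivable.
Qed.

Lemma derive_fadd (f g : V -> R) x v :
  differentiable f x -> differentiable g x ->
  'D_v (fun y => f y + g y) x = 'D_v f x + 'D_v g x.
Proof. by move=> df dg; apply: deriveD; exact: diff_derivable. Qed.

Lemma derive_fsub (f g : V -> R) x v :
  differentiable f x -> differentiable g x ->
  'D_v (fun y => f y - g y) x = 'D_v f x - 'D_v g x.
Proof. by move=> df dg; apply: deriveB; exact: diff_derivable. Qed.

Lemma derive_fscale (c : R) (f : V -> R) x v :
  differentiable f x -> 'D_v (fun y => c * f y) x = c * 'D_v f x.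
Proof.
move=> df; rewrite (derive_fmul _ (differentiable_cst c x) df).
by rewrite derive_cst mul0r add0r.
Qed.

Lemma derive_fscaler (c : R) (f : V -> R) x v :
  differentiable f x -> 'D_v (fun y => f y * c) x = 'D_v f x * c.
Proof. by move=> df; under eq_fun do rewrite mulrC; rewrite derive_fscale// mulrC. Qed.

End PointwiseDerivatives.

Section Bilinear.
Context {R : realType}.

Lemma bilE m (A : 'M[R]_m) v w :
  bil A v w = \sum_(i < m) \sum_(j < m) v 0 i * A i j * w 0 j.
Proof.
rewrite /bil mxE exchange_big /=; apply: eq_bigr => j _.
by rewrite mxE big_distrl /=; apply: eq_bigr => i _; rewrite mxE.
Qed.

Lemma bil_mulmx m p (Q : 'M[R]_p) (T : 'M[R]_(m, p)) v w :
  bil (T *m Q *m T^T) v w = bil Q (v *m T) (w *m T).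
Proof. by rewrite /bil trmx_mul !mulmxA. Qed.

Lemma bil_sym m (A : 'M[R]_m) v w : A^T = A -> bil A v w = bil A w v.
Proof.
move=> AT; rewrite /bil -[in RHS]AT.
have -> : w *m A^T *m v^T = (v *m A *m w^T)^T by rewrite !trmx_mul trmxK mulmxA.
by rewrite [RHS]mxE.
Qed.

Lemma bilDl m (A : 'M[R]_m) u v w : bil A (u + v) w = bil A u w + bil A v w.
Proof. by rewrite /bil !mulmxDl [LHS]mxE. Qed.

Lemma bilDr m (A : 'M[R]_m) u v w : bil A w (u + v) = bil A w u + bil A w v.
Proof. by rewrite /bil linearD mulmxDr [LHS]mxE. Qed.

Lemma bil_inj m (A : 'M[R]_m) u v : A \in unitmx ->
  (forall w, bil A u w = bil A v w) -> u = v.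
Proof.
move=> uA H.
suff : u *m A = v *m A by move/(congr1 (mulmx^~ (invmx A))); rewrite !mulmxK.
apply/rowP => j; have := H (delta_mx 0 j).
rewrite /bil trmx_delta -!colE !mxE; congr (_ = _); apply: eq_bigr => i _;
  by rewrite ?mxE.
Qed.

Lemma bil_delta m (A : 'M[R]_m) i j : bil A (delta_mx 0 i) (delta_mx 0 j) = A i j.
Proof. by rewrite /bil -rowE trmx_delta -colE !mxE. Qed.

Lemma differentiable_bil (V : normedModType R) m (Q : 'M[R]_m)
    (p q : V -> 'rV[R]_m) x :
  differentiable p x -> differentiable q x ->
  differentiable (fun y => bil Q (p y) (q y)) x.
Proof.
move=> dp dq; under eq_fun do rewrite bilE.
apply: differentiable_fsum => i; apply: differentiable_fsum => j.
apply: differentiableM; last exact: differentiable_entry.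
apply: differentiableM; first exact: differentiable_entry.
exact: differentiable_cst.
Qed.

Lemma derive_bil (V : normedModType R) m (Q : 'M[R]_m) (p q : V -> 'rV[R]_m) x v :
  differentiable p x -> differentiable q x ->
  'D_v (fun y => bil Q (p y) (q y)) x =
    bil Q ('D_v p x) (q x) + bil Q (p x) ('D_v q x).
Proof.
move=> dp dq; rewrite (_ : (fun y => _) =
    fun y => \sum_(i < m) \sum_(j < m) p y 0 i * Q i j * q y 0 j); last first.
  by apply/funext => y; rewrite bilE.
have dpi i : differentiable (fun y => p y 0 i) x by exact: differentiable_entry.
have dqi i : differentiable (fun y => q y 0 i) x by exact: differentiable_entry.
have dpQ i j : differentiable (fun y => p y 0 i * Q i j) x.
  by apply: differentiableM => //; exact: differentiable_cst.
have dd i j : differentiable (fun y => p y 0 i * Q i j * q y 0 j) x.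
  exact: differentiableM.
rewrite derive_fsum => [|i]; last exact: differentiable_fsum.
rewrite !bilE -big_split /=; apply: eq_bigr => i _.
rewrite derive_fsum// -big_split /=; apply: eq_bigr => j _.
by rewrite derive_fmul// derive_fscaler// !derive_entry.
Qed.

Lemma differentiable_mulmxr (V : normedModType R) m p q
    (T : V -> 'M[R]_(m, p)) (u : 'M[R]_(q, m)) x :
  differentiable T x -> differentiable (fun y => u *m T y) x.
Proof.
move=> dT; apply: differentiable_mx => i j.
under eq_fun do rewrite mxE; apply: differentiable_fsum => k.
apply: differentiableM; first exact: differentiable_cst.
exact: differentiable_entry.
Qed.

Lemma derive_mulmxr (V : normedModType R) m p q
    (T : V -> 'M[R]_(m, p)) (u : 'M[R]_(q, m)) x v :
  differentiable T x -> 'D_v (fun y => u *m T y) x = u *m 'D_v T x.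
Proof.
move=> dT; apply/matrixP => i j; rewrite derive_entry; last exact: differentiable_mulmxr.
under eq_fun do rewrite mxE; rewrite derive_fsum => [|k]; last first.
  apply: differentiableM; first exact: differentiable_cst.
  exact: differentiable_entry.
rewrite mxE; apply: eq_bigr => k _; rewrite derive_fscale ?derive_entry//.
exact: differentiable_entry.
Qed.

End Bilinear.

(** * The Koszul formula and connections in moving frames *)

Section Koszul.
Context {R : realType} {N : nat}.
Variables (G : 'rV[R]_N -> 'M[R]_N) (x : 'rV[R]_N).
Hypothesis symG : forall i j, \forall y \near x, G y i j = G y j i.
Hypothesis unitG : G x \in unitmx.
Hypothesis diffG : forall i j, differentiable (fun y => G y i j) x.

Lemma derive_bil_metric v w u :
  'D_v (fun y => bil (G y) w u) x =
  \sum_(i < N) \sum_(j < N) \sum_(l < N)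
    v 0 i * w 0 j * u 0 l * 'D_(basis_vec i) (fun y => G y j l) x.
Proof.
rewrite (_ : (fun y => _) =
    fun y => \sum_(j < N) \sum_(l < N) w 0 j * G y j l * u 0 l); last first.
  by apply/funext => y; rewrite bilE.
have d1 j l : differentiable (fun y => w 0 j * G y j l) x.
  by apply: differentiableM => //; exact: differentiable_cst.
have d2 j l : differentiable (fun y => w 0 j * G y j l * u 0 l) x.
  by apply: differentiableM => //; exact: differentiable_cst.
rewrite derive_fsum => [|j]; last exact: differentiable_fsum.
rewrite exchange_big /=; apply: eq_bigr => j _.
rewrite derive_fsum// exchange_big /=; apply: eq_bigr => l _.
rewrite derive_fscaler// derive_fscale// {1}(row_sum_delta v) derive_sumv//.
by rewrite mulr_sumr mulr_suml; apply: eq_bigr => i _; rewrite /basis_vec /GRing.scale /=; ring.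
Qed.

(** Koszul formula for constant vector fields, whose brackets vanish. From here on no sum of
    Christoffel symbols has to be expanded to identify a connection. *)
Lemma bil_christoffel v w u :
  bil (G x) (Gam G x v w) u = 2^-1 *
    ('D_v (fun y => bil (G y) w u) x + 'D_w (fun y => bil (G y) v u) x
     - 'D_u (fun y => bil (G y) v w) x).
Proof.
have symGx : (G x)^T = G x.
  by apply/matrixP => i j; rewrite mxE; exact: (nbhs_singleton (symG j i)).
pose T i j l := 'D_(basis_vec i) (fun y => G y j l) x +
     'D_(basis_vec j) (fun y => G y i l) x -
     'D_(basis_vec l) (fun y => G y i j) x.
pose t : 'rV[R]_N := \row_l \sum_(i < N) \sum_(j < N) 2^-1 * T i j l * v 0 i * w 0 j.
have GE : Gam G x v w = t *m invmx (G x).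
  apply/rowP => k; rewrite !mxE.
  under [RHS]eq_bigr => l _ do rewrite mxE mulr_suml.
  rewrite [RHS]exchange_big; apply: eq_bigr => i _.
  under [RHS]eq_bigr => l _ do rewrite mulr_suml.
  rewrite [RHS]exchange_big; apply: eq_bigr => j _.
  rewrite /christoffel mulr_sumr !mulr_suml; apply: eq_bigr => l _.
  have -> : invmx (G x) k l = invmx (G x) l k.
    by rewrite -[in LHS]symGx -trmx_inv mxE.
  by rewrite -/(T i j l); ring.
have -> : bil (G x) (Gam G x v w) u = \sum_(l < N) t 0 l * u 0 l.
  rewrite /bil GE mulmxKV// [LHS]mxE; apply: eq_bigr => l _.
  by congr (_ * _); rewrite mxE.
rewrite !derive_bil_metric.
have E1 : \sum_(l < N) t 0 l * u 0 l =
    \sum_(i < N) \sum_(j < N) \sum_(l < N) 2^-1 * T i j l * v 0 i * w 0 j * u 0 l.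
  under eq_bigr => l _ do rewrite mxE mulr_suml.
  rewrite exchange_big; apply: eq_bigr => i _.
  under eq_bigr => l _ do rewrite mulr_suml.
  by rewrite exchange_big.
rewrite E1.
have E2 : \sum_(i < N) \sum_(j < N) \sum_(l < N)
    w 0 i * v 0 j * u 0 l * 'D_(basis_vec i) (fun y => G y j l) x =
    \sum_(i < N) \sum_(j < N) \sum_(l < N)
    v 0 i * w 0 j * u 0 l * 'D_(basis_vec j) (fun y => G y i l) x.
  rewrite exchange_big; apply: eq_bigr => i _; apply: eq_bigr => j _.
  by apply: eq_bigr => l _; ring.
have E3 : \sum_(i < N) \sum_(j < N) \sum_(l < N)
    u 0 i * v 0 j * w 0 l * 'D_(basis_vec i) (fun y => G y j l) x =
    \sum_(i < N) \sum_(j < N) \sum_(l < N)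
    v 0 i * w 0 j * u 0 l * 'D_(basis_vec l) (fun y => G y i j) x.
  rewrite exchange_big; apply: eq_bigr => i _; rewrite exchange_big.
  by apply: eq_bigr => j _; apply: eq_bigr => l _; ring.
rewrite E2 E3 -big_split -sumrB mulr_sumr /=; apply: eq_bigr => i _.
rewrite -big_split -sumrB mulr_sumr /=; apply: eq_bigr => j _.
rewrite -big_split -sumrB mulr_sumr /=; apply: eq_bigr => l _.
by rewrite /T; ring.
Qed.

End Koszul.

(* A connection given in a moving frame is the Levi-Civita connection as soon
   as it is skew for the constant Gram matrix Q of the frame and torsion-free. *)
Lemma Gam_frame (R : realType) (N : nat) (G T : 'rV[R]_N -> 'M[R]_N)
    (x : 'rV[R]_N) (Q : 'M[R]_N) (A : 'rV[R]_N -> 'M[R]_N) :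
  (\forall y \near x, G y = T y *m Q *m (T y)^T) ->
  Q^T = Q -> Q \in unitmx -> T x \in unitmx -> differentiable T x ->
  (forall v, A v *m Q + (A v *m Q)^T = 0) ->
  (forall v w, w *m 'D_v T x + w *m T x *m A v =
               v *m 'D_w T x + v *m T x *m A w) ->
  forall v w, Gam G x v w *m T x = w *m 'D_v T x + w *m T x *m A v.
Proof.
move=> GT QT uQ uT dT skewA torA v w.
have GTx := nbhs_singleton GT.
have symG i j : \forall y \near x, G y i j = G y j i.
  apply: filterS GT => y ->; pose P := T y *m Q *m (T y)^T.
  have PT : P^T = P by rewrite /P !trmx_mul trmxK QT mulmxA.
  by rewrite -/P -[in LHS]PT mxE.
have unitG : G x \in unitmx by rewrite GTx !unitmx_mul uT uQ unitmx_tr.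
have nearG i j : \forall y \near x, (T y *m Q *m (T y)^T) i j = G y i j.
  by apply: filterS GT => y ->.
have diffG i j : differentiable (fun y => G y i j) x.
  apply: near_eq_differentiable (nearG i j) _.
  under eq_fun do rewrite -bil_delta bil_mulmx.
  by apply: differentiable_bil; exact: differentiable_mulmxr.
(* [D a b] is the candidate covariant derivative in frame components. [torD] is the vanishing of
   torsion and [DG] the compatibility with the metric; in the Koszul combination of three instances
   of [DG] only [D v w] survives. *)
pose D (a b : 'rV[R]_N) := b *m 'D_a T x + b *m T x *m A a.
have torD a b : D a b = D b a by exact: torA.
have DG a b c : 'D_a (fun y => bil (G y) b c) x =
   bil Q (D a b) (c *m T x) + bil Q (b *m T x) (D a c).
  have nb : \forall y \near x, bil (G y) b c = bil Q (b *m T y) (c *m T y).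
    by apply: filterS GT => y ->; rewrite bil_mulmx.
  rewrite (near_eq_derive a nb) derive_bil; [|exact: differentiable_mulmxr..].
  rewrite !derive_mulmxr// /D bilDl bilDr.
  suff : bil Q (b *m T x *m A a) (c *m T x) + bil Q (b *m T x) (c *m T x *m A a) = 0.
    by move=> S0; rewrite addrACA S0 addr0.
  set p := b *m T x; set q := c *m T x.
  have -> : bil Q p (q *m A a) = bil (A a *m Q)^T p q.
    by rewrite /bil !trmx_mul QT !mulmxA.
  have -> : bil Q (p *m A a) q = bil (A a *m Q) p q by rewrite /bil !mulmxA.
  have -> : bil (A a *m Q) p q + bil (A a *m Q)^T p q =
      bil (A a *m Q + (A a *m Q)^T) p q.
    by rewrite /bil mulmxDr mulmxDl [in RHS]mxE.
  by rewrite skewA /bil mulmx0 mul0mx mxE.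
apply: (bil_inj uQ) => c'.
pose c := c' *m invmx (T x).
have <- : c *m T x = c' by rewrite /c mulmxKV.
rewrite -bil_mulmx -GTx bil_christoffel// !DG.
have sQ p q : bil Q p q = bil Q q p by exact: bil_sym.
rewrite -/(D v w) (torD w v) (torD c v) (torD c w) (sQ (w *m T x)).
clear -v; move: (bil Q _ _) (bil Q _ _) (bil Q _ _) => a1 a2 a3.
by field.
Qed.

Section Plane.
Context {R : realType}.

Lemma sum2E (V : nmodType) (F : 'I_2 -> V) : \sum_(i < 2) F i = F 0 + F 1.
Proof. by rewrite big_ord_recl big_ord1; congr (_ + F _); exact/val_inj. Qed.

Lemma forall2 (P : 'I_2 -> Prop) : P 0 -> P 1 -> forall i, P i.
Proof.
move=> P0 P1 [[|[|//]] i2].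
  by rewrite (_ : Ordinal _ = 0)//; exact/val_inj.
by rewrite (_ : Ordinal _ = 1)//; exact/val_inj.
Qed.

Lemma mulmx2E m n (A : 'M[R]_(m, 2)) (B : 'M[R]_(2, n)) i j :
  (A *m B) i j = A i 0 * B 0 j + A i 1 * B 1 j.
Proof. by rewrite mxE sum2E. Qed.

Lemma trmxE m n (A : 'M[R]_(m, n)) i j : A^T i j = A j i.
Proof. by rewrite mxE. Qed.

Lemma scalemxE m n c (A : 'M[R]_(m, n)) i j : (c *: A) i j = c * A i j.
Proof. by rewrite mxE. Qed.

Lemma addmxE m n (A B : 'M[R]_(m, n)) i j : (A + B) i j = A i j + B i j.
Proof. by rewrite mxE. Qed.

Lemma oppmxE m n (A : 'M[R]_(m, n)) i j : (- A) i j = - A i j.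
Proof. by rewrite mxE. Qed.

Definition rot90 : 'M[R]_2 := \matrix_(a < 2, b < 2) ((b : nat)%:R - (a : nat)%:R).

Lemma rot90E : (rot90 0 0 = 0) * (rot90 0 1 = 1) * (rot90 1 0 = -1) * (rot90 1 1 = 0).
Proof. by rewrite !mxE /= !subrr subr0 sub0r. Qed.

Lemma mulmx_rot90 (v : 'rV[R]_2) :
  ((v *m rot90) 0 0 = - v 0 1) * ((v *m rot90) 0 1 = v 0 0).
Proof. by rewrite !mulmx2E !rot90E; split; ring. Qed.

Lemma rot90_sq : rot90 *m rot90 = - 1%:M.
Proof.
by apply/matrixP; apply: forall2; apply: forall2;
   rewrite mulmx2E !rot90E !mxE /=; ring.
Qed.

Lemma tr_rot90 : rot90^T = - rot90.
Proof.
by apply/matrixP; apply: forall2; apply: forall2; rewrite !mxE /=; ring.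
Qed.

Lemma det2E (A : 'M[R]_2) : \det A = A 0 0 * A 1 1 - A 0 1 * A 1 0.
Proof.
rewrite (expand_det_row _ 0) sum2E /cofactor !det_mx11 !mxE /=.
rewrite (_ : lift 0 0 = 1); last exact/val_inj.
by rewrite (_ : lift 1 0 = 0); [rewrite /=; ring|exact/val_inj].
Qed.

(** [rot90] is the matrix of the area form of the plane, which a change of basis multiplies by its
    determinant. *)
Lemma mul_rot90_tr (M : 'M[R]_2) : M *m rot90 *m M^T = \det M *: rot90.
Proof.
apply/matrixP; apply: forall2; apply: forall2;
  by rewrite !mulmx2E !rot90E scalemxE rot90E det2E !trmxE; ring.
Qed.

Lemma rot90_conj (M : 'M[R]_2) : M^T *m rot90 *m M = \det M *: rot90.
Proof. by rewrite -[in RHS]det_tr -mul_rot90_tr trmxK. Qed.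

End Plane.

Section MatrixDerivative.
Context {R : realType} {V : normedModType R}.

Lemma differentiable_mulmx m n p (A : V -> 'M[R]_(m, n)) (B : V -> 'M[R]_(n, p)) x :
  differentiable A x -> differentiable B x -> differentiable (fun y => A y *m B y) x.
Proof.
move=> dA dB; apply: differentiable_mx => i j.
under eq_fun do rewrite mxE; apply: differentiable_fsum => k.
by apply: differentiableM; exact: differentiable_entry.
Qed.

Lemma derive_mulmx m n p (A : V -> 'M[R]_(m, n)) (B : V -> 'M[R]_(n, p)) x v :
  differentiable A x -> differentiable B x ->
  'D_v (fun y => A y *m B y) x = 'D_v A x *m B x + A x *m 'D_v B x.
Proof.
move=> dA dB; apply/matrixP => i j; rewrite derive_entry; last exact: differentiable_mulmx.
have dAe k l : differentiable (fun y => A y k l) x by exact: differentiable_entry.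
have dBe k l : differentiable (fun y => B y k l) x by exact: differentiable_entry.
under eq_fun do rewrite mxE; rewrite derive_fsum => [|k]; last exact: differentiableM.
rewrite addmxE [X in _ = X + _]mxE [X in _ = _ + X]mxE -big_split /=; apply: eq_bigr => k _.
by rewrite derive_fmul// !derive_entry.
Qed.

Lemma differentiable_scale m n (a : V -> R) (B : V -> 'M[R]_(m, n)) x :
  differentiable a x -> differentiable B x -> differentiable (fun y => a y *: B y) x.
Proof.
move=> da dB; apply: differentiable_mx => i j.
under eq_fun do rewrite mxE.
by apply: differentiableM => //; exact: differentiable_entry.
Qed.

Lemma derive_scale m n (a : V -> R) (B : V -> 'M[R]_(m, n)) x v :
  differentiable a x -> differentiable B x ->
  'D_v (fun y => a y *: B y) x = 'D_v a x *: B x + a x *: 'D_v B x.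
Proof.
move=> da dB; apply/matrixP => i j; rewrite derive_entry; last exact: differentiable_scale.
under eq_fun do rewrite mxE.
rewrite derive_fmul//; last exact: differentiable_entry.
by rewrite !mxE derive_entry.
Qed.

Lemma derive_mxadd m n (A B : V -> 'M[R]_(m, n)) x v :
  differentiable A x -> differentiable B x ->
  'D_v (fun y => A y + B y) x = 'D_v A x + 'D_v B x.
Proof. by move=> dA dB; apply: deriveD; exact: diff_derivable. Qed.

Lemma smooth_mulmx m n p (A : V -> 'M[R]_(m, n)) (B : V -> 'M[R]_(n, p)) U :
  open U -> smooth_on U A -> smooth_on U B -> smooth_on U (fun y => A y *m B y).
Proof.
move=> oU sA sB k; apply: Ck_mx => // i j.
under eq_fun do rewrite mxE; apply: Ck_sum => // l _.
by apply: Ck_mul => //; exact: Ck_entry.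
Qed.

Lemma smooth_scale m n (a : V -> R) (B : V -> 'M[R]_(m, n)) U :
  open U -> smooth_on U a -> smooth_on U B -> smooth_on U (fun y => a y *: B y).
Proof.
move=> oU sa sB k; apply: Ck_mx => // i j.
under eq_fun do rewrite mxE; apply: Ck_mul => //; exact: Ck_entry.
Qed.

Lemma smooth_add (W : normedModType R) U (A B : V -> W) :
  open U -> smooth_on U A -> smooth_on U B -> smooth_on U (fun y => A y + B y).
Proof. by move=> oU sA sB k; exact: Ck_add. Qed.

End MatrixDerivative.

(** * Connection form and curvature of the base surface *)

Section Frame.
Context {R : realType}.

Lemma basis_mulmx m n (A : 'M[R]_(m, n)) i j : (basis_vec i *m A) 0 j = A i j.
Proof. by rewrite /basis_vec -rowE mxE. Qed.

Lemma derive_rV2 (W : normedModType R) (f : 'rV[R]_2 -> W) x v :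
  differentiable f x ->
  'D_v f x = v 0 0 *: 'D_(basis_vec 0) f x + v 0 1 *: 'D_(basis_vec 1) f x.
Proof. by move=> df; rewrite {1}(row_sum_delta v) derive_sumv// sum2E. Qed.

(* The connection form of the frame whose coframe is given by the columns of M:
   row vectors v are identified with the complex number v M, on which rot90 acts
   as multiplication by i. *)
Definition conn_form (M : 'rV[R]_2 -> 'M[R]_2) (x : 'rV[R]_2) : 'rV[R]_2 :=
  (\det (M x))^-1 *: ((basis_vec 1 *m 'D_(basis_vec 0) M x -
                       basis_vec 0 *m 'D_(basis_vec 1) M x) *m (M x)^T).

Definition conn (M : 'rV[R]_2 -> 'M[R]_2) (x v : 'rV[R]_2) : R :=
  v 0 0 * conn_form M x 0 0 + v 0 1 * conn_form M x 0 1.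

(** The algebra of d omega = 0 implies zero curvature. [X] and [Y] are the derivatives of the
    connection matrices [Cj] and [Ci], [S] is the common second derivative of the frame [A], and the
    common [w] expresses that omega is closed. The terms in oi oj cancel because rotations of the
    plane commute. *)
Lemma curvature_alg n (J X Y S B Ci Cj A Di Dj : 'M[R]_n) (oi oj w : R) :
  Di = Ci *m A - oi *: (A *m J) -> Dj = Cj *m A - oj *: (A *m J) ->
  X *m A + Cj *m Di = S + (w *: B + oj *: (Di *m J)) ->
  Y *m A + Ci *m Dj = S + (w *: B + oi *: (Dj *m J)) ->
  (X - Y + Cj *m Ci - Ci *m Cj) *m A = 0.
Proof.
move=> DiE DjE /(canRL (addrK _)) HX /(canRL (addrK _)) HY.
rewrite !(mulmxDl, mulNmx) HX HY DiE DjE.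
rewrite !(mulmxBr, mulmxBl) -!scalemxAl -!scalemxAr !scalerBr !scalerA -!mulmxA.
by apply/matrixP => p q; rewrite !(addmxE, oppmxE, scalemxE) [RHS]mxE; ring.
Qed.

Variables (U : set 'rV[R]_2) (M : 'rV[R]_2 -> 'M[R]_2).
Hypothesis oU : open U.
Hypothesis sM : smooth_on U M.
Hypothesis uM : forall x, U x -> M x \in unitmx.

(** First structure equation, of which [conn_form] is the solution. On basis vectors it reads
    (omega_1 e_0 - omega_0 e_1) M rot90 = e_1 D_0 M - e_0 D_1 M, and multiplication by M^T turns M
    rot90 M^T into det M times [rot90]. *)
Lemma conn_torsion x v w : U x ->
  w *m 'D_v M x + conn M x v *: (w *m M x *m rot90) =
  v *m 'D_w M x + conn M x w *: (v *m M x *m rot90).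
Proof.
move=> Ux; have dM := smooth_diff sM Ux.
have := uM Ux; rewrite unitmxE unitfE => d0.
rewrite (derive_rV2 v dM) (derive_rV2 w dM) /conn /conn_form.
rewrite det2E in d0 *.
move: ('D_(basis_vec 0) M x) ('D_(basis_vec 1) M x) (M x) d0 => D0 D1 A d0.
apply/rowP; apply: forall2; rewrite !(basis_mulmx, addmxE, scalemxE, oppmxE, mulmx2E, trmxE, rot90E);
  by field.
Qed.

Lemma Gam_conn G x v w : (forall y, U y -> G y = M y *m (M y)^T) -> U x ->
  Gam G x v w *m M x = w *m 'D_v M x + conn M x v *: (w *m M x *m rot90).
Proof.
move=> GM Ux.
rewrite (@Gam_frame _ _ G M x 1%:M (fun v => conn M x v *: rot90)).
- by rewrite -scalemxAr.
- have : \forall y \near x, U y by exact: open_nbhs_nbhs.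
  by apply: filterS => y /GM ->; rewrite mulmx1.
- by rewrite trmx1.
- exact: unitmx1.
- exact: uM.
- exact: smooth_diff sM Ux.
- by move=> a; rewrite mulmx1 linearZ /= tr_rot90 scalerN subrr.
- by move=> a b; rewrite -!scalemxAr; exact: conn_torsion.
Qed.

Lemma smooth_conn_form : smooth_on U (conn_form M).
Proof.
apply: smooth_scale => //.
  move=> k; apply: Ck_inv => //; first by move=> x /uM; rewrite unitmxE unitfE.
  by apply: Ck_det => // i j; exact: Ck_entry.
apply: smooth_mulmx => //; last first.
  by move=> k; apply: Ck_mx => // i j; under eq_fun do rewrite mxE; exact: Ck_entry.
have sD a b : smooth_on U (fun x => basis_vec a *m 'D_(basis_vec b) M x).
  by apply: smooth_mulmx => //; [move=> k; exact: Ck_cst|exact: smooth_derive].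
move=> k; apply: Ck_mx => // i j; under eq_fun do rewrite addmxE oppmxE.
by apply: Ck_sub => //; apply: (Ck_entry _ _ oU (sD _ _ k)).
Qed.

(** The hypothesis is d omega = 0. The Christoffel symbols are the entries of the matrices [C a]
    below, so the Riemann tensor becomes the curvature of these matrices, which [curvature_alg]
    annihilates. *)
Lemma riemann_conn G x l k i j : (forall y, U y -> G y = M y *m (M y)^T) -> U x ->
  'D_(basis_vec 0) (fun y => conn_form M y 0 1) x =
  'D_(basis_vec 1) (fun y => conn_form M y 0 0) x ->
  riemann G x l k i j = 0.
Proof.
move=> GM Ux dw.
pose om (a : 'I_2) (y : 'rV[R]_2) := conn_form M y 0 a.
have connE y a : conn M y (basis_vec a) = om a y.
  rewrite /conn /om; move: a; apply: forall2; rewrite !mxE /=; ring.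
pose DM a y := 'D_(basis_vec a) M y.
(* Matrix of covariant differentiation in the coordinate frame: the connection form transported back
   through [M]. *)
pose C a y := (DM a y + om a y *: (M y *m rot90)) *m invmx (M y).
have CM a y : U y -> C a y *m M y = DM a y + om a y *: (M y *m rot90).
  by move=> Uy; rewrite /C mulmxKV//; exact: uM.
have chrE y a b c : U y -> christoffel G y a b c = C b y c a.
  move=> Uy.
  have -> : christoffel G y a b c = Gam G y (basis_vec b) (basis_vec c) 0 a.
    rewrite mxE (bigD1 b)//= (bigD1 c)//= !big1 ?addr0.
    - by rewrite !mxE !eqxx /= !mulr1.
    - by move=> b' b'b; apply: big1 => c' _; rewrite !mxE (negPf b'b) /= mulr0 mul0r.
    - by move=> c' c'c; rewrite !mxE (negPf c'c) /= mulr0.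
  have -> : Gam G y (basis_vec b) (basis_vec c) = basis_vec c *m C b y.
    rewrite -[LHS](mulmxK (uM Uy)) (Gam_conn _ _ GM Uy) connE.
    by rewrite /C mulmxA mulmxDr -scalemxAr !mulmxA.
  by rewrite basis_mulmx.
have sinv : smooth_on U (fun y => invmx (M y)).
  move=> n; apply: Ck_mx => // a b; apply: Ck_invmx => // a' b'; exact: Ck_entry.
have som a : smooth_on U (om a).
  by move=> n; apply: Ck_entry => //; exact: smooth_conn_form.
have sMrot : smooth_on U (fun y => M y *m rot90).
  by apply: smooth_mulmx => // n; exact: Ck_cst.
have sC a : smooth_on U (C a).
  apply: smooth_mulmx => //; apply: smooth_add => //; first exact: smooth_derive.
  exact: smooth_scale.
have dM := smooth_diff sM Ux.
have dDM a : differentiable (DM a) x.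
  exact: (smooth_diff (smooth_derive (basis_vec a) sM) Ux).
have dC a := smooth_diff (sC a) Ux.
have dom a := smooth_diff (som a) Ux.
have dMrot := smooth_diff sMrot Ux.
have dsc a : differentiable (fun y => om a y *: (M y *m rot90)) x.
  exact: differentiable_scale.
have comM a b : 'D_(basis_vec b) (DM a) x = 'D_(basis_vec a) (DM b) x.
  apply/matrixP => p q.
  have H c d : ('D_(basis_vec d) (DM c) x) p q =
      'D_(basis_vec d) ('D_(basis_vec c) (fun z => M z p q)) x.
    rewrite (derive_entry _ _ _ (dDM c)); apply: near_eq_derive.
    have : \forall y \near x, U y by exact: open_nbhs_nbhs.
    by apply: filterS => y Uy; exact: (derive_entry _ _ _ (smooth_diff sM Uy)).
  apply: (eq_trans (H a b)).
  apply: (eq_trans _ (esym (H b a))).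
  have sMpq : smooth_on U (fun z => M z p q) by move=> n; exact: Ck_entry.
  exact: (smooth_derive_commute _ _ oU Ux sMpq).
have dCM a b : 'D_(basis_vec b) (C a) x *m M x + C a x *m DM b x =
    'D_(basis_vec b) (DM a) x + ('D_(basis_vec b) (om a) x *: (M x *m rot90) +
       om a x *: (DM b x *m rot90)).
  rewrite -[DM b x in LHS]/('D_(basis_vec b) M x) -derive_mulmx//.
  have nE : \forall y \near x, C a y *m M y = DM a y + om a y *: (M y *m rot90).
    have : \forall y \near x, U y by exact: open_nbhs_nbhs.
    by apply: filterS => y Uy; exact: CM.
  rewrite (near_eq_derive _ nE) derive_mxadd// derive_scale// derive_mulmx//.
  by rewrite derive_cst mulmx0 addr0.
have dw' : 'D_(basis_vec i) (om j) x = 'D_(basis_vec j) (om i) x.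
  have sym01 (c d : 'I_2) : c = d \/ (c = 0 /\ d = 1) \/ (c = 1 /\ d = 0).
    move: c d; apply: forall2; apply: forall2; by [left|right; left|right; right].
  have [->|[[-> ->]|[-> ->]]] := sym01 i j; [by []|exact: dw|exact: (esym dw)].
have DME a : DM a x = C a x *m M x - om a x *: (M x *m rot90).
  by rewrite CM// addrK.
have key : ('D_(basis_vec i) (C j) x - 'D_(basis_vec j) (C i) x +
     C j x *m C i x - C i x *m C j x) *m M x = 0.
  have H1 := dCM j i; have H2 := dCM i j; rewrite comM dw' in H1.
  exact: curvature_alg (DME i) (DME j) H1 H2.
have key0 : 'D_(basis_vec i) (C j) x - 'D_(basis_vec j) (C i) x +
     C j x *m C i x - C i x *m C j x = 0.
  by rewrite -[LHS](mulmxK (uM Ux)) key mul0mx.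
have nE a b c : \forall y \near x, christoffel G y a b c = C b y c a.
  have : \forall y \near x, U y by exact: open_nbhs_nbhs.
  by apply: filterS => y Uy; exact: chrE.
rewrite /riemann (near_eq_derive _ (nE l j k)) (near_eq_derive _ (nE l i k)).
rewrite -(derive_entry _ _ _ (dC j)) -(derive_entry _ _ _ (dC i)).
transitivity (('D_(basis_vec i) (C j) x - 'D_(basis_vec j) (C i) x +
     C j x *m C i x - C i x *m C j x) k l); last by rewrite key0 mxE.
rewrite !(addmxE, oppmxE) (mulmx2E (C j x)) (mulmx2E (C i x)) sum2E !chrE//.
rewrite -[RHS]addrA; congr (_ + _).
move: (C i x) (C j x) => Ci Cj; ring.
Qed.

End Frame.

Section SmoothBlocks.
Context {R : realType} {V : normedModType R}.

Lemma smooth_row_mx m n p (A : V -> 'M[R]_(m, n)) (B : V -> 'M[R]_(m, p)) U :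
  open U -> smooth_on U A -> smooth_on U B -> smooth_on U (fun y => row_mx (A y) (B y)).
Proof.
move=> oU sA sB k; apply: Ck_mx => // i j.
case: (splitP j) => j' jE.
  have -> : j = lshift p j' by exact/val_inj.
  by under eq_fun do rewrite row_mxEl; apply: (Ck_entry _ _ oU (sA k)).
have -> : j = rshift n j' by exact/val_inj.
by under eq_fun do rewrite row_mxEr; apply: (Ck_entry _ _ oU (sB k)).
Qed.

Lemma derive_linear (W W' : normedModType R) (f : {linear W -> W'}) x v :
  continuous f -> 'D_v f x = f v.
Proof. by move=> cf; rewrite deriveE ?diff_lin//; exact: linear_differentiable. Qed.

Lemma smooth_lsubmx n p U : smooth_on U (lsubmx : 'rV[R]_(n + p) -> 'rV[R]_n).
Proof. by move=> k; apply: Ck_lin; exact: continuous_lsubmx. Qed.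

Lemma smooth_rsubmx n p U : smooth_on U (rsubmx : 'rV[R]_(n + p) -> 'rV[R]_p).
Proof. by move=> k; apply: Ck_lin; exact: continuous_rsubmx. Qed.

Lemma derive_lsubmx n p (f : V -> 'rV[R]_(n + p)) x v : differentiable f x ->
  lsubmx ('D_v f x) = 'D_v (fun y => lsubmx (f y)) x.
Proof.
move=> df; rewrite [RHS](derive_comp _ df (differentiable_lsubmx _)).
by rewrite (derive_linear _ _ (@continuous_lsubmx _ _ _ _)).
Qed.

Lemma derive_rsubmx n p (f : V -> 'rV[R]_(n + p)) x v : differentiable f x ->
  rsubmx ('D_v f x) = 'D_v (fun y => rsubmx (f y)) x.
Proof.
move=> df; rewrite [RHS](derive_comp _ df (differentiable_rsubmx _)).
by rewrite (derive_linear _ _ (@continuous_rsubmx _ _ _ _)).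
Qed.

Lemma row_mxP m n p (A B : 'M[R]_(m, n + p)) :
  lsubmx A = lsubmx B -> rsubmx A = rsubmx B -> A = B.
Proof. by move=> HL HR; rewrite -(hsubmxK A) HL HR hsubmxK. Qed.

End SmoothBlocks.

Section OrthonormalFrame.
Context {R : realType}.

(** Cholesky factorization, that is, Gram-Schmidt on the coordinate frame: the triangular factor
    involves only square roots of positive functions, so it is smooth, and its positive diagonal
    fixes the orientation. *)
Lemma orthonormal_frame (U : set 'rV[R]_2) (G : 'rV[R]_2 -> 'M[R]_2) :
  open U -> smooth_on U G -> (forall x, U x -> (G x)^T = G x) ->
  (forall x, U x -> forall v, v != 0 -> 0 < bil (G x) v v) ->
  exists M : 'rV[R]_2 -> 'M[R]_2, [/\ smooth_on U M,
    forall x, U x -> G x = M x *m (M x)^T & forall x, U x -> 0 < \det (M x)].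
Proof.
move=> oU sG symG posG.
have bil2 (A : 'M[R]_2) v w : bil A v w =
    v 0 0 * A 0 0 * w 0 0 + v 0 0 * A 0 1 * w 0 1 +
    (v 0 1 * A 1 0 * w 0 0 + v 0 1 * A 1 1 * w 0 1).
  by rewrite bilE !sum2E.
have G10 x : U x -> G x 1 0 = G x 0 1 by move=> Ux; rewrite -[in LHS]symG// mxE.
have a0 x : U x -> 0 < G x 0 0.
  move=> Ux; have := @posG x Ux (\row_j (j == 0)%:R).
  rewrite bil2 !mxE /= !(mulr0, mul0r, mulr1, mul1r, addr0); apply.
  by apply/eqP => /rowP/(_ 0); rewrite !mxE /= => /eqP; rewrite oner_eq0.
have d0 x : U x -> 0 < \det (G x).
  (* The vector (- G_01, G_00) is orthogonal to the first basis vector and has square length G_00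
     det G. *)
  move=> Ux; have := @posG x Ux (\row_j (if j == 0 then - G x 0 1 else G x 0 0)).
  rewrite bil2 !mxE /= det2E G10// => H.
  rewrite -(pmulr_rgt0 _ (a0 _ Ux)).
  have -> : G x 0 0 * (G x 0 0 * G x 1 1 - G x 0 1 * G x 0 1) =
    - G x 0 1 * G x 0 0 * - G x 0 1 + - G x 0 1 * G x 0 1 * G x 0 0 +
    (G x 0 0 * G x 0 1 * - G x 0 1 + G x 0 0 * G x 1 1 * G x 0 0) by ring.
  apply: H; apply/eqP => /rowP/(_ 1); rewrite !mxE /= => /eqP.
  by rewrite gt_eqF// a0.
pose s x := Num.sqrt (G x 0 0).
pose M x : 'M[R]_2 := \matrix_(i, j)
  (if i == 0 then (if j == 0 then s x else 0)
   else (if j == 0 then G x 1 0 * (s x)^-1 else Num.sqrt (\det (G x)) * (s x)^-1)).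
have s0 x : U x -> s x != 0 by move=> Ux; rewrite gt_eqF// sqrtr_gt0 a0.
have s2 x : U x -> G x 0 0 = s x ^+ 2 by move=> Ux; rewrite sqr_sqrtr// ltW// a0.
have ME x : ((M x 0 0 = s x) * (M x 0 1 = 0)) *
   ((M x 1 0 = G x 1 0 * (s x)^-1) * (M x 1 1 = Num.sqrt (\det (G x)) * (s x)^-1)).
  by rewrite !mxE.
exists M; split.
- have ss k : Ck k U s.
    by apply: Ck_sqrt => //; exact: (Ck_entry _ _ oU (sG k)).
  have si k : Ck k U (fun x => (s x)^-1) by apply: Ck_inv.
  move=> k; apply: Ck_mx => //; apply: forall2; apply: forall2;
    under eq_fun do rewrite ME.
  + exact: ss.
  + exact: Ck_cst.
  + by apply: Ck_mul => //; exact: (Ck_entry _ _ oU (sG k)).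
  + apply: Ck_mul => //; apply: Ck_sqrt => //; apply: Ck_det => // i j.
    exact: (Ck_entry _ _ oU (sG k)).
- move=> x Ux; have q2 : Num.sqrt (\det (G x)) ^+ 2 = \det (G x).
    by rewrite sqr_sqrtr// ltW// d0.
  have sx0 := s0 _ Ux.
  apply/matrixP; apply: forall2; apply: forall2; rewrite !mulmx2E !trmxE !ME.
  + by rewrite s2//; ring.
  + by rewrite G10//; field.
  + by rewrite mulfVK// mulr0 addr0.
  + transitivity ((G x 1 0 ^+ 2 + Num.sqrt (\det (G x)) ^+ 2) / s x ^+ 2); last by field.
    by rewrite q2 -s2// det2E G10//; field; rewrite gt_eqF// a0.
- move=> x Ux; rewrite det2E !ME mul0r subr0 mulrCA mulfV ?s0// mulr1.
  by rewrite sqrtr_gt0 d0.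
Qed.

End OrthonormalFrame.

(** * The neutral metric on the tangent bundle *)

Section Lift.
Context {R : realType}.

(* Gram matrix of the neutral metric in the frame (horizontal, vertical) lifted
   from an orthonormal frame. *)
Definition neutral_mx : 'M[R]_(2 + 2) := block_mx 0 (- rot90) rot90 0.

Lemma neutral_mx_tr : neutral_mx^T = neutral_mx.
Proof. by rewrite /neutral_mx tr_block_mx !trmx0 linearN /= tr_rot90 opprK. Qed.

Lemma neutral_mx_unit : neutral_mx \in unitmx.
Proof.
suff : neutral_mx *m neutral_mx = 1%:M by case/mulmx1_unit.
rewrite /neutral_mx mulmx_block !(mulmx0, mul0mx, addr0, add0r) mulmxN mulNmx.
by rewrite rot90_sq opprK -scalar_mx_block.
Qed.

Lemma bil_neutral (a b c d : 'rV[R]_2) :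
  bil neutral_mx (row_mx a b) (row_mx c d) =
  (b *m rot90 *m c^T) 0 0 - (a *m rot90 *m d^T) 0 0.
Proof.
rewrite /bil /neutral_mx mul_row_block !(mulmx0, addr0, add0r) mulmxN.
by rewrite tr_row_mx mul_row_col mulNmx addmxE oppmxE.
Qed.

(** Vertical part of the torsion of the lifted connection. Here [n] is the fibre vector in the frame
    and ddX - ddY is d omega. It rests on the plane identity <n, p> q - <n, q> p = (p ^ q) i n, with
    p = X A, q = Y A and p ^ q = det A times X ^ Y. *)
Lemma lift_torsion_alg (A : 'M[R]_2) (X Y n a b P : 'rV[R]_2)
    (oX oY ddX ddY dw : R) : \det A != 0 ->
  ddX - ddY = (X 0 0 * Y 0 1 - X 0 1 * Y 0 0) * dw ->
  P + (ddX *: (n *m rot90) + oY *: (a *m rot90)) +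
   ((- (dw / \det A) * (n *m (X *m A)^T) 0 0) *: (Y *m A) +
     oX *: ((b + oY *: (n *m rot90)) *m rot90)) =
  P + (ddY *: (n *m rot90) + oX *: (b *m rot90)) +
   ((- (dw / \det A) * (n *m (Y *m A)^T) 0 0) *: (X *m A) +
     oY *: ((a + oX *: (n *m rot90)) *m rot90)).
Proof.
move=> d0 /(canRL (subrK _)) ->; rewrite det2E in d0 *.
by apply/rowP; apply: forall2;
  rewrite !(addmxE, scalemxE, mulmx2E, trmxE, rot90E); field.
Qed.

Variables (U : set 'rV[R]_2) (M G : 'rV[R]_2 -> 'M[R]_2).
Hypothesis oU : open U.
Hypothesis sM : smooth_on U M.
Hypothesis dM0 : forall x, U x -> 0 < \det (M x).
Hypothesis GM : forall x, U x -> G x = M x *m (M x)^T.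

Let uM x : U x -> M x \in unitmx.
Proof. by move=> /dM0 d0; rewrite unitmxE unitfE gt_eqF. Qed.

Definition fibre_coord (z : 'rV[R]_(2 + 2)) : 'rV[R]_2 := rsubmx z *m M (lsubmx z).

Definition vertical_coord (z X : 'rV[R]_(2 + 2)) : 'rV[R]_2 :=
  rsubmx X *m M (lsubmx z) + rsubmx z *m 'D_(lsubmx X) M (lsubmx z) +
  conn M (lsubmx z) (lsubmx X) *: (fibre_coord z *m rot90).

(** Matrix of the map from coordinates (dx, dV) to the pair (z, k) of horizontal and vertical parts.
    The zero block says that vectors tangent to a fibre have no horizontal part. *)
Definition lift_frame (z : 'rV[R]_(2 + 2)) : 'M[R]_(2 + 2) :=
  block_mx (M (lsubmx z))
    (\matrix_(i < 2) (rsubmx z *m 'D_(basis_vec i) M (lsubmx z) +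
       conn M (lsubmx z) (basis_vec i) *: (fibre_coord z *m rot90)))
    0 (M (lsubmx z)).

Let TU := [set z : 'rV[R]_(2 + 2) | U (lsubmx z)].

Lemma open_lift : open TU.
Proof. by apply: open_comp => // z _; exact: continuous_lsubmx. Qed.
Let oTU := open_lift.

Lemma conn_basis x a : conn M x (basis_vec a) = conn_form M x 0 a.
Proof. by rewrite /conn; move: a; apply: forall2; rewrite !mxE /=; ring. Qed.

Lemma mul_lift_frame z X : TU z ->
  X *m lift_frame z = row_mx (lsubmx X *m M (lsubmx z)) (vertical_coord z X).
Proof.
move=> Uz; rewrite -[X in LHS]hsubmxK /lift_frame mul_row_block mulmx0 addr0.
congr row_mx; rewrite /vertical_coord addrC -addrA; congr (_ + _).

rewrite (derive_rV2 (lsubmx X) (smooth_diff sM Uz)) mulmx_sum_row sum2E !rowK.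
rewrite !conn_basis /conn.
move: (conn_form _ _) (fibre_coord z *m _) ('D_(basis_vec 0) M _)
  ('D_(basis_vec 1) M _) (lsubmx X) (rsubmx z) => w n D0 D1 Y v.
rewrite mulmxDr -!scalemxAr scalerDl !scalerDr !scalerA.
by rewrite addrACA.
Qed.

Lemma Kmap_frame z X : TU z -> Kmap G z X *m M (lsubmx z) = vertical_coord z X.
Proof.
move=> Uz; rewrite /Kmap /cov_deriv mulmxDl.
by rewrite (Gam_conn oU sM uM _ _ GM Uz) addrA.
Qed.

Lemma jrot_frame x v : U x -> jrot (G x) v *m M x = v *m M x *m rot90.
Proof.
move=> Ux; have d0 := dM0 Ux; rewrite /jrot GM// det_mulmx det_tr.
rewrite -expr2 sqrtr_sqr gtr0_norm// -/rot90 -scalemxAl -!mulmxA (mulmxA _ rot90).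
rewrite rot90_conj -!scalemxAr scalerA mulVf ?scale1r// gt_eqF//.
Qed.

Lemma GG_frame z X Y : TU z ->
  GG G z X Y = bil neutral_mx (X *m lift_frame z) (Y *m lift_frame z).
Proof.
move=> Uz; rewrite !mul_lift_frame// bil_neutral -!Kmap_frame//.
have bG v w : bil (G (lsubmx z)) v w = (v *m M (lsubmx z) *m (w *m M (lsubmx z))^T) 0 0.
  by rewrite /bil GM// trmx_mul !mulmxA.
rewrite /GG /Omega !bG /JJ /PKinv /Pmap row_mxKl jrot_frame//.
rewrite {1}/Kmap /cov_deriv row_mxKl row_mxKr subrK jrot_frame//.
Qed.

Lemma GGmx_frame z : TU z ->
  GGmx G z = lift_frame z *m neutral_mx *m (lift_frame z)^T.
Proof.
move=> Uz; apply/matrixP => i j.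
by rewrite mxE GG_frame// -bil_mulmx /basis_vec bil_delta.
Qed.

Lemma lift_frame_unit z : TU z -> lift_frame z \in unitmx.
Proof.
by move=> Uz; rewrite unitmxE det_ublock unitrM -!unitmxE uM.
Qed.

Lemma smooth_base : smooth_on TU (fun z => M (lsubmx z)).
Proof.
by apply: (smooth_comp (U' := U)) => //; exact: smooth_lsubmx.
Qed.

Lemma smooth_fibre_coord : smooth_on TU fibre_coord.
Proof. by apply: smooth_mulmx => //; [exact: smooth_rsubmx|exact: smooth_base]. Qed.

Lemma derive_base z X : TU z ->
  'D_X (fun y => M (lsubmx y)) z = 'D_(lsubmx X) M (lsubmx z).
Proof.
move=> Uz; rewrite [LHS](derive_comp _ (differentiable_lsubmx _) (smooth_diff sM Uz)).
by rewrite (derive_linear _ _ (@continuous_lsubmx _ _ _ _)).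
Qed.

Lemma derive_fibre_coord z X : TU z ->
  'D_X fibre_coord z = rsubmx X *m M (lsubmx z) + rsubmx z *m 'D_(lsubmx X) M (lsubmx z).
Proof.
move=> Uz; rewrite (derive_mulmx _ (differentiable_rsubmx _) (smooth_diff smooth_base Uz)).
by rewrite derive_base// (derive_linear _ _ (@continuous_rsubmx _ _ _ _)).
Qed.

Lemma vertical_coordE z X : TU z -> vertical_coord z X =
  'D_X fibre_coord z + conn M (lsubmx z) (lsubmx X) *: (fibre_coord z *m rot90).
Proof. by move=> Uz; rewrite derive_fibre_coord. Qed.

Lemma smooth_conn_form_base : smooth_on TU (fun z => conn_form M (lsubmx z)).
Proof.
apply: (smooth_comp (U' := U)) => //; first exact: smooth_lsubmx.
exact: smooth_conn_form.
Qed.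

Lemma smooth_conn_base (X : 'rV[R]_(2 + 2)) :
  smooth_on TU (fun z => conn M (lsubmx z) (lsubmx X)).
Proof.
have sf k a := Ck_entry 0 a oTU (smooth_conn_form_base k).
move=> k; apply: Ck_add => //; apply: Ck_mul => //; exact: Ck_cst.
Qed.

Lemma smooth_vertical_coord (X : 'rV[R]_(2 + 2)) : smooth_on TU (vertical_coord^~ X).
Proof.
apply: (@smooth_ext _ _ _ _ (fun z => 'D_X fibre_coord z +
    conn M (lsubmx z) (lsubmx X) *: (fibre_coord z *m rot90))) => //.
  by move=> z Uz; rewrite vertical_coordE.
apply: smooth_add => //; first exact/smooth_derive/smooth_fibre_coord.
apply: smooth_scale => //; first exact: smooth_conn_base.
by apply: smooth_mulmx => //; [exact: smooth_fibre_coord|move=> k; exact: Ck_cst].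
Qed.

Lemma smooth_lift_row (X : 'rV[R]_(2 + 2)) :
  smooth_on TU (fun z => X *m lift_frame z).
Proof.
apply: (@smooth_ext _ _ _ _
   (fun z => row_mx (lsubmx X *m M (lsubmx z)) (vertical_coord z X))) => //.
  by move=> z Uz; rewrite mul_lift_frame.
apply: smooth_row_mx => //; last exact: smooth_vertical_coord.
by apply: smooth_mulmx => //; [move=> k; exact: Ck_cst|exact: smooth_base].
Qed.

Lemma smooth_lift_frame : smooth_on TU lift_frame.
Proof.
move=> k; apply: Ck_mx => // i j.
apply: (@Ck_ext _ _ _ _ _ (fun z => (basis_vec i *m lift_frame z) 0 j)) => //.
  by move=> z Uz; rewrite basis_mulmx.
by apply: (Ck_entry _ _ oTU (smooth_lift_row _ k)).
Qed.

Definition dconn (x : 'rV[R]_2) : R :=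
  'D_(basis_vec 0) (fun y => conn_form M y 0 1) x -
  'D_(basis_vec 1) (fun y => conn_form M y 0 0) x.

(** Forced by the vanishing of torsion: antisymmetrizing the derivatives of vertical parts leaves d
    omega(X, Y) i n, with n the fibre vector, and this coefficient compensates it. It is thus the
    curvature of the base contracted with n. *)
Definition lift_conn_coef (z X : 'rV[R]_(2 + 2)) : R :=
  - (dconn (lsubmx z) / \det (M (lsubmx z))) *
  (fibre_coord z *m (lsubmx X *m M (lsubmx z))^T) 0 0.

(** All blocks commute with [rot90], so J is parallel; the off-diagonal block is the only trace of
    the curvature of the base. *)
Definition lift_conn (z X : 'rV[R]_(2 + 2)) : 'M[R]_(2 + 2) :=
  block_mx (conn M (lsubmx z) (lsubmx X) *: rot90) (lift_conn_coef z X)%:M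
    0 (conn M (lsubmx z) (lsubmx X) *: rot90).

Lemma lift_conn_skew z X :
  lift_conn z X *m neutral_mx + (lift_conn z X *m neutral_mx)^T = 0.
Proof.
rewrite /lift_conn; move: (conn _ _ _) (lift_conn_coef _ _) => o lam.
have -> : block_mx (o *: rot90) lam%:M 0 (o *: rot90) *m neutral_mx =
    block_mx (lam *: rot90) o%:M (- o%:M) 0.
  rewrite /neutral_mx mulmx_block !(mulmx0, mul0mx, addr0, add0r) mulmxN.
  by rewrite -scalemxAl rot90_sq scalerN opprK mul_scalar_mx scalemx1.
have trN : (- o%:M : 'M[R]_2)^T = - o%:M by rewrite linearN /= tr_scalar_mx.
have trr : (lam *: rot90)^T = - (lam *: rot90) :> 'M[R]_2.
  by rewrite linearZ /= tr_rot90 scalerN.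
rewrite tr_block_mx add_block_mx trN trr tr_scalar_mx trmx0 addr0 !subrr addNr.
exact: block_mx0.
Qed.

(** This is d omega evaluated on the projections of two constant fields, whose bracket is zero. *)
Lemma derive_conn_base (z X Y : 'rV[R]_(2 + 2)) : TU z ->
  'D_X (fun y => conn M (lsubmx y) (lsubmx Y)) z -
  'D_Y (fun y => conn M (lsubmx y) (lsubmx X)) z =
  (lsubmx X 0 0 * lsubmx Y 0 1 - lsubmx X 0 1 * lsubmx Y 0 0) * dconn (lsubmx z).
Proof.
move=> Uz.
have dom a : differentiable (fun y => conn_form M y 0 a) (lsubmx z).
  by apply: differentiable_entry; exact: (smooth_diff (smooth_conn_form oU sM uM) Uz).
have dl : differentiable (lsubmx : 'rV[R]_(2 + 2) -> 'rV[R]_2) z.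
  exact: differentiable_lsubmx.
have dcomp a : differentiable (fun y : 'rV[R]_(2 + 2) => conn_form M (lsubmx y) 0 a) z.
  exact: (differentiable_comp dl (dom a)).
have DE (X' Y' : 'rV[R]_(2 + 2)) : 'D_X' (fun y => conn M (lsubmx y) (lsubmx Y')) z =
   lsubmx Y' 0 0 * 'D_(lsubmx X') (fun y => conn_form M y 0 0) (lsubmx z) +
   lsubmx Y' 0 1 * 'D_(lsubmx X') (fun y => conn_form M y 0 1) (lsubmx z).
  have Dc a : 'D_X' (fun y : 'rV[R]_(2 + 2) => conn_form M (lsubmx y) 0 a) z =
      'D_(lsubmx X') (fun y => conn_form M y 0 a) (lsubmx z).
    rewrite [LHS](derive_comp _ dl (dom a)).
    by rewrite (derive_linear _ _ (@continuous_lsubmx _ _ _ _)).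
  have dm a b : differentiable
      (fun y : 'rV[R]_(2 + 2) => b * conn_form M (lsubmx y) 0 a) z.
    by apply: differentiableM; [exact: differentiable_cst|exact: dcomp].
  rewrite [LHS](derive_fadd _ (dm 0 (lsubmx Y' 0 0)) (dm 1 (lsubmx Y' 0 1))).
  by rewrite (derive_fscale _ _ (dcomp 0)) (derive_fscale _ _ (dcomp 1)) (Dc 0) (Dc 1).
rewrite (DE X Y) (DE Y X) (derive_rV2 (lsubmx X) (dom 0)) (derive_rV2 (lsubmx X) (dom 1)).
rewrite (derive_rV2 (lsubmx Y) (dom 0)) (derive_rV2 (lsubmx Y) (dom 1)) /dconn.
move: ('D_(basis_vec 0) (fun y => conn_form M y 0 0) _)
  ('D_(basis_vec 1) (fun y => conn_form M y 0 0) _)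
  ('D_(basis_vec 0) (fun y => conn_form M y 0 1) _)
  ('D_(basis_vec 1) (fun y => conn_form M y 0 1) _) => p q p' q'.
by rewrite /GRing.scale /=; ring.
Qed.

(** Instance of [Gam_frame]. The horizontal part of the torsion vanishes as on the base; in the
    vertical part the second derivatives of the fibre coordinate commute and [lift_torsion_alg]
    settles the rest. *)
Lemma Gam_lift z X Y : TU z ->
  Gam (GGmx G) z X Y *m lift_frame z =
  Y *m 'D_X lift_frame z + Y *m lift_frame z *m lift_conn z X.
Proof.
move=> Uz; have dL := smooth_diff smooth_lift_frame Uz.
apply: (@Gam_frame _ _ _ lift_frame z neutral_mx (lift_conn z)) => //.
- have : \forall y \near z, TU y by exact: open_nbhs_nbhs.
  by apply: filterS => y; exact: GGmx_frame.
- exact: neutral_mx_tr.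
- exact: neutral_mx_unit.
- exact: lift_frame_unit.
- exact: lift_conn_skew.
move=> {}X {}Y.
have dV Z := smooth_diff (smooth_vertical_coord Z) Uz.
have dMb := smooth_diff smooth_base Uz.
have dF := smooth_diff smooth_fibre_coord Uz.
have nTU : \forall y \near z, TU y by exact: open_nbhs_nbhs.
have E Z W : W *m 'D_Z lift_frame z = row_mx (lsubmx W *m 'D_(lsubmx Z) M (lsubmx z))
    ('D_Z (vertical_coord^~ W) z).
  have dW : differentiable (fun y => W *m lift_frame y) z.
    exact: (smooth_diff (smooth_lift_row W) Uz).
  rewrite -derive_mulmxr//; apply: row_mxP.
    rewrite (derive_lsubmx _ dW) row_mxKl -(derive_base _ Uz).
    rewrite -(derive_mulmxr _ _ dMb).
    apply: near_eq_derive; apply: filterS nTU => y Uy.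
    by rewrite mul_lift_frame// row_mxKl.
  rewrite (derive_rsubmx _ dW) row_mxKr.
  apply: near_eq_derive; apply: filterS nTU => y Uy.
  by rewrite mul_lift_frame// row_mxKr.
have DV Z W : 'D_Z (vertical_coord^~ W) z =
   'D_Z ('D_W fibre_coord) z +
   ('D_Z (fun y => conn M (lsubmx y) (lsubmx W)) z *: (fibre_coord z *m rot90) +
    conn M (lsubmx z) (lsubmx W) *: ('D_Z fibre_coord z *m rot90)).
  have dc := smooth_diff (smooth_conn_base W) Uz.
  have dFr : differentiable (fun y => fibre_coord y *m rot90) z.
    by apply: differentiable_mulmx => //; exact: differentiable_cst.
  have dDF : differentiable ('D_W fibre_coord) z.
    exact: (smooth_diff (smooth_derive W smooth_fibre_coord) Uz).
  have nE : \forall y \near z, vertical_coord y W = 'D_W fibre_coord y +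
      conn M (lsubmx y) (lsubmx W) *: (fibre_coord y *m rot90).
    by apply: filterS nTU => y Uy; exact: vertical_coordE.
  rewrite (near_eq_derive _ nE) derive_mxadd//; last exact: differentiable_scale.
  rewrite derive_scale// derive_mulmx//.
  by rewrite derive_cst mulmx0 addr0.
rewrite (E X Y) (E Y X) (mul_lift_frame X Uz) (mul_lift_frame Y Uz).
rewrite /lift_conn !mul_row_block !mulmx0 !addr0.
rewrite !add_row_mx -!scalemxAr !mul_mx_scalar; congr row_mx.
  exact: (conn_torsion sM uM).
rewrite (DV X Y) (DV Y X) (vertical_coordE X Uz) (vertical_coordE Y Uz).
have -> : 'D_Y ('D_X fibre_coord) z = 'D_X ('D_Y fibre_coord) z.
  apply/rowP => j.
  have H Z W : ('D_Z ('D_W fibre_coord) z) 0 j =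
      'D_Z ('D_W (fun y => fibre_coord y 0 j)) z.
    rewrite (derive_entry _ _ _ (smooth_diff (smooth_derive W smooth_fibre_coord) Uz)).
    apply: near_eq_derive; apply: filterS nTU => y Uy.
    exact: (derive_entry _ _ _ (smooth_diff smooth_fibre_coord Uy)).
  have sj : smooth_on TU (fun y => fibre_coord y 0 j).
    by move=> k; exact: (Ck_entry 0 j oTU (smooth_fibre_coord k)).
  apply: (eq_trans (H Y X)); apply: (eq_trans _ (esym (H X Y))).
  exact: (smooth_derive_commute _ _ oTU Uz sj).
apply: lift_torsion_alg; last exact: derive_conn_base.
by rewrite gt_eqF// dM0.
Qed.

End Lift.

(** * The Lagrangian angle *)

Section SurfaceAlgebra.
Context {R : realType}.
Implicit Types a b z k p q : 'rV[R]_2.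

Definition dot a b : R := a 0 0 * b 0 0 + a 0 1 * b 0 1.

Lemma dotE a b : (a *m b^T) 0 0 = dot a b.
Proof. by rewrite mulmx2E !trmxE. Qed.

(* Real and imaginary parts of z1 k2 - z2 k1. *)
Definition cdet_re z1 k1 z2 k2 : R :=
  z1 0 0 * k2 0 0 - z1 0 1 * k2 0 1 - (z2 0 0 * k1 0 0 - z2 0 1 * k1 0 1).
Definition cdet_im z1 k1 z2 k2 : R :=
  z1 0 0 * k2 0 1 + z1 0 1 * k2 0 0 - (z2 0 0 * k1 0 1 + z2 0 1 * k1 0 0).

Definition symp z1 k1 z2 k2 : R := dot k1 z2 - dot z1 k2.
Definition neut z1 k1 z2 k2 : R := dot (k1 *m rot90) z2 - dot (z1 *m rot90) k2.

(** [neut] and [symp] are the real and imaginary parts, up to sign, of a hermitian form of signature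
    (1, 1); its Gram determinant on two vectors is minus the squared modulus of their complex
    determinant. *)
Lemma cdet_norm z1 k1 z2 k2 :
  cdet_re z1 k1 z2 k2 ^+ 2 + cdet_im z1 k1 z2 k2 ^+ 2 =
  neut z1 k1 z2 k2 ^+ 2 + symp z1 k1 z2 k2 ^+ 2 -
  neut z1 k1 z1 k1 * neut z2 k2 z2 k2.
Proof. by rewrite /cdet_re /cdet_im /neut /symp /dot !mulmx_rot90; ring. Qed.

(** The left side is Im (conj(lag) d lag) = |lag|^2 d arg lag, for a variation (p_a, q_a) of the
    frame. The right side is minus the trace of the pairings of variation and frame against the
    adjugate of the induced metric, plus a term that the Lagrangian condition kills. *)
Lemma cdet_derivative z1 k1 z2 k2 p1 q1 p2 q2 :
  cdet_re z1 k1 z2 k2 * (cdet_im p1 q1 z2 k2 + cdet_im z1 k1 p2 q2) -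
  cdet_im z1 k1 z2 k2 * (cdet_re p1 q1 z2 k2 + cdet_re z1 k1 p2 q2) =
  - (neut z2 k2 z2 k2 * symp p1 q1 z1 k1 + neut z1 k1 z1 k1 * symp p2 q2 z2 k2
     - neut z1 k1 z2 k2 * (symp p1 q1 z2 k2 + symp p2 q2 z1 k1)
     + symp z1 k1 z2 k2 * (neut p1 q1 z2 k2 - neut p2 q2 z1 k1)).
Proof. by rewrite /cdet_re /cdet_im /neut /symp /dot !mulmx_rot90; ring. Qed.

(** The symplectic form is parallel: the rotation terms cancel since rotations preserve it, the
    terms in [l] by the symmetry of [dot]. *)
Lemma symp_conn z k z' k' p q p' q' (o l : R) :
  0 = symp p q z' k' + symp z k p' q' ->
  symp (p + o *: (z *m rot90)) (q + (l *: z + o *: (k *m rot90))) z' k' =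
  symp (p' + o *: (z' *m rot90)) (q' + (l *: z' + o *: (k' *m rot90))) z k.
Proof.
rewrite /symp /dot !(addmxE, scalemxE) !mulmx_rot90 => H.
by apply/eqP; rewrite -subr_eq0; apply/eqP; rewrite [RHS]H; ring.
Qed.

(** Passing to covariant derivatives adds the complex trace 2 i o of the connection to d lag / lag;
    the off-diagonal [l] contributes nothing. *)
Lemma cdet_conn z k z' k' p q p' q' (o l : R) :
  let P := p + o *: (z *m rot90) in let Q := q + (l *: z + o *: (k *m rot90)) in
  let P' := p' + o *: (z' *m rot90) in
  let Q' := q' + (l *: z' + o *: (k' *m rot90)) in
  cdet_re z k z' k' * (cdet_im p q z' k' + cdet_im z k p' q') -
  cdet_im z k z' k' * (cdet_re p q z' k' + cdet_re z k p' q') +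
  2 * o * (cdet_re z k z' k' ^+ 2 + cdet_im z k z' k' ^+ 2) =
  cdet_re z k z' k' * (cdet_im P Q z' k' + cdet_im z k P' Q') -
  cdet_im z k z' k' * (cdet_re P Q z' k' + cdet_re z k P' Q').
Proof.
move=> P Q P' Q'; rewrite /P /Q /P' /Q' /cdet_re /cdet_im !(addmxE, scalemxE).
by rewrite !mulmx_rot90; ring.
Qed.

(** This matrix and the next are those of the bilinear forms Re (z k) and Im (z k). *)
Definition conj_mx : 'M[R]_2 := \matrix_(i, j) ((i == j)%:R * (-1) ^+ (i == 1)).
Definition swap_mx : 'M[R]_2 := \matrix_(i, j) (i != j)%:R.

Lemma bil_skew_block (C : 'M[R]_2) z1 k1 z2 k2 :
  bil (block_mx 0 C (- C) 0) (row_mx z1 k1) (row_mx z2 k2) =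
  (z1 *m C *m k2^T) 0 0 - (k1 *m C *m z2^T) 0 0.
Proof.
rewrite /bil mul_row_block !(mulmx0, addr0, add0r) mulmxN tr_row_mx mul_row_col.
by rewrite mulNmx addmxE oppmxE addrC.
Qed.

Lemma sympE z1 k1 z2 k2 : symp z1 k1 z2 k2 =
  bil (block_mx 0 (- 1%:M) (- - 1%:M) 0) (row_mx z1 k1) (row_mx z2 k2).
Proof. by rewrite bil_skew_block !mulmxN !mulNmx !mulmx1 !oppmxE !dotE /symp; ring. Qed.

Lemma cdet_reE z1 k1 z2 k2 : cdet_re z1 k1 z2 k2 =
  bil (block_mx 0 conj_mx (- conj_mx) 0) (row_mx z1 k1) (row_mx z2 k2).
Proof.
rewrite bil_skew_block !dotE /dot !mulmx2E ![conj_mx _ _]mxE /= /cdet_re.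
by rewrite expr0 expr1; ring.
Qed.

Lemma cdet_imE z1 k1 z2 k2 : cdet_im z1 k1 z2 k2 =
  bil (block_mx 0 swap_mx (- swap_mx) 0) (row_mx z1 k1) (row_mx z2 k2).
Proof.
by rewrite bil_skew_block !dotE /dot !mulmx2E ![swap_mx _ _]mxE /= /cdet_im; ring.
Qed.

Lemma neutE z1 k1 z2 k2 : neut z1 k1 z2 k2 =
  bil neutral_mx (row_mx z1 k1) (row_mx z2 k2).
Proof. by rewrite bil_neutral !dotE. Qed.

Lemma neut_sym z1 k1 z2 k2 : neut z1 k1 z2 k2 = neut z2 k2 z1 k1.
Proof. by rewrite /neut /dot !mulmx_rot90; ring. Qed.

Lemma invmx2E (A : 'M[R]_2) : A \in unitmx ->
  ((invmx A 0 0 = A 1 1 / \det A) * (invmx A 0 1 = - A 0 1 / \det A)) *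
  ((invmx A 1 0 = - A 1 0 / \det A) * (invmx A 1 1 = A 0 0 / \det A)).
Proof.
move=> uA; have := uA; rewrite unitmxE unitfE => d0.
pose B : 'M[R]_2 := \matrix_(i, j) ((if i == 0 then (if j == 0 then A 1 1 else - A 0 1)
    else (if j == 0 then - A 1 0 else A 0 0)) / \det A).
have BA : B *m A = 1%:M.
  apply/matrixP; apply: forall2; apply: forall2;
    rewrite mulmx2E ![B _ _]mxE !mxE /= det2E; field; by rewrite -det2E.
have -> : invmx A = B by rewrite -[RHS](mulmxK uA) BA mul1mx.
by rewrite !mxE.
Qed.

(** Clears the denominator: up to det h the inverse is the adjugate, and the result has the
    polynomial shape met in [cdet_derivative]. *)
Lemma trace2 (h : 'M[R]_2) (c : 'I_2 -> 'I_2 -> R) :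
  h \in unitmx -> h 1 0 = h 0 1 ->
  2^-1 * (\sum_(a < 2) \sum_(b < 2) invmx h a b * c a b) = 0 ->
  h 1 1 * c 0 0 - h 0 1 * (c 0 1 + c 1 0) + h 0 0 * c 1 1 = 0.
Proof.
move=> uh hs; have := uh; rewrite unitmxE unitfE => d0.
rewrite !sum2E !(invmx2E uh) hs; move: (\det h) d0 => e e0 H.
set S := (X in _ * X) in H.
have -> : h 1 1 * c 0 0 - h 0 1 * (c 0 1 + c 1 0) + h 0 0 * c 1 1 =
    (2 * e) * (2^-1 * S) by rewrite /S; field.
by rewrite H mulr0.
Qed.

End SurfaceAlgebra.

Lemma Gam_sym (R : realType) (N : nat) (G : 'rV[R]_N -> 'M[R]_N) (x v w : 'rV[R]_N) :
  (forall i j, \forall y \near x, G y i j = G y j i) -> Gam G x v w = Gam G x w v.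
Proof.
move=> symG; apply/rowP => k; rewrite !mxE exchange_big /=.
apply: eq_bigr => i _; apply: eq_bigr => j _.
suff -> : christoffel G x k j i = christoffel G x k i j by rewrite mulrAC.
rewrite /christoffel; congr (_ * _); apply: eq_bigr => l _; congr (_ * _).
by rewrite (near_eq_derive _ (symG j i)); congr (_ - _); exact: addrC.
Qed.

Section FormDerivative.
Context {R : realType} {V : normedModType R}.

Lemma differentiable_row_mx n p (f : V -> 'rV[R]_n) (g : V -> 'rV[R]_p) x :
  differentiable f x -> differentiable g x ->
  differentiable (fun y => row_mx (f y) (g y)) x.
Proof.
move=> df dg; apply: differentiable_mx => i j.
case: (splitP j) => j' jE.
  have -> : j = lshift p j' by exact/val_inj.
  by under eq_fun do rewrite row_mxEl; exact: differentiable_entry.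
have -> : j = rshift n j' by exact/val_inj.
by under eq_fun do rewrite row_mxEr; exact: differentiable_entry.
Qed.

Lemma derive_row_mx n p (f : V -> 'rV[R]_n) (g : V -> 'rV[R]_p) x v :
  differentiable f x -> differentiable g x ->
  'D_v (fun y => row_mx (f y) (g y)) x = row_mx ('D_v f x) ('D_v g x).
Proof.
move=> df dg; have dr := differentiable_row_mx df dg.
apply: row_mxP.
  rewrite (derive_lsubmx _ dr) row_mxKl; congr ('D_v _ x).
  by apply/funext => y; rewrite row_mxKl.
rewrite (derive_rsubmx _ dr) row_mxKr; congr ('D_v _ x).
by apply/funext => y; rewrite row_mxKr.
Qed.

(** One product rule serving [symp], [cdet_re] and [cdet_im], all of them bilinear forms with a
    constant matrix. *)
Lemma derive_form (B : 'rV[R]_2 -> 'rV[R]_2 -> 'rV[R]_2 -> 'rV[R]_2 -> R)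
    (Q : 'M[R]_(2 + 2)) (z k z' k' : V -> 'rV[R]_2) x v :
  (forall a b c d, B a b c d = bil Q (row_mx a b) (row_mx c d)) ->
  differentiable z x -> differentiable k x ->
  differentiable z' x -> differentiable k' x ->
  'D_v (fun y => B (z y) (k y) (z' y) (k' y)) x =
  B ('D_v z x) ('D_v k x) (z' x) (k' x) + B (z x) (k x) ('D_v z' x) ('D_v k' x).
Proof.
move=> BE dz dk dz' dk'; under eq_fun do rewrite BE.
rewrite (derive_bil _ _ (differentiable_row_mx dz dk) (differentiable_row_mx dz' dk')).
by rewrite !derive_row_mx// !BE.
Qed.

End FormDerivative.

(** * The cubic form and the angle of a minimal Lagrangian surface *)

Section Surface.
Context {R : realType}.
Variables (U : set 'rV[R]_2) (M G : 'rV[R]_2 -> 'M[R]_2).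
Hypothesis oU : open U.
Hypothesis sM : smooth_on U M.
Hypothesis dM0 : forall x, U x -> 0 < \det (M x).
Hypothesis GM : forall x, U x -> G x = M x *m (M x)^T.
Variables (D : set 'rV[R]_2) (F : 'rV[R]_2 -> 'rV[R]_(2 + 2)).
Hypothesis oD : open D.
Hypothesis sF : smooth_on D F.
Hypothesis FU : forall u, D u -> U (lsubmx (F u)).

Definition frame_vec (a : 'I_2) (u : 'rV[R]_2) : 'rV[R]_(2 + 2) :=
  pderiv F a u *m lift_frame M (F u).
Definition hor (a : 'I_2) (u : 'rV[R]_2) : 'rV[R]_2 := lsubmx (frame_vec a u).
Definition ver (a : 'I_2) (u : 'rV[R]_2) : 'rV[R]_2 := rsubmx (frame_vec a u).
Definition pconn (a : 'I_2) (u : 'rV[R]_2) : R :=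
  conn M (lsubmx (F u)) (lsubmx (pderiv F a u)).
Definition hess (a b : 'I_2) (u : 'rV[R]_2) : 'rV[R]_(2 + 2) :=
  cov_deriv (GGmx G) (F u) (pderiv F a u) (pderiv F b u)
    ('D_(basis_vec a) (pderiv F b) u).

Let TU := [set z : 'rV[R]_(2 + 2) | U (lsubmx z)].
Let oTU : open TU. Proof. exact: open_lift oU. Qed.

Lemma hor_verK a u : row_mx (hor a u) (ver a u) = frame_vec a u.
Proof. exact: hsubmxK. Qed.

Lemma frame_vecE a u :
  pderiv F a u *m lift_frame M (F u) = row_mx (hor a u) (ver a u).
Proof. by rewrite hor_verK. Qed.

Lemma smooth_pderiv a : smooth_on D (pderiv F a).
Proof. exact: smooth_derive. Qed.

Lemma smooth_lift_along : smooth_on D (fun u => lift_frame M (F u)).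
Proof. exact: (smooth_comp oD oTU FU sF (smooth_lift_frame oU sM dM0)). Qed.

Lemma smooth_frame_vec a : smooth_on D (frame_vec a).
Proof. by apply: smooth_mulmx => //; [exact: smooth_pderiv|exact: smooth_lift_along]. Qed.

Lemma smooth_hor a : smooth_on D (hor a).
Proof.
apply: (@smooth_comp _ _ _ _ _ D setT (frame_vec a) lsubmx) => //.
- exact: openT.
- exact: smooth_frame_vec.
- exact: smooth_lsubmx.
Qed.

Lemma smooth_ver a : smooth_on D (ver a).
Proof.
apply: (@smooth_comp _ _ _ _ _ D setT (frame_vec a) rsubmx) => //.
- exact: openT.
- exact: smooth_frame_vec.
- exact: smooth_rsubmx.
Qed.

Lemma hess_frame a b u : D u ->
  hess a b u *m lift_frame M (F u) = 'D_(basis_vec a) (frame_vec b) u +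
    frame_vec b u *m lift_conn M (F u) (pderiv F a u).
Proof.
move=> Du; rewrite /hess /cov_deriv mulmxDl.
rewrite (Gam_lift oU sM dM0 GM _ _ (FU Du)) addrA; congr (_ + _).
have dF := smooth_diff sF Du.
have dP := smooth_diff (smooth_pderiv b) Du.
have dL := smooth_diff (smooth_lift_frame oU sM dM0) (FU Du).
rewrite (derive_mulmx _ dP (smooth_diff smooth_lift_along Du)); congr (_ + _ *m _).
by rewrite [RHS](derive_comp _ dF dL).
Qed.

Lemma hess_sym a b u : D u -> hess a b u = hess b a u.
Proof.
move=> Du.
have E1 : 'D_(basis_vec a) (pderiv F b) u = 'D_(basis_vec b) (pderiv F a) u.
  apply/rowP => j.
  have H c d : ('D_(basis_vec c) (pderiv F d) u) 0 j =
      'D_(basis_vec c) ('D_(basis_vec d) (fun v => F v 0 j)) u.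
    rewrite (derive_entry _ _ _ (smooth_diff (smooth_pderiv d) Du)).
    have nD : \forall v \near u, D v by exact: open_nbhs_nbhs.
    apply: near_eq_derive; apply: filterS nD => v Dv.
    exact: (derive_entry _ _ _ (smooth_diff sF Dv)).
  apply: (eq_trans (H a b)); apply: (eq_trans _ (esym (H b a))).
  have sFj : smooth_on D (fun v => F v 0 j) by move=> k; exact: (Ck_entry 0 j oD (sF k)).
  exact: (smooth_derive_commute _ _ oD Du sFj).
suff E2 : Gam (GGmx G) (F u) (pderiv F a u) (pderiv F b u) =
    Gam (GGmx G) (F u) (pderiv F b u) (pderiv F a u).
  exact: (f_equal2 +%R E1 E2).
apply: Gam_sym => i j.
have nTU : \forall z \near F u, TU z.
  by apply: open_nbhs_nbhs; split; [exact: oTU|exact: (FU Du)].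
apply: filterS nTU => z Uz; rewrite (GGmx_frame oU sM dM0 GM Uz).
pose P := lift_frame M z *m neutral_mx *m (lift_frame M z)^T.
have PT : P^T = P by rewrite /P !trmx_mul trmxK neutral_mx_tr mulmxA.
by rewrite -/P -[in LHS]PT mxE.
Qed.

Lemma induced_metric_frame a b u : D u ->
  induced_metric (GGmx G) F u a b = neut (hor a u) (ver a u) (hor b u) (ver b u).
Proof.
move=> Du; rewrite mxE (GGmx_frame oU sM dM0 GM (FU Du)) bil_mulmx neutE.
exact: (f_equal2 (bil neutral_mx) (frame_vecE a u) (frame_vecE b u)).
Qed.

Lemma induced_metric_sym u : D u ->
  induced_metric (GGmx G) F u 1 0 = induced_metric (GGmx G) F u 0 1.
Proof.
move=> Du; apply: (eq_trans (induced_metric_frame 1 0 Du)).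
exact: (eq_trans (neut_sym _ _ _ _) (esym (induced_metric_frame 0 1 Du))).
Qed.

Lemma Omega_frame a b u : D u ->
  Omega G (F u) (pderiv F a u) (pderiv F b u) =
  symp (hor a u) (ver a u) (hor b u) (ver b u).
Proof.
move=> Du; have Uz := FU Du.
have bG v w : bil (G (lsubmx (F u))) v w =
    dot (v *m M (lsubmx (F u))) (w *m M (lsubmx (F u))).
  by rewrite -dotE /bil (GM Uz) trmx_mul !mulmxA.
have K a' : Kmap G (F u) (pderiv F a' u) *m M (lsubmx (F u)) = ver a' u.
  rewrite (Kmap_frame oU sM dM0 GM _ Uz).
  by rewrite /ver /frame_vec (mul_lift_frame sM _ Uz) row_mxKr.
have P a' : Pmap (pderiv F a' u) *m M (lsubmx (F u)) = hor a' u.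
  by rewrite /hor /frame_vec (mul_lift_frame sM _ Uz) row_mxKl.
rewrite /Omega (bG (Kmap G (F u) (pderiv F a u))) (bG (Pmap (pderiv F a u))).
exact: (f_equal2 (fun x y => x - y) (f_equal2 dot (K a) (P b)) (f_equal2 dot (P a) (K b))).
Qed.

#[local] Opaque derive pderiv lift_frame frame_vec hor ver hess.

(* Components, in the moving frame, of the covariant derivative of the b-th
   coordinate tangent vector along the a-th one. *)
Lemma hess_hor a b u : D u ->
  lsubmx (hess a b u *m lift_frame M (F u)) =
  'D_(basis_vec a) (hor b) u + pconn a u *: (hor b u *m rot90).
Proof.
move=> Du; rewrite hess_frame// linearD /=; congr (_ + _).
  exact: (derive_lsubmx _ (smooth_diff (smooth_frame_vec b) Du)).
rewrite -hor_verK /lift_conn mul_row_block row_mxKl mulmx0 addr0.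
by rewrite -scalemxAr.
Qed.

Lemma hess_ver a b u : D u ->
  rsubmx (hess a b u *m lift_frame M (F u)) =
  'D_(basis_vec a) (ver b) u + (lift_conn_coef M (F u) (pderiv F a u) *: hor b u +
    pconn a u *: (ver b u *m rot90)).
Proof.
move=> Du; rewrite hess_frame// linearD /=; congr (_ + _).
  exact: (derive_rsubmx _ (smooth_diff (smooth_frame_vec b) Du)).
rewrite -hor_verK /lift_conn mul_row_block row_mxKr mul_mx_scalar.
by rewrite -scalemxAr.
Qed.

Hypothesis lagF : forall u, D u -> forall a b,
  Omega G (F u) (pderiv F a u) (pderiv F b u) = 0.
Hypothesis nonnullF : forall u, D u -> induced_metric (GGmx G) F u \in unitmx.
Hypothesis minF : forall u, D u -> mean_curvature (GGmx G) F u = 0.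

Definition cubic (c a b : 'I_2) (u : 'rV[R]_2) : R :=
  symp (lsubmx (hess c a u *m lift_frame M (F u)))
    (rsubmx (hess c a u *m lift_frame M (F u))) (hor b u) (ver b u).

Lemma sym_cubic12 c a b u : D u -> cubic c a b u = cubic a c b u.
Proof. by move=> Du; rewrite /cubic hess_sym. Qed.

Lemma symp_lag a b v : D v -> symp (hor a v) (ver a v) (hor b v) (ver b v) = 0.
Proof. by move=> Dv; apply: (eq_trans (esym (Omega_frame a b Dv))); exact: lagF. Qed.

Lemma cubicE c a b u : D u -> cubic c a b u =
  symp ('D_(basis_vec c) (hor a) u + pconn c u *: (hor a u *m rot90))
    ('D_(basis_vec c) (ver a) u + (lift_conn_coef M (F u) (pderiv F c u) *: hor a u +
      pconn c u *: (ver a u *m rot90))) (hor b u) (ver b u).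
Proof. by move=> Du; rewrite /cubic (hess_hor c a Du) (hess_ver c a Du). Qed.

(** Differentiate the Lagrangian condition along the [c]-th direction and use that the symplectic
    form is parallel. *)
Lemma sym_cubic23 c a b u : D u -> cubic c a b u = cubic c b a u.
Proof.
move=> Du.
have nD : \forall v \near u, D v by exact: open_nbhs_nbhs.
have nE : \forall v \near u,
    symp (hor a v) (ver a v) (hor b v) (ver b v) = cst 0 v.
  by apply: filterS nD => v Dv; exact: symp_lag.
have dh e := smooth_diff (smooth_hor e) Du.
have dv e := smooth_diff (smooth_ver e) Du.
have := derive_form (basis_vec c) sympE (dh a) (dv a) (dh b) (dv b).
move=> /(eq_trans (esym (near_eq_derive _ nE))).
move=> /(eq_trans (esym (derive_cst _ _ _))).
rewrite (cubicE c a b Du) (cubicE c b a Du).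
exact: symp_conn.
Qed.

(* The cubic form is totally symmetric and pairs the second fundamental form with
   the tangent plane rotated by J, so its trace is the mean curvature. *)
Lemma cubic_trace d u : D u ->
  let h a b := induced_metric (GGmx G) F u a b in
  h 1 1 * cubic d 0 0 u - h 0 1 * (cubic d 0 1 u + cubic d 1 0 u)
  + h 0 0 * cubic d 1 1 u = 0.
Proof.
move=> Du h.
pose Q : 'M[R]_(2 + 2) := block_mx 0 (- 1%:M) (- - 1%:M) 0.
(* Symplectic pairing with the [d]-th tangent vector. It kills tangent vectors by the Lagrangian
   condition, so it takes the same value on [hess] and on the second fundamental form. *)
pose phi (w : 'rV[R]_(2 + 2)) := bil Q (w *m lift_frame M (F u)) (frame_vec d u).
have phiD v w : phi (v + w) = phi v + phi w by rewrite /phi mulmxDl bilDl.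
have phiZ c v : phi (c *: v) = c * phi v.
  by rewrite /phi -scalemxAl /bil -!scalemxAl scalemxE.
have phiN v : phi (- v) = - phi v by rewrite -scaleN1r phiZ mulN1r.
have phiE w : phi w =
    symp (lsubmx (w *m lift_frame M (F u))) (rsubmx (w *m lift_frame M (F u)))
      (hor d u) (ver d u).
  apply/esym/(eq_trans (sympE _ _ _ _)).
  exact: (f_equal2 (bil Q) (hsubmxK _) (hor_verK d u)).
have phiF a : phi (pderiv F a u) = 0 by rewrite phiE; exact: (symp_lag a d Du).
have phiH a b : phi (hess a b u) = cubic a b d u by exact: phiE.
have {phiE} : exists2 psi : 'rV[R]_(2 + 2) -> R,
    [/\ forall v w, psi (v + w) = psi v + psi w,
        forall c v, psi (c *: v) = c * psi v & forall a, psi (pderiv F a u) = 0]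
    & forall a b, psi (hess a b u) = cubic a b d u by exists phi.
case=> {phiD phiZ phiN phiF phiH}phi [phiD phiZ phiF] phiH {Q}.
have phiN v : phi (- v) = - phi v by rewrite -scaleN1r phiZ mulN1r.
have phi0 : phi 0 = 0 by rewrite -(scale0r 0) phiZ mul0r.
have phi_sum (I : Type) (r : seq I) (f : I -> 'rV[R]_(2 + 2)) :
    phi (\sum_(i <- r) f i) = \sum_(i <- r) phi (f i).
  by elim: r => [|i r IH]; rewrite ?big_nil// !big_cons phiD IH.
have phiS a b : phi (second_fundamental_form (GGmx G) F u a b) = cubic a b d u.
  rewrite -phiH /second_fundamental_form /normal_part phiD phiN.
  rewrite [X in _ - X](_ : _ = 0) ?subr0//.
  rewrite phi_sum big1// => a' _; rewrite phi_sum big1// => b' _.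
  by rewrite phiZ phiF mulr0.
have S : 2^-1 * (\sum_(a < 2) \sum_(b < 2)
    invmx (induced_metric (GGmx G) F u) a b * cubic d a b u) = 0.
  rewrite -[RHS]phi0 -(minF Du) /mean_curvature phiZ phi_sum; congr (_ * _).
  apply: eq_bigr => a _; rewrite phi_sum; apply: eq_bigr => b _.
  (* Total symmetry exchanges the direction of differentiation with the slot of the pairing, so the
     trace over [a] and [b] becomes [phi] of the mean curvature vector. *)
  have E : cubic d a b u = phi (second_fundamental_form (GGmx G) F u a b).
    rewrite phiS.
    exact: (eq_trans (sym_cubic12 d a b Du) (sym_cubic23 a d b Du)).
  by rewrite phiZ E.
exact: (trace2 (nonnullF Du) (induced_metric_sym Du) S).
Qed.

Definition lag_re u := cdet_re (hor 0 u) (ver 0 u) (hor 1 u) (ver 1 u).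
Definition lag_im u := cdet_im (hor 0 u) (ver 0 u) (hor 1 u) (ver 1 u).

(* The derivative of the angle, corrected by the connection, is a trace of the
   cubic form, hence zero by minimality. *)
Lemma lag_angle c u : D u ->
  lag_re u * 'D_(basis_vec c) lag_im u - lag_im u * 'D_(basis_vec c) lag_re u
  + 2 * pconn c u * (lag_re u ^+ 2 + lag_im u ^+ 2) = 0.
Proof.
move=> Du.
have dh e := smooth_diff (smooth_hor e) Du.
have dv e := smooth_diff (smooth_ver e) Du.
have Dre := derive_form (basis_vec c) cdet_reE (dh 0) (dv 0) (dh 1) (dv 1).
have Dim := derive_form (basis_vec c) cdet_imE (dh 0) (dv 0) (dh 1) (dv 1).
rewrite [X in _ * X - _]Dim [X in _ - _ * X]Dre.
(* The term in omega is absorbed by replacing derivatives with covariant ones; what remains is minus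
   the trace of the cubic form. *)
apply: (eq_trans (cdet_conn _ _ _ _ _ _ _ _ (pconn c u)
  (lift_conn_coef M (F u) (pderiv F c u)))).
apply: (eq_trans (cdet_derivative _ _ _ _ _ _ _ _)).
rewrite (symp_lag 0 1 Du) mul0r addr0 -[RHS]oppr0; congr (- _).
apply: (eq_trans _ (cubic_trace c Du)) => /=.
rewrite !(induced_metric_frame _ _ Du) !(cubicE c _ _ Du).
exact: addrAC.
Qed.

Lemma lag_norm u : D u -> 0 < lag_re u ^+ 2 + lag_im u ^+ 2.
Proof.
move=> Du; have uh := nonnullF Du; move: uh; rewrite unitmxE unitfE det2E => h0.
have lag01 := symp_lag 0 1 Du.
rewrite lt_neqAle addr_ge0 ?sqr_ge0// andbT eq_sym /lag_re /lag_im cdet_norm lag01.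
apply: contra h0; rewrite (induced_metric_frame 0 0 Du) (induced_metric_frame 1 1 Du).
rewrite (induced_metric_sym Du) (induced_metric_frame 0 1 Du).
move=> /eqP h0; apply/eqP; rewrite -[RHS]oppr0 -h0.
have K (p q r : R) : p * q - r * r = - (r ^+ 2 + 0 ^+ 2 - p * q) by ring.
exact: K.
Qed.

End Surface.

(** * Consequences of the angle equation *)

Section AngleAlgebra.
Context {R : realType}.

(* If 2 w (p^2 + q^2) = q dp - p dq, i.e. w is half the differential of the
   argument of p - i q, then w is closed. *)
Lemma closed_angle (p q p0 q0 p1 q1 p01 q01 w0 w1 dw10 dw01 : R) :
  0 < p ^+ 2 + q ^+ 2 ->
  p * q0 - q * p0 + 2 * w0 * (p ^+ 2 + q ^+ 2) = 0 ->
  p * q1 - q * p1 + 2 * w1 * (p ^+ 2 + q ^+ 2) = 0 ->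
  p0 * q1 + p * q01 - (q0 * p1 + q * p01) + (2 * dw01 * (p ^+ 2 + q ^+ 2)
    + 2 * w1 * (2 * p * p0 + 2 * q * q0)) = 0 ->
  p1 * q0 + p * q01 - (q1 * p0 + q * p01) + (2 * dw10 * (p ^+ 2 + q ^+ 2)
    + 2 * w0 * (2 * p * p1 + 2 * q * q1)) = 0 ->
  dw01 - dw10 = 0.
Proof.
move=> m0 E0 E1 F1 F0.
have wE w p' q' : p * q' - q * p' + 2 * w * (p ^+ 2 + q ^+ 2) = 0 ->
    w = (q * p' - p * q') / (2 * (p ^+ 2 + q ^+ 2)).
  move=> E; apply: (canRL (mulfK _)); first by rewrite mulf_neq0 ?lt0r_neq0.
  by apply/eqP; rewrite -subr_eq0 -[X in _ == X]E; apply/eqP; ring.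
have w0E := wE _ _ _ E0; have w1E := wE _ _ _ E1.
apply: (mulIf (lt0r_neq0 m0)); rewrite mul0r.
(* The mixed second derivatives cancel in the difference of the two differentiated equations; the
   products of first derivatives cancel once w0 and w1 are replaced by their rational
   expressions. *)
have -> : (dw01 - dw10) * (p ^+ 2 + q ^+ 2) =
  2^-1 * ((p0 * q1 + p * q01 - (q0 * p1 + q * p01) + (2 * dw01 * (p ^+ 2 + q ^+ 2)
    + 2 * w1 * (2 * p * p0 + 2 * q * q0))) -
   (p1 * q0 + p * q01 - (q1 * p0 + q * p01) + (2 * dw10 * (p ^+ 2 + q ^+ 2)
    + 2 * w0 * (2 * p * p1 + 2 * q * q1)))).
  by rewrite w0E w1E; field; exact: lt0r_neq0.
by rewrite F0 F1 subrr mulr0.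
Qed.

(* With the unit complex number c + i s, the hypothesis p A + q B = 0 says that
   p + i q is a real multiple of i (c + i s)^2. *)
Lemma parallel_angle (p q dp dq c s dc ds w : R) :
  0 < p ^+ 2 + q ^+ 2 -> c ^+ 2 + s ^+ 2 = 1 -> c * dc + s * ds = 0 ->
  p * (c ^+ 2 - s ^+ 2) + q * (2 * c * s) = 0 ->
  dp * (c ^+ 2 - s ^+ 2) + p * (2 * c * dc - 2 * s * ds) +
    (dq * (2 * c * s) + q * (2 * (dc * s + c * ds))) = 0 ->
  p * dq - q * dp + 2 * w * (p ^+ 2 + q ^+ 2) = 0 ->
  dc = w * s /\ ds = - (w * c).
Proof.
move=> m0 cs1 dcs pq0 dpq ang.
(* Angular velocity of the unit number c + i s, whose derivative is i t (c + i s); the claim becomes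
   w = - t. *)
pose t := c * ds - s * dc.
have dcE : dc = - (t * s).
  have : dc = dc * (c ^+ 2 + s ^+ 2) by rewrite cs1 mulr1.
  move=> ->; rewrite (_ : dc * (c ^+ 2 + s ^+ 2) = c * (c * dc + s * ds) - t * s).
    by rewrite dcs mulr0 sub0r.
  by rewrite /t; ring.
have dsE : ds = t * c.
  have : ds = ds * (c ^+ 2 + s ^+ 2) by rewrite cs1 mulr1.
  move=> ->; rewrite (_ : ds * (c ^+ 2 + s ^+ 2) = s * (c * dc + s * ds) + t * c).
    by rewrite dcs mulr0 add0r.
  by rewrite /t; ring.
clearbody t.
pose A := c ^+ 2 - s ^+ 2; pose B := 2 * c * s.
have AB1 : A ^+ 2 + B ^+ 2 = 1.
  by rewrite -(expr1n _ 2) -cs1 /A /B; ring.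
(* The real factor in p + i q = i r (A + i B), where A + i B = (c + i s)^2. *)
pose r := q * A - p * B.
have qE : q = r * A.
  have -> : r * A = q * (A ^+ 2 + B ^+ 2) - B * (p * A + q * B) by rewrite /r; ring.
  by rewrite AB1 [X in B * X](_ : _ = 0)// mulr0 subr0 mulr1.
have pE : p = - (r * B).
  have -> : - (r * B) = p * (A ^+ 2 + B ^+ 2) - A * (p * A + q * B) by rewrite /r; ring.
  by rewrite AB1 [X in A * X](_ : _ = 0)// mulr0 subr0 mulr1.
have m2 : p ^+ 2 + q ^+ 2 = r ^+ 2.
  rewrite {1}pE {1}qE (_ : _ + _ = r ^+ 2 * (A ^+ 2 + B ^+ 2)); last by ring.
  by rewrite AB1 mulr1.
have dpq' : dp * A + dq * B + 2 * r * t = 0.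
  by rewrite -[RHS]dpq dcE dsE /r /A /B; ring.
have key : (w + t) * r ^+ 2 = 0.
  have -> : (w + t) * r ^+ 2 = 2^-1 * ((- (r * B) * dq - (r * A) * dp + 2 * w * r ^+ 2) +
      r * (dp * A + dq * B + 2 * r * t)) by field.
  by rewrite dpq' mulr0 addr0 -pE -qE -m2 ang mulr0.
have wt : w = - t.
  apply/eqP; rewrite -addr_eq0; move/eqP: key; rewrite mulf_eq0 => /orP[//|].
  by rewrite -m2 gt_eqF.
by rewrite dcE dsE wt; split; ring.
Qed.

(** With horizontal parts a z and b z, lag = z (a k' - b k). The left side is Re (lag conj(z)^2),
    which is |z|^2 Re ((a k' - b k) conj(z)). *)
Lemma cdet_line_angle (z k k' : 'rV[R]_2) (a b : R) :
  cdet_re (a *: z) k (b *: z) k' * (z 0 0 ^+ 2 - z 0 1 ^+ 2) +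
  cdet_im (a *: z) k (b *: z) k' * (2 * z 0 0 * z 0 1) =
  - symp (a *: z) k (b *: z) k' * dot z z.
Proof. by rewrite /cdet_re /cdet_im /symp /dot !scalemxE; ring. Qed.

(** The modulus of z (a k' - b k) through the components of a k' - b k along z and i z. On a
    Lagrangian surface the first vanishes, so the second cannot where [lag] is nonzero. *)
Lemma cdet_line_norm (z k k' : 'rV[R]_2) (a b : R) :
  cdet_re (a *: z) k (b *: z) k' ^+ 2 + cdet_im (a *: z) k (b *: z) k' ^+ 2 =
  symp (a *: z) k (b *: z) k' ^+ 2 +
  (a * dot k' (z *m rot90) - b * dot k (z *m rot90)) ^+ 2.
Proof. by rewrite /cdet_re /cdet_im /symp /dot !mulmx_rot90 !scalemxE; ring. Qed.

Lemma symp_line (z k k' : 'rV[R]_2) (a b : R) :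
  symp (a *: z) k (b *: z) k' = b * dot k z - a * dot k' z.
Proof. by rewrite /symp /dot !scalemxE; ring. Qed.

Lemma dot_bil (a b : 'rV[R]_2) : dot a b = bil 1%:M a b.
Proof. by rewrite /bil mulmx1 dotE. Qed.

Lemma derive_dot (V : normedModType R) (f g : V -> 'rV[R]_2) x v :
  differentiable f x -> differentiable g x ->
  'D_v (fun y => dot (f y) (g y)) x = dot ('D_v f x) (g x) + dot (f x) ('D_v g x).
Proof.
by move=> df dg; under eq_fun do rewrite dot_bil; rewrite derive_bil// !dot_bil.
Qed.

(** For a parallel [e], differentiating the components of [n] along [e] and i [e] gives the
    components of the covariant derivative of [n]. *)
Lemma dot_conn (n e dn de : 'rV[R]_2) (o : R) :
  de + o *: (e *m rot90) = 0 ->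
  dot dn e + dot n de = dot (dn + o *: (n *m rot90)) e /\
  dot dn (e *m rot90) + dot n (de *m rot90) =
    dot (dn + o *: (n *m rot90)) (e *m rot90).
Proof.
move=> /eqP; rewrite addr_eq0 => /eqP ->.
by rewrite /dot !(addmxE, oppmxE, scalemxE, mulmx_rot90); split; ring.
Qed.

(** The exterior derivative commutes with pull-back, for a 1-form in the plane: the second
    derivatives of the map cancel by symmetry. *)
Lemma pconn_alg (xa xb : 'rV[R]_2)
    (s0 s1 t0 t1 o0 o1 o00 o01 o10 o11 b0 b1 a0 a1 : R) :
  s0 = t0 -> s1 = t1 ->
  b0 = xb 0 0 *: (o00 : R^o) + xb 0 1 *: (o10 : R^o) ->
  b1 = xb 0 0 *: (o01 : R^o) + xb 0 1 *: (o11 : R^o) ->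
  a0 = xa 0 0 *: (o00 : R^o) + xa 0 1 *: (o10 : R^o) ->
  a1 = xa 0 0 *: (o01 : R^o) + xa 0 1 *: (o11 : R^o) ->
  (s0 * o0 + xa 0 0 * b0) + (s1 * o1 + xa 0 1 * b1) -
  ((t0 * o0 + xb 0 0 * a0) + (t1 * o1 + xb 0 1 * a1)) =
  (o01 - o10) * (xb 0 0 * xa 0 1 - xb 0 1 * xa 0 0).
Proof. by move=> -> -> -> -> -> ->; rewrite /GRing.scale /=; ring. Qed.

End AngleAlgebra.

Section SurfaceConsequences.
Context {R : realType}.
Variables (U : set 'rV[R]_2) (M G : 'rV[R]_2 -> 'M[R]_2).
Hypothesis oU : open U.
Hypothesis sM : smooth_on U M.
Hypothesis dM0 : forall x, U x -> 0 < \det (M x).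
Hypothesis GM : forall x, U x -> G x = M x *m (M x)^T.
Variables (D : set 'rV[R]_2) (F : 'rV[R]_2 -> 'rV[R]_(2 + 2)).
Hypothesis oD : open D.
Hypothesis sF : smooth_on D F.
Hypothesis FU : forall u, D u -> U (lsubmx (F u)).
Hypothesis lagF : forall u, D u -> forall a b,
  Omega G (F u) (pderiv F a u) (pderiv F b u) = 0.
Hypothesis nonnullF : forall u, D u -> induced_metric (GGmx G) F u \in unitmx.
Hypothesis minF : forall u, D u -> mean_curvature (GGmx G) F u = 0.

Let uM x : U x -> M x \in unitmx.
Proof. by move=> /dM0 d0; rewrite unitmxE unitfE gt_eqF. Qed.

Let base (u : 'rV[R]_2) : 'rV[R]_2 := lsubmx (F u).

Lemma smooth_base_along : smooth_on D base.
Proof.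
apply: (@smooth_comp _ _ _ _ _ D setT F lsubmx) => //; first exact: openT.
exact: smooth_lsubmx.
Qed.

Lemma pderiv_base a u : D u -> lsubmx (pderiv F a u) = 'D_(basis_vec a) base u.
Proof. by move=> Du; exact: (derive_lsubmx _ (smooth_diff sF Du)). Qed.

Lemma smooth_lag_re : smooth_on D (lag_re M F).
Proof.
have sh a i k := Ck_entry 0 i oD (smooth_hor oU sM dM0 oD sF FU a k).
have sv a i k := Ck_entry 0 i oD (smooth_ver oU sM dM0 oD sF FU a k).
by move=> k; rewrite /lag_re /cdet_re; do 2 (apply: Ck_sub => //);
  apply: Ck_mul.
Qed.

Lemma smooth_lag_im : smooth_on D (lag_im M F).
Proof.
have sh a i k := Ck_entry 0 i oD (smooth_hor oU sM dM0 oD sF FU a k).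
have sv a i k := Ck_entry 0 i oD (smooth_ver oU sM dM0 oD sF FU a k).
move=> k; rewrite /lag_im /cdet_im; apply: Ck_sub => //; apply: Ck_add => //;
  by apply: Ck_mul.
Qed.

Lemma smooth_pconn a : smooth_on D (pconn M F a).
Proof.
have sl k j := Ck_entry 0 j oD (smooth_derive (basis_vec a) smooth_base_along k).
have so k j := Ck_entry 0 j oD
  (smooth_comp oD oU FU smooth_base_along (smooth_conn_form oU sM uM) k).
apply: (@smooth_ext _ _ _ _ (fun u => conn M (base u) ('D_(basis_vec a) base u))) => //.
  by move=> u Du; rewrite /pconn (pderiv_base a Du).
by move=> k; apply: Ck_add => //; apply: Ck_mul => //.
Qed.

Lemma derive_pconn a b u : D u ->
  'D_(basis_vec b) (pconn M F a) u - 'D_(basis_vec a) (pconn M F b) u =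
  dconn M (base u) *
  (('D_(basis_vec b) base u) 0 0 * ('D_(basis_vec a) base u) 0 1 -
   ('D_(basis_vec b) base u) 0 1 * ('D_(basis_vec a) base u) 0 0).
Proof.
move=> Du; have db := smooth_diff smooth_base_along Du.
have dom j : differentiable (fun y => conn_form M y 0 j) (base u).
  by apply: differentiable_entry; exact: (smooth_diff (smooth_conn_form oU sM uM) (FU Du)).
have dob j : differentiable (fun v => conn_form M (base v) 0 j) u.
  exact: (differentiable_comp db (dom j)).
have dpb c j : differentiable (fun v => ('D_(basis_vec c) base v) 0 j) u.
  apply: differentiable_entry.
  exact: (smooth_diff (smooth_derive (basis_vec c) smooth_base_along) Du).
have nD : \forall v \near u, D v by exact: open_nbhs_nbhs.
have E c d : 'D_(basis_vec d) (pconn M F c) u =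
  ('D_(basis_vec d) (fun v => ('D_(basis_vec c) base v) 0 0) u * conn_form M (base u) 0 0 +
   ('D_(basis_vec c) base u) 0 0 *
      'D_('D_(basis_vec d) base u) (fun y => conn_form M y 0 0) (base u)) +
  ('D_(basis_vec d) (fun v => ('D_(basis_vec c) base v) 0 1) u * conn_form M (base u) 0 1 +
   ('D_(basis_vec c) base u) 0 1 *
      'D_('D_(basis_vec d) base u) (fun y => conn_form M y 0 1) (base u)).
  have nE : \forall v \near u, pconn M F c v =
      ('D_(basis_vec c) base v) 0 0 * conn_form M (base v) 0 0 +
      ('D_(basis_vec c) base v) 0 1 * conn_form M (base v) 0 1.
    by apply: filterS nD => v Dv; rewrite /pconn (pderiv_base c Dv).
  apply: (eq_trans (near_eq_derive _ nE)).
  have dm j : differentiable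
      (fun v => ('D_(basis_vec c) base v) 0 j * conn_form M (base v) 0 j) u.
    exact: differentiableM (dpb c j) (dob j).
  apply: (eq_trans (derive_fadd _ (dm 0) (dm 1))).
  apply: (f_equal2 +%R).
    apply: (eq_trans (derive_fmul _ (dpb c 0) (dob 0))); congr (_ + _ * _).
    exact: (derive_comp _ db (dom 0)).
  apply: (eq_trans (derive_fmul _ (dpb c 1) (dob 1))); congr (_ + _ * _).
  exact: (derive_comp _ db (dom 1)).
have S j : 'D_(basis_vec b) (fun v => ('D_(basis_vec a) base v) 0 j) u =
    'D_(basis_vec a) (fun v => ('D_(basis_vec b) base v) 0 j) u.
  have H c d : 'D_(basis_vec c) (fun v => ('D_(basis_vec d) base v) 0 j) u =
      'D_(basis_vec c) ('D_(basis_vec d) (fun v => base v 0 j)) u.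
    apply: near_eq_derive; apply: filterS nD => v Dv.
    exact: (derive_entry _ _ _ (smooth_diff smooth_base_along Dv)).
  have sj : smooth_on D (fun v => base v 0 j).
    by move=> k; exact: (Ck_entry 0 j oD (smooth_base_along k)).
  apply: (eq_trans (H b a)); apply: (eq_trans _ (esym (H a b))).
  exact: (smooth_derive_commute _ _ oD Du sj).
apply: (eq_trans (f_equal2 (fun x y => x - y) (E a b) (E b a))).
have K := (pconn_alg (conn_form M (base u) 0 0) (conn_form M (base u) 0 1) (S 0) (S 1) (derive_rV2 ('D_(basis_vec b) base u) (dom 0))
  (derive_rV2 ('D_(basis_vec b) base u) (dom 1))
  (derive_rV2 ('D_(basis_vec a) base u) (dom 0))
  (derive_rV2 ('D_(basis_vec a) base u) (dom 1))).
exact: K.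
Qed.

Lemma dconn_surface u : D u ->
  dconn M (base u) *
  (('D_(basis_vec 0) base u) 0 0 * ('D_(basis_vec 1) base u) 0 1 -
   ('D_(basis_vec 0) base u) 0 1 * ('D_(basis_vec 1) base u) 0 0) = 0.
Proof.
move=> Du; rewrite -derive_pconn//.
set p := lag_re M F; set q := lag_im M F; set w := pconn M F.
have dp := smooth_diff smooth_lag_re Du; have dq := smooth_diff smooth_lag_im Du.
have dw a := smooth_diff (smooth_pconn a) Du.
have ddp a := smooth_diff (smooth_derive (basis_vec a) smooth_lag_re) Du.
have ddq a := smooth_diff (smooth_derive (basis_vec a) smooth_lag_im) Du.
have nD : \forall v \near u, D v by exact: open_nbhs_nbhs.
have ang := lag_angle oU sM dM0 GM oD sF FU lagF nonnullF minF.
pose m v := p v ^+ 2 + q v ^+ 2.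
have mE : m = fun v => p v * p v + q v * q v by apply/funext => v; rewrite /m !expr2.
have dpp := differentiableM dp dp; have dqq := differentiableM dq dq.
have dm : differentiable m u by rewrite mE; exact: (differentiableD dpp dqq).
have Dm b : 'D_(basis_vec b) m u = 2 * p u * 'D_(basis_vec b) p u + 2 * q u * 'D_(basis_vec b) q u.
  rewrite mE; apply: (eq_trans (derive_fadd _ dpp dqq)).
  apply: (eq_trans (f_equal2 +%R (derive_fmul _ dp dp) (derive_fmul _ dq dq))).
  have K (x y z t : R) : z * x + x * z + (t * y + y * t) = 2 * x * z + 2 * y * t by ring.
  exact: K.
have E a b : 'D_(basis_vec b) p u * 'D_(basis_vec a) q u + p u * 'D_(basis_vec b) ('D_(basis_vec a) q) u
   - ('D_(basis_vec b) q u * 'D_(basis_vec a) p u + q u * 'D_(basis_vec b) ('D_(basis_vec a) p) u)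
   + (2 * 'D_(basis_vec b) (w a) u * m u + 2 * w a u * 'D_(basis_vec b) m u) = 0.
  have nE : \forall v \near u, p v * 'D_(basis_vec a) q v - q v * 'D_(basis_vec a) p v
     + 2 * w a v * m v = cst 0 v.
    by apply: filterS nD => v Dv; exact: ang.
  have := near_eq_derive (basis_vec b) nE; rewrite derive_cst => H; rewrite -[RHS]H.
  have d1 := differentiableM dp (ddq a); have d2 := differentiableM dq (ddp a).
  have d3 : differentiable (fun v => 2 * w a v) u.
    by apply: differentiableM; [exact: differentiable_cst|exact: dw].
  have d4 := differentiableM d3 dm; have d5 := differentiableB d1 d2.
  apply/esym; apply: (eq_trans (derive_fadd _ d5 d4)); apply: (f_equal2 +%R).
    apply: (eq_trans (derive_fsub _ d1 d2)).
    exact: (f_equal2 (fun x y => x - y) (derive_fmul _ dp (ddq a)) (derive_fmul _ dq (ddp a))).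
  apply: (eq_trans (derive_fmul _ d3 dm)).
  by congr (_ * _ + _); exact: derive_fscale.
have Sp : 'D_(basis_vec 1) ('D_(basis_vec 0) p) u = 'D_(basis_vec 0) ('D_(basis_vec 1) p) u.
  exact: (smooth_derive_commute _ _ oD Du smooth_lag_re).
have Sq : 'D_(basis_vec 1) ('D_(basis_vec 0) q) u = 'D_(basis_vec 0) ('D_(basis_vec 1) q) u.
  exact: (smooth_derive_commute _ _ oD Du smooth_lag_im).
have E0 := E 0 1; have E1 := E 1 0; rewrite Sp Sq in E0.
rewrite Dm in E0; rewrite Dm in E1.
have m0 := lag_norm oU sM dM0 GM FU lagF nonnullF Du.
have K := closed_angle m0 (ang 0 u Du) (ang 1 u Du) E1 E0.
exact: K.
Qed.

Lemma hor_base a u : D u -> hor M F a u = 'D_(basis_vec a) base u *m M (base u).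
Proof.
move=> Du; rewrite /hor /frame_vec (mul_lift_frame sM _ (FU Du)) row_mxKl.
by rewrite (pderiv_base a Du).
Qed.

Definition fibre_along (u : 'rV[R]_2) : 'rV[R]_2 := fibre_coord M (F u).

Lemma differentiable_fibre_along u : D u -> differentiable fibre_along u.
Proof.
move=> Du; have dF := smooth_diff sF Du.
exact: (differentiable_comp dF (smooth_diff (smooth_fibre_coord oU sM) (FU Du))).
Qed.

Lemma ver_fibre a u : D u -> ver M F a u =
  'D_(basis_vec a) fibre_along u + pconn M F a u *: (fibre_along u *m rot90).
Proof.
move=> Du; rewrite /ver /frame_vec (mul_lift_frame sM _ (FU Du)) row_mxKr.
have dN := smooth_diff (smooth_fibre_coord oU sM) (FU Du).
apply: (eq_trans (vertical_coordE oU sM _ (FU Du))).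
exact: (f_equal (+%R^~ _) (esym (derive_comp _ (smooth_diff sF Du) dN))).
Qed.

(** * Surfaces that project onto a curve with unit tangent [e] *)

Section RankOne.
Variables (u : 'rV[R]_2) (mu : 'I_2 -> 'rV[R]_2 -> R) (e : 'rV[R]_2 -> 'rV[R]_2).
Hypothesis Du : D u.
Hypothesis de : differentiable e u.
Hypothesis baseE : \forall v \near u, forall a,
  'D_(basis_vec a) base v = mu a v *: e v.
Hypothesis unit_e : \forall v \near u, bil (G (base v)) (e v) (e v) = 1.

Let ep (v : 'rV[R]_2) := e v *m M (base v).

Lemma differentiable_base_frame : differentiable (fun v => M (base v)) u.
Proof.
have db := smooth_diff smooth_base_along Du.
exact: (differentiable_comp db (smooth_diff sM (FU Du))).
Qed.

Let dep : differentiable ep u.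
Proof. by apply: differentiable_mulmx => //; exact: differentiable_base_frame. Qed.

Let nD : \forall v \near u, D v.
Proof. by apply: open_nbhs_nbhs; split; [exact: oD|exact: Du]. Qed.

Let dot_ep : \forall v \near u, dot (ep v) (ep v) = 1.
Proof.
apply: filterS2 nD unit_e => v Dv <-.
by rewrite -dotE /bil (GM (FU Dv)) trmx_mul !mulmxA.
Qed.

Let hor_ep : \forall v \near u, forall a, hor M F a v = mu a v *: ep v.
Proof. by apply: filterS2 nD baseE => v Dv bE a; rewrite hor_base// bE scalemxAl. Qed.

(* lag is a real multiple of i e^2, so the angle of e is half that of lag, up to
   a constant. *)
Lemma lag_parallel c :
  'D_(basis_vec c) ep u + pconn M F c u *: (ep u *m rot90) = 0.
Proof.
have dp := smooth_diff smooth_lag_re Du; have dq := smooth_diff smooth_lag_im Du.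
pose x v := ep v 0 0; pose y v := ep v 0 1.
have dx : differentiable x u by exact: differentiable_entry.
have dy : differentiable y u by exact: differentiable_entry.
have dxx := differentiableM dx dx; have dyy := differentiableM dy dy.
have dxy := differentiableM dx dy.
pose A v := x v * x v - y v * y v; pose B v := 2 * (x v * y v).
have dA : differentiable A u by exact: differentiableB.
have dB : differentiable B u.
  by apply: differentiableM => //; exact: differentiable_cst.
have DA : 'D_(basis_vec c) A u = 2 * x u * 'D_(basis_vec c) x u - 2 * y u * 'D_(basis_vec c) y u.
  apply: (eq_trans (derive_fsub _ dxx dyy)).
  apply: (eq_trans (f_equal2 (fun x y => x - y) (derive_fmul _ dx dx) (derive_fmul _ dy dy))).
  have K (a b p q : R) : p * a + a * p - (q * b + b * q) = 2 * a * p - 2 * b * q by ring.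
  exact: K.
have DB : 'D_(basis_vec c) B u = 2 * ('D_(basis_vec c) x u * y u + x u * 'D_(basis_vec c) y u).
  apply: (eq_trans (derive_fscale _ _ dxy)).
  exact: (f_equal ( *%R 2) (derive_fmul _ dx dy)).
have nE : \forall v \near u, lag_re M F v * A v + lag_im M F v * B v = cst 0 v.
  apply: filterS2 nD hor_ep => v Dv hE.
  have L := symp_lag oU sM dM0 GM FU lagF 0 1 Dv; rewrite (hE 0) (hE 1) in L.
  rewrite /lag_re /lag_im (hE 0) (hE 1) /A /B -!expr2 (mulrA 2 (x v)).
  by rewrite [LHS]cdet_line_angle L oppr0 mul0r.
have dpA := differentiableM dp dA; have dqB := differentiableM dq dB.
have E := near_eq_derive (basis_vec c) nE; rewrite derive_cst in E.
have {}E := eq_trans (esym (eq_trans (derive_fadd _ dpA dqB)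
   (f_equal2 +%R (derive_fmul _ dp dA) (derive_fmul _ dq dB)))) E.
rewrite DA DB in E.
have d1 := nbhs_singleton dot_ep.
have xy1 : x u ^+ 2 + y u ^+ 2 = 1 by rewrite -[RHS]d1 /dot !expr2.
have dxy0 : x u * 'D_(basis_vec c) x u + y u * 'D_(basis_vec c) y u = 0.
  have nE1 : \forall v \near u, x v * x v + y v * y v = cst 1 v by exact: dot_ep.
  have H := near_eq_derive (basis_vec c) nE1; rewrite derive_cst in H.
  have {}H := eq_trans (esym (eq_trans (derive_fadd _ dxx dyy)
   (f_equal2 +%R (derive_fmul _ dx dx) (derive_fmul _ dy dy)))) H.
  have K (a b p q : R) : p * a + a * p + (q * b + b * q) = 0 -> a * p + b * q = 0.
    by move=> H'; lra.
  exact: K H.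
have m0 := lag_norm oU sM dM0 GM FU lagF nonnullF Du.
have ang := lag_angle oU sM dM0 GM oD sF FU lagF nonnullF minF c Du.
have AE : A u = x u ^+ 2 - y u ^+ 2 by rewrite /A !expr2.
have BE : B u = 2 * x u * y u by rewrite /B mulrA.
have AB0 := nbhs_singleton nE; rewrite /= AE BE in AB0; rewrite AE BE in E.
have [Dx Dy] := parallel_angle m0 xy1 dxy0 AB0 E ang.
apply/rowP; apply: forall2; rewrite addmxE scalemxE mulmx_rot90 [RHS]mxE.
  rewrite (derive_entry _ _ _ dep); apply: (eq_trans (f_equal (+%R^~ _) Dx)).
  by rewrite mulrN subrr.
rewrite (derive_entry _ _ _ dep); apply: (eq_trans (f_equal (+%R^~ _) Dy)).
by rewrite addNr.
Qed.

(** [lag_parallel] translated from the frame to coordinates. It becomes the geodesic equation once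
    [e] is known to be the velocity of a curve. *)
Lemma base_geodesic c :
  cov_deriv G (base u) ('D_(basis_vec c) base u) (e u) ('D_(basis_vec c) e u) = 0.
Proof.
have db := smooth_diff smooth_base_along Du.
have dMb := differentiable_base_frame.
apply: (can_inj (mulmxK (uM (FU Du)))); rewrite mul0mx -[RHS](lag_parallel c).
rewrite /cov_deriv mulmxDl (Gam_conn oU sM uM _ _ GM (FU Du)) addrA.
have -> : 'D_(basis_vec c) ep u = 'D_(basis_vec c) e u *m M (base u) +
    e u *m 'D_('D_(basis_vec c) base u) M (base u).
  apply: (eq_trans (derive_mulmx _ de dMb)); congr (_ + _ *m _).
  exact: (derive_comp _ db (smooth_diff sM (FU Du))).
by rewrite /pconn (pderiv_base c Du).
Qed.

(** Both [e] and J [e] are parallel along the surface, so [dot_conn] applies. *)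
Lemma derive_fibre_comp c :
  'D_(basis_vec c) (fun v => dot (fibre_along v) (ep v)) u = dot (ver M F c u) (ep u) /\
  'D_(basis_vec c) (fun v => dot (fibre_along v) (ep v *m rot90)) u =
    dot (ver M F c u) (ep u *m rot90).
Proof.
have dn := differentiable_fibre_along Du.
have dr : differentiable (fun v => ep v *m rot90) u.
  by apply: differentiable_mulmx => //; exact: differentiable_cst.
have Dr : 'D_(basis_vec c) (fun v => ep v *m rot90) u = 'D_(basis_vec c) ep u *m rot90.
  apply: (eq_trans (derive_mulmx _ dep (differentiable_cst rot90 u))).
  by rewrite derive_cst mulmx0 addr0.
have [H1 H2] := dot_conn (fibre_along u) ('D_(basis_vec c) fibre_along u) (lag_parallel c).
rewrite (ver_fibre c Du); split.
  exact: (eq_trans (derive_dot _ dn dep) H1).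
apply: (eq_trans (derive_dot _ dn dr)); apply: (eq_trans _ H2).
by congr (_ + dot _ _).
Qed.

(** By [derive_fibre_comp], the first part (Lagrangian condition) says that the component of the
    fibre along [e] has differential proportional to [mu]; the second ([lag] nonzero) says that the
    component along J [e] has differential independent of [mu], so that it can serve as the
    coordinate t. *)
Lemma rank_one_lagrangian :
  mu 1 u * dot (ver M F 0 u) (ep u) = mu 0 u * dot (ver M F 1 u) (ep u) /\
  mu 0 u * dot (ver M F 1 u) (ep u *m rot90) -
  mu 1 u * dot (ver M F 0 u) (ep u *m rot90) != 0.
Proof.
have L := symp_lag oU sM dM0 GM FU lagF 0 1 Du.
have m0 := lag_norm oU sM dM0 GM FU lagF nonnullF Du.
have hE := nbhs_singleton hor_ep.
rewrite /lag_re /lag_im (hE 0) (hE 1) in m0; rewrite (hE 0) (hE 1) in L.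
rewrite cdet_line_norm L expr0n add0r in m0; rewrite symp_line in L; split.
  by apply/eqP; rewrite -subr_eq0 L.
by apply: contraL m0 => /eqP ->; rewrite expr0n ltxx.
Qed.

End RankOne.

End SurfaceConsequences.

(** * Projections of rank one *)

Section NormalForm.
Context {R : realType}.

(** The radius is halved so that the closed segment of integration lies where [h] is continuous;
    smoothness then follows from S' = h. *)
Lemma antiderivative (h : R -> R) (y0 d : R) : 0 < d -> smooth_on (ball y0 d) h ->
  exists2 S : R -> R, smooth_on (ball y0 (d / 2)) S &
    forall y, ball y0 (d / 2) y -> 'D_1 S y = h y.
Proof.
move=> d0 sh; pose a := y0 - d / 2; pose b := y0 + d / 2.
have ab : a < b by rewrite /a /b; lra.
have hc y : a <= y <= b -> {for y, continuous h}.
  move=> /andP[ay yb]; apply: (sh 0%N); rewrite in_ballE ltr_norml.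
  by move: ay yb; rewrite /a /b => *; apply/andP; split; lra.
have hw : {within `[a, b], continuous h}.
  by apply: continuous_in_subspaceT => y; rewrite inE /= in_itv /= => /hc.
have ih : (@lebesgue_measure R).-integrable `[a, b] (EFin \o h).
  by apply: continuous_compact_integrable => //; exact: segment_compact.
pose S y := (\int[@lebesgue_measure R]_(t in [set` Interval (BLeft a) (BRight y)]) h t)%R.
have HS y : ball y0 (d / 2) y -> derivable S y 1 /\ derive1 S y = h y.
  rewrite in_ballE ltr_norml => /andP[y1 y2].
  have ay : a < y by rewrite /a; lra.
  have yb : y < b by rewrite /b; lra.
  apply: (@continuous_FTC1_closed R h a y b yb ih ay).
  by apply: hc; rewrite !ltW.
have DS y : ball y0 (d / 2) y -> 'D_1 S y = h y.
  by move=> /HS[_]; rewrite derive1E.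
exists S => // k; have oB : open (ball y0 (d / 2)) by exact: ball_open.
case: k => [|k].
  move=> y /HS[dS _]; apply: differentiable_continuous.
  exact/derivable1_diffP.
split=> [y /HS[dS _]|v]; first exact/derivable1_diffP.
apply: (@Ck_ext _ _ _ _ _ (fun y => v * h y)) => //.
  move=> y By; have [dS _] := HS _ By.
  rewrite -DS//; move/derivable1_diffP: dS => dS.
  by rewrite -[v in RHS]mulr1 -[_ * 1]/(v *: 1) derive_scalev.
apply: Ck_mul => //; first exact: Ck_cst.
apply: Ck_subset (sh k) => y; rewrite !in_ballE => /lt_trans; apply.
by rewrite ltr_pdivrMr// ltr_pMr// ltr1n.
Qed.

Definition pt (y b : R) : 'rV[R]_2 := \row_k (if k == 0 then y else b).

Lemma ptE y b : (pt y b 0 0 = y) * (pt y b 0 1 = b).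
Proof. by rewrite !mxE. Qed.

Lemma ball_pt (c v : 'rV[R]_2) (d : R) : 0 < d ->
  ball c d v <-> `|c 0 0 - v 0 0| < d /\ `|c 0 1 - v 0 1| < d.
Proof.
move=> d0; rewrite in_ballE; split=> [H|[H0 H1]].
  by split; apply: le_lt_trans H; [have := normr_entry_le (c - v) 0 0|
    have := normr_entry_le (c - v) 0 1]; rewrite addmxE oppmxE.
rewrite /Num.Def.normr/= mx_normrE; apply: bigmax_lt => // -[i j] _ /=.
by rewrite addmxE oppmxE ord1; move: j; apply: forall2.
Qed.

Lemma const_second (f : 'rV[R]_2 -> R) (c : 'rV[R]_2) (d : R) :
  (forall z, ball c d z -> differentiable f z /\ 'D_(basis_vec 1) f z = 0) ->
  forall z z', ball c d z -> ball c d z' -> z 0 0 = z' 0 0 -> f z = f z'.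
Proof.
move=> Hf z z' Bz Bz' zz'.
have d0 : 0 < d.
  by move: Bz; rewrite in_ballE; apply: le_lt_trans; exact: normr_ge0.
have zE : z' - z = (z' 0 1 - z 0 1) *: basis_vec 1.
  apply/rowP; apply: forall2; rewrite addmxE oppmxE scalemxE !mxE /=.
    by rewrite zz' subrr mulr0.
  by rewrite mulr1.
have Bt t : 0 <= t <= 1 -> ball c d (z + t *: (z' - z)) by exact: ball_segment.
have [|t t01] := @mvt_line R _ f z (z' - z).
  by move=> t /Bt /Hf[].
rewrite subrKC => E; apply/esym/eqP; rewrite -subr_eq0 E.
have [dft D0] := Hf _ (Bt _ t01).
rewrite zE in dft D0 *; rewrite derive_scalev// D0 scaler0.
exact: eqxx.
Qed.

(* Functions whose differential is proportional to that of the first coordinate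
   of a diffeomorphism depend on that coordinate only. *)
Lemma functional_dependence (N : set 'rV[R]_2) (P g : 'rV[R]_2 -> 'rV[R]_2)
    (f : 'rV[R]_2 -> R) (mu : 'I_2 -> 'rV[R]_2 -> R) (r t : 'rV[R]_2 -> R)
    (c : 'rV[R]_2) (d : R) :
  (forall y, ball c d y -> N (g y) /\ P (g y) = y) ->
  (forall y, ball c d y -> differentiable g y) ->
  (forall v, N v -> differentiable P v) ->
  (forall v, N v -> differentiable f v) ->
  (forall v a, N v -> 'D_(basis_vec a) (fun v => P v 0 0) v = mu a v * t v) ->
  (forall v, N v -> t v != 0) ->
  (forall v a, N v -> 'D_(basis_vec a) f v = mu a v * r v) ->
  forall y y', ball c d y -> ball c d y' -> y 0 0 = y' 0 0 -> f (g y) = f (g y').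
Proof.
move=> gN dg dP df DP t0 Df.
apply: (@const_second (fun y => f (g y)) c d) => y By.
have [Ng Pg] := gN _ By; have dgy := dg _ By; have dfg := df _ Ng.
have dPg : differentiable (fun v => P v 0 0) (g y).
  by apply: differentiable_entry; exact: dP.
split; first exact: (differentiable_comp dgy dfg).
set w := 'D_(basis_vec 1) g y.
have E (h : 'rV[R]_2 -> R) : differentiable h (g y) ->
    'D_(basis_vec 1) (fun y => h (g y)) y =
    w 0 0 * 'D_(basis_vec 0) h (g y) + w 0 1 * 'D_(basis_vec 1) h (g y).
  by move=> dh; rewrite [LHS](derive_comp _ dgy dh) (derive_rV2 _ dh).
have nB : \forall z \near y, ball c d z.
  by apply: open_nbhs_nbhs; split=> //; exact: ball_open.
have P1 : 'D_(basis_vec 1) (fun y => P (g y) 0 0) y = 0.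
  have nE : \forall z \near y, P (g z) 0 0 = z 0 0.
    by apply: filterS nB => z /gN[_ ->].
  rewrite (near_eq_derive _ nE) -derive_entry//.
  by rewrite derive_id mxE.
move: P1; rewrite (E _ dPg) (E _ dfg) !DP// !Df// !mulrA -!mulrDl.
by move=> /eqP; rewrite mulf_eq0 (negPf (t0 _ Ng)) orbF => /eqP ->; rewrite mul0r.
Qed.

Lemma smooth_pt (V : normedModType R) (U : set V) (s b : V -> R) : open U ->
  smooth_on U s -> smooth_on U b -> smooth_on U (fun v => pt (s v) (b v)).
Proof.
move=> oU ss sb k; apply: Ck_mx => // i m; rewrite ord1; move: m; apply: forall2.
  by apply: (@Ck_ext _ _ _ _ _ s) => // v _; rewrite ptE.
by apply: (@Ck_ext _ _ _ _ _ b) => // v _; rewrite ptE.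
Qed.

Lemma ball_slice (s0 b0 d y : R) : 0 < d -> ball s0 d y -> ball (pt s0 b0) d (pt y b0).
Proof.
by move=> d0; rewrite in_ballE => yd; apply/(ball_pt _ _ d0); rewrite !ptE subrr normr0.
Qed.

Lemma smooth_slice m p (g : 'rV[R]_2 -> 'M[R]_(m, p)) (s0 b0 d : R) : 0 < d ->
  smooth_on (ball (pt s0 b0) d) g -> smooth_on (ball s0 d) (fun y => g (pt y b0)).
Proof.
move=> d0 sg.
apply: (@smooth_comp _ _ _ _ _ (ball s0 d) (ball (pt s0 b0) d) (fun y => pt y b0) g) => //.
- exact: ball_open.
- exact: ball_open.
- by move=> y; exact: ball_slice.
- apply: smooth_pt; first exact: ball_open.
    by move=> k; apply: (@Ck_lin _ _ _ _ _ idfun) => y; exact: cvg_id.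
  by move=> k; exact: Ck_cst.
Qed.

Lemma pt_inverse (N0 : set 'rV[R]_2) (u0 : 'rV[R]_2) (s b : 'rV[R]_2 -> R) :
  open N0 -> N0 u0 -> smooth_on N0 s -> smooth_on N0 b ->
  'D_(basis_vec 0) s u0 * 'D_(basis_vec 1) b u0 -
    'D_(basis_vec 1) s u0 * 'D_(basis_vec 0) b u0 != 0 ->
  exists (N : set 'rV[R]_2) (d : R) (g : 'rV[R]_2 -> 'rV[R]_2),
  let Phi v := pt (s v) (b v) in
  [/\ [/\ open N, N u0, N `<=` N0 & 0 < d],
      forall y, ball (Phi u0) d y -> N (g y) /\ Phi (g y) = y,
      forall v, N v -> ball (Phi u0) d (Phi v) /\ g (Phi v) = v
    & smooth_on (ball (Phi u0) d) g].
Proof.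
move=> oN Nu ss sb det0; apply: inverse_function => //; first exact: smooth_pt.
have sP := smooth_pt oN ss sb; have dP := smooth_diff sP Nu.
rewrite unitmxE unitfE det2E !(jacobian_entry _ _ dP).
rewrite (_ : (fun y => pt (s y) (b y) 0 0) = s); last by apply/funext => y; rewrite ptE.
rewrite (_ : (fun y => pt (s y) (b y) 0 1) = b); last by apply/funext => y; rewrite ptE.
by rewrite [X in _ - X]mulrC.
Qed.

(** A point [v] is compared with the point having the same [s] on the slice where the second
    coordinate equals [b u0]; along that slice [f] is visibly a function of [s]. *)
Lemma factor_first (N : set 'rV[R]_2) (u0 : 'rV[R]_2) (s b : 'rV[R]_2 -> R) (d : R)
    (g : 'rV[R]_2 -> 'rV[R]_2) (f : 'rV[R]_2 -> R)
    (mu : 'I_2 -> 'rV[R]_2 -> R) (r t : 'rV[R]_2 -> R) :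
  let Phi v := pt (s v) (b v) in
  open N -> 0 < d -> smooth_on N s -> smooth_on N b ->
  (forall y, ball (Phi u0) d y -> N (g y) /\ Phi (g y) = y) ->
  (forall v, N v -> ball (Phi u0) d (Phi v) /\ g (Phi v) = v) ->
  smooth_on (ball (Phi u0) d) g ->
  (forall v a, N v -> 'D_(basis_vec a) s v = mu a v * t v) ->
  (forall v, N v -> t v != 0) -> smooth_on N f ->
  (forall v a, N v -> 'D_(basis_vec a) f v = mu a v * r v) ->
  forall v, N v -> ball (s u0) d (s v) /\ f v = f (g (pt (s v) (b u0))).
Proof.
move=> Phi oN d0 ss sb gN Ng sg Ds t0 sf Df v Nv.
have [Bv gv] := Ng _ Nv.
have Bs : ball (s u0) d (s v).
  by move: Bv => /(ball_pt _ _ d0)[+ _]; rewrite !ptE in_ballE.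
split => //; rewrite -[in LHS]gv.
have sP := smooth_pt oN ss sb.
apply: (@functional_dependence N Phi g f mu r t (Phi u0) d) => //.
- by move=> y By; exact: smooth_diff sg By.
- by move=> z Nz; exact: smooth_diff sP Nz.
- by move=> z Nz; exact: smooth_diff sf Nz.
- move=> z a Nz; rewrite (_ : (fun y => Phi y 0 0) = s) ?Ds//.
  by apply/funext => y; rewrite ptE.
- exact: ball_slice.
- by rewrite !ptE.
Qed.

(* In the coordinates (x_j, bb), the entry e_j depends on x_j only, so that
   1 / e_j has a primitive S; then s = S(x_j) satisfies ds = mu, and in the
   coordinates (s, bb) both x and aa depend on s only. *)
Lemma rank_one_normal_form (N0 : set 'rV[R]_2) (u0 : 'rV[R]_2)
    (x e w : 'rV[R]_2 -> 'rV[R]_2) (aa bb al : 'rV[R]_2 -> R)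
    (mu : 'I_2 -> 'rV[R]_2 -> R) (j : 'I_2) :
  open N0 -> N0 u0 -> smooth_on N0 x -> smooth_on N0 e ->
  smooth_on N0 aa -> smooth_on N0 bb ->
  (forall v a, N0 v -> 'D_(basis_vec a) x v = mu a v *: e v) ->
  (forall v a, N0 v -> 'D_(basis_vec a) e v = mu a v *: w v) ->
  (forall v a, N0 v -> 'D_(basis_vec a) aa v = mu a v * al v) ->
  (forall v, N0 v -> mu 0 v * 'D_(basis_vec 1) bb v - mu 1 v * 'D_(basis_vec 0) bb v != 0) ->
  (forall v, N0 v -> e v 0 j != 0) ->
  exists (N : set 'rV[R]_2) (s : 'rV[R]_2 -> R) (d : R) (g : 'rV[R]_2 -> 'rV[R]_2)
         (c : R -> 'rV[R]_2) (a : R -> R),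
  let Phi v := pt (s v) (bb v) in
  [/\ [/\ open N, N u0, N `<=` N0, 0 < d & smooth_on N s],
      [/\ forall y, ball (Phi u0) d y -> N (g y) /\ Phi (g y) = y,
          forall v, N v -> ball (Phi u0) d (Phi v) /\ g (Phi v) = v
        & smooth_on (ball (Phi u0) d) g],
      forall v b, N v -> 'D_(basis_vec b) s v = mu b v,
      smooth_on (ball (s u0) d) c /\ smooth_on (ball (s u0) d) a
    & forall v, N v -> [/\ x v = c (s v), e v = derive1 c (s v) & aa v = a (s v)]].
Proof.
move=> oN0 Nu0 sx se saa sbb Dx De Daa det0 ej0.
pose xj v := x v 0 j; pose ej v := e v 0 j.
have sxj : smooth_on N0 xj by move=> k; exact: Ck_entry.
have sej : smooth_on N0 ej by move=> k; exact: Ck_entry.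
have Dxj v a : N0 v -> 'D_(basis_vec a) xj v = mu a v * ej v.
  by move=> Nv; rewrite -derive_entry ?Dx ?scalemxE//; exact: smooth_diff sx Nv.
have Dek k v a : N0 v -> 'D_(basis_vec a) (fun v => e v 0 k) v = mu a v * w v 0 k.
  by move=> Nv; rewrite -derive_entry ?De ?scalemxE//; exact: smooth_diff se Nv.
have Dxk k v a : N0 v -> 'D_(basis_vec a) (fun v => x v 0 k) v = mu a v * e v 0 k.
  by move=> Nv; rewrite -derive_entry ?Dx ?scalemxE//; exact: smooth_diff sx Nv.
(* The Jacobian determinant of (x_j, bb) is e_j times that of mu against d bb, both nonzero. *)
have det1 : 'D_(basis_vec 0) xj u0 * 'D_(basis_vec 1) bb u0 -
    'D_(basis_vec 1) xj u0 * 'D_(basis_vec 0) bb u0 != 0.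
  rewrite !Dxj// -!mulrA !(mulrC (ej u0)) !mulrA -mulrBl mulf_neq0 //.
    exact: det0.
  exact: ej0.
have [N1 [d1 [g1 [[oN1 N1u N1N d10] g1N N1g sg1]]]] := pt_inverse oN0 Nu0 sxj sbb det1.
pose E y := ej (g1 (pt y (bb u0))).
have sE : smooth_on (ball (xj u0) d1) E.
  move=> k; apply: (@Ck_comp _ _ _ k _ N0 (fun y => g1 (pt y (bb u0))) ej).
  - exact: ball_open.
  - move=> y By; apply: N1N; have [] // := g1N (pt y (bb u0)).
    exact: ball_slice.
  - exact: (smooth_slice d10 sg1 k).
  - exact: sej.
have E0 y : ball (xj u0) d1 y -> E y != 0.
  move=> By; apply: ej0; apply: N1N; have [] // := g1N (pt y (bb u0)).
  exact: ball_slice.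
have ejE v : N1 v -> ball (xj u0) d1 (xj v) /\ ej v = E (xj v).
  move=> Nv; apply: (factor_first oN1 d10 (smooth_subset N1N sxj) (smooth_subset N1N sbb)
    g1N N1g sg1 (mu := mu) (r := fun v => w v 0 j) (t := ej)) => //.
  - by move=> z a /N1N; exact: Dxj.
  - by move=> z /N1N; exact: ej0.
  - exact: smooth_subset sej.
  - by move=> z a /N1N; exact: Dek.
have sEi : smooth_on (ball (xj u0) d1) (fun y => (E y)^-1).
  by move=> k; apply: Ck_inv => //; exact: ball_open.
have [S sS DS] := antiderivative d10 sEi.
have d120 : 0 < d1 / 2 by rewrite divr_gt0.
pose N2 := N1 `&` xj @^-1` ball (xj u0) (d1 / 2).
have cxj v : N1 v -> {for v, continuous xj} by move=> /N1N; exact: (sxj 0%N).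
have oN2 : open N2.
  rewrite openE => v [Nv Bv]; apply: filterI; first exact: open_nbhs_nbhs.
  by apply: (cxj _ Nv); apply: open_nbhs_nbhs; split=> //; exact: ball_open.
have N2u : N2 u0 by split=> //; exact: ballxx.
have N2N1 : N2 `<=` N1 by move=> v [].
have N2N : N2 `<=` N0 by move=> v /N2N1/N1N.
pose s v := S (xj v).
have ss : smooth_on N2 s.
  move=> k; apply: (@Ck_comp1 _ _ k _ (ball (xj u0) (d1 / 2)) xj S) => //.
    by move=> v [].
  exact: Ck_subset (sxj k).
have Ds v a : N2 v -> 'D_(basis_vec a) s v = mu a v.
  move=> N2v; have [N1v Bv] := N2v; have N0v := N1N _ N1v.
  have dS : differentiable S (xj v) by exact: smooth_diff sS Bv.
  have dxj : differentiable xj v by exact: smooth_diff sxj N0v.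
  rewrite [LHS](derive_comp _ dxj dS) Dxj// -[_ * _]mulr1 -[_ * 1]/(_ *: 1).
  rewrite derive_scalev// DS// -(ejE _ N1v).2.
  by rewrite -[RHS]mulr1 -[RHS](_ : mu a v * ej v * (ej v)^-1 = _) // -mulrA divff ?mulr1//; exact: ej0.
have det2 : 'D_(basis_vec 0) s u0 * 'D_(basis_vec 1) bb u0 -
    'D_(basis_vec 1) s u0 * 'D_(basis_vec 0) bb u0 != 0.
  by rewrite !Ds//; exact: det0.
have [N [d [g [[oN Nu NN d0] gN Ng sg]]]] := pt_inverse oN2 N2u ss (smooth_subset N2N sbb) det2.
have NN0 : N `<=` N0 by move=> v /NN/N2N.
pose l y := g (pt y (bb u0)).
have lN y : ball (s u0) d y -> N (l y) /\ pt (s (l y)) (bb (l y)) = pt y (bb u0).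
  by move=> By; apply: gN; exact: ball_slice.
have sl : smooth_on (ball (s u0) d) l by exact: smooth_slice.
have oB : open (ball (s u0) d) by exact: ball_open.
(* Every function whose differential is a multiple of mu = ds factors through [s]; [l] is the curve
   inserting [s] on the slice. *)
have ff (h : 'rV[R]_2 -> R) r : smooth_on N0 h ->
    (forall v a, N0 v -> 'D_(basis_vec a) h v = mu a v * r v) ->
    forall v, N v -> ball (s u0) d (s v) /\ h v = h (l (s v)).
  move=> sh Dh; apply: (factor_first oN d0 (smooth_subset NN ss) (smooth_subset NN0 sbb)
    gN Ng sg (mu := mu) (r := r) (t := fun=> 1)).
  - by move=> z a /NN Nz; rewrite mulr1 Ds.
  - by move=> z _; exact: oner_neq0.
  - exact: smooth_subset sh.
  - by move=> z a /NN0; exact: Dh.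
exists N, s, d, g, (fun y => x (l y)), (fun y => aa (l y)); split.
- by split=> //; exact: smooth_subset ss.
- by split.
- by move=> v b /NN; exact: Ds.
- split.
    apply: (@smooth_comp _ _ _ _ _ _ N0 l x) => //.
    by move=> y /lN[/NN0].
  move=> k; apply: (@Ck_comp _ _ _ k _ N0 l aa) => //.
  by move=> y /lN[/NN0].
move=> v Nv.
have Bv : ball (s u0) d (s v) by have [] := ff _ _ saa Daa _ Nv.
have xE : x v = x (l (s v)).
  by apply/rowP => k; have [] := ff _ _ (fun m => Ck_entry 0 k oN0 (sx m)) (Dxk k) _ Nv.
have eE : e v = e (l (s v)).
  by apply/rowP => k; have [] := ff _ _ (fun m => Ck_entry 0 k oN0 (se m)) (Dek k) _ Nv.
split=> //; last by have [] := ff _ _ saa Daa _ Nv.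
have [Nl lE] := lN _ Bv; have N0l := NN0 _ Nl; have N2l := NN _ Nl.
have dl := smooth_diff sl Bv; have dx := smooth_diff sx N0l.
have ds := smooth_diff ss N2l.
set z := 'D_1 l (s v).
(* Differentiating s (l y) = y. Since dx = ds e, the velocity of x along [l] is then exactly [e]. *)
have D1 : z 0 0 * mu 0 (l (s v)) + z 0 1 * mu 1 (l (s v)) = 1.
  transitivity ('D_1 (s \o l) (s v)).
    by rewrite (derive_comp _ dl ds) (derive_rV2 _ ds) !Ds.
  have nE : \forall y \near s v, (s \o l) y = y.
    have nB : \forall y \near s v, ball (s u0) d y by apply: open_nbhs_nbhs.
    apply: filterS nB => y /lN[_ /(congr1 (fun p : 'rV[R]_2 => p 0 0))].
    by rewrite !ptE.
  by rewrite (near_eq_derive _ nE) derive_id.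
rewrite derive1E.
rewrite [RHS](derive_comp _ dl dx) (derive_rV2 _ dx) !Dx// !scalerA -scalerDl D1 scale1r.
exact: eE.
Qed.

End NormalForm.

(** * Local form of a surface whose projection has rank one *)

Section RankOneLocal.
Context {R : realType}.
Variables (U : set 'rV[R]_2) (M G : 'rV[R]_2 -> 'M[R]_2).
Hypothesis oU : open U.
Hypothesis sM : smooth_on U M.
Hypothesis dM0 : forall x, U x -> 0 < \det (M x).
Hypothesis GM : forall x, U x -> G x = M x *m (M x)^T.
Variables (D : set 'rV[R]_2) (F : 'rV[R]_2 -> 'rV[R]_(2 + 2)).
Hypothesis oD : open D.
Hypothesis sF : smooth_on D F.
Hypothesis FU : forall u, D u -> U (lsubmx (F u)).
Hypothesis lagF : forall u, D u -> forall a b,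
  Omega G (F u) (pderiv F a u) (pderiv F b u) = 0.
Hypothesis nonnullF : forall u, D u -> induced_metric (GGmx G) F u \in unitmx.
Hypothesis minF : forall u, D u -> mean_curvature (GGmx G) F u = 0.

Let uM x : U x -> M x \in unitmx.
Proof. by move=> /dM0 d0; rewrite unitmxE unitfE gt_eqF. Qed.

Let base (u : 'rV[R]_2) : 'rV[R]_2 := lsubmx (F u).

Let sb : smooth_on D base.
Proof. exact: smooth_base_along. Qed.

Lemma bil_frame x (v w : 'rV[R]_2) : U x -> bil (G x) v w = dot (v *m M x) (w *m M x).
Proof. by move=> Ux; rewrite -dotE /bil (GM Ux) trmx_mul !mulmxA. Qed.

Lemma dot_gt0 (p : 'rV[R]_2) : p != 0 -> 0 < dot p p.
Proof.
move=> p0; rewrite lt_neqAle addr_ge0 -?expr2 ?sqr_ge0// andbT eq_sym.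
apply: contra p0; rewrite paddr_eq0 -?expr2 ?sqr_ge0// !sqrf_eq0 => /andP[/eqP x0 /eqP y0].
by apply/eqP/rowP; apply: forall2; rewrite ?x0 ?y0 mxE.
Qed.

Lemma frame_expand (n p : 'rV[R]_2) : dot p p = 1 ->
  n = dot n p *: p + dot n (p *m rot90) *: (p *m rot90).
Proof.
rewrite /dot => p1; apply/rowP; apply: forall2; rewrite addmxE !scalemxE !mulmx_rot90.
  by rewrite -[LHS]mulr1 -p1; ring.
by rewrite -[LHS]mulr1 -p1; ring.
Qed.

Lemma Gam_scalel x t (v w : 'rV[R]_2) : Gam G x (t *: v) w = t *: Gam G x v w.
Proof.
apply/rowP => k; rewrite !mxE big_distrr /=; apply: eq_bigr => i _.
by rewrite big_distrr /=; apply: eq_bigr => l _; rewrite !mxE; ring.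
Qed.

(** The geodesic equation is required in every chart. Rather than transforming Christoffel symbols,
    [base_geodesic] is applied afresh in the chart at hand to the unit field e = c'(s); a nonzero
    partial derivative of [s] is then divided out. *)
Lemma geodesic_of_factor u (s : 'rV[R]_2 -> R) (c : R -> 'rV[R]_2) (I : set R) a :
  D u -> smooth_on D s -> open I -> I (s u) -> smooth_on I c ->
  (forall v, D v -> I (s v) -> base v = c (s v)) ->
  (forall y, I y -> bil (G (c y)) (derive1 c y) (derive1 c y) = 1) ->
  'D_(basis_vec a) s u != 0 ->
  cov_deriv G (c (s u)) (derive1 c (s u)) (derive1 c (s u))
    (derive1 (derive1 c) (s u)) = 0.
Proof.
move=> Du ss oI Iu sc bE unit_c Ds0.
have c1E : derive1 c = 'D_1 c by apply/funext => y; rewrite derive1E.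
have sc1 : smooth_on I (derive1 c) by rewrite c1E; exact: smooth_derive.
pose N := D `&` s @^-1` I.
have oN : open N.
  rewrite openE => v [Dv Iv]; apply: filterI; first exact: open_nbhs_nbhs.
  by apply: (ss 0%N _ Dv); exact: open_nbhs_nbhs.
have nN v : N v -> \forall z \near v, N z by move=> Nv; exact: open_nbhs_nbhs.
have chain v b (h : R -> 'rV[R]_2) : N v -> smooth_on I h ->
    'D_(basis_vec b) (fun z => h (s z)) v = 'D_(basis_vec b) s v *: derive1 h (s v).
  move=> [Dv Iv] sh; rewrite [LHS](derive_comp _ (smooth_diff ss Dv) (smooth_diff sh Iv)).
  rewrite derive1E; apply: (eq_trans _ (derive_scalev _ _ (smooth_diff sh Iv))).
  by congr ('D_ _ h _); rewrite -[_ *: 1]/(_ * 1) mulr1.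
have Nu : N u by [].
pose e v := derive1 c (s v).
have de : differentiable e u.
  apply: (@differentiable_comp _ _ _ _ s (derive1 c)); first exact: smooth_diff ss Du.
  exact: smooth_diff sc1 Iu.
have baseE : \forall v \near u, forall b,
    'D_(basis_vec b) base v = 'D_(basis_vec b) s v *: e v.
  apply: filterS (nN _ Nu) => v Nv b.
  rewrite -(chain _ _ _ Nv sc); apply: near_eq_derive.
  by apply: filterS (nN _ Nv) => z [Dz Iz]; exact: bE.
have unit_e : \forall v \near u, bil (G (base v)) (e v) (e v) = 1.
  by apply: filterS (nN _ Nu) => v [Dv Iv]; rewrite bE// unit_c.
have := base_geodesic oU sM dM0 GM oD sF FU lagF nonnullF minF Du de baseE unit_e a.
rewrite (nbhs_singleton baseE) (chain _ _ _ Nu sc1) /cov_deriv Gam_scalel -scalerDr.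
move/eqP; rewrite scaler_eq0 (negPf Ds0)/= => /eqP.
by rewrite -/(base u) (bE _ Du Iu).
Qed.

Lemma proportional_rows (P : 'M[R]_2) : P 0 0 * P 1 1 = P 0 1 * P 1 0 ->
  forall a b l j, P a l * P b j = P a j * P b l.
Proof. by move=> E; do 4!apply: forall2; lra. Qed.

(** Supplies the data of [rank_one_normal_form]: [e] is a normalized partial derivative of the
    projection, [aa] and [bb] are the components of the fibre along [e] and J [e]. *)
Lemma rank_one_local u0 : D u0 -> (forall u, D u -> \rank ('J base u) = 1%N) ->
  exists (N : set 'rV[R]_2) (s b : 'rV[R]_2 -> R) (d : R) (h : 'rV[R]_2 -> 'rV[R]_2)
         (c : R -> 'rV[R]_2) (a : R -> R),
  let Phi v := pt (s v) (b v) in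
  [/\ [/\ open N, N u0, N `<=` D, 0 < d & smooth_on N s],
      [/\ smooth_on N b, forall y, ball (Phi u0) d y -> N (h y) /\ Phi (h y) = y,
          forall v, N v -> ball (Phi u0) d (Phi v) /\ h (Phi v) = v
        & smooth_on (ball (Phi u0) d) h],
      forall v, N v -> exists k, 'D_(basis_vec k) s v != 0,
      [/\ smooth_on (ball (s u0) d) c, smooth_on (ball (s u0) d) a
        & forall y, ball (s u0) d y ->
            bil (G (c y)) (derive1 c y) (derive1 c y) = 1]
    & forall v, N v -> base v = c (s v) /\
        rsubmx (F v) = a (s v) *: derive1 c (s v) +
          b v *: jrot (G (c (s v))) (derive1 c (s v))].
Proof.
move=> Du0 rk1.
have Jb u i j : D u -> ('J base u) i j = ('D_(basis_vec i) base u) 0 j.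
  move=> Du; have db := smooth_diff sb Du.
  by rewrite (jacobian_entry _ _ db) -derive_entry.
have [a0 [j X0]] : exists a0 j, ('D_(basis_vec a0) base u0) 0 j != 0.
  apply: contrapT => H; have := rk1 _ Du0.
  rewrite (_ : 'J base u0 = 0) ?mxrank0//; apply/matrixP => i l.
  by rewrite Jb// [RHS]mxE; apply/eqP; apply: contrapT => /negP Hn; apply: H; exists i, l.
have par u a l : D u -> ('D_(basis_vec a) base u) 0 l * ('D_(basis_vec a0) base u) 0 j =
    ('D_(basis_vec a) base u) 0 j * ('D_(basis_vec a0) base u) 0 l.
  move=> Du; apply: (eq_trans (esym (f_equal2 *%R (Jb u a l Du) (Jb u a0 j Du)))).
  apply: (eq_trans _ (f_equal2 *%R (Jb u a j Du) (Jb u a0 l Du))).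
  apply: proportional_rows; apply/eqP; rewrite -subr_eq0 -det2E -[_ == 0]negbK -unitfE -unitmxE -row_free_unit.
  by rewrite /row_free rk1.
pose X := 'D_(basis_vec a0) base.
have sX : smooth_on D X by exact: smooth_derive.
pose N0 := D `&` [set v | X v 0 j != 0].
have oN0 : open N0.
  rewrite openE => v [Dv Xv]; apply: filterI; first exact: open_nbhs_nbhs.
  have cX : {for v, continuous (fun v => X v 0 j)} by exact: (Ck_entry 0 j oD (sX 0%N) v Dv).
  exact: cvgr_neq0 cX Xv.
have N0D : N0 `<=` D by move=> v [].
pose ep0 v := X v *m M (base v).
pose q v := dot (ep0 v) (ep0 v).
have q0 v : N0 v -> 0 < q v.
  move=> [Dv Xv]; apply: dot_gt0; apply: contraNneq Xv => p0.
  have X0' : X v = 0.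
    by apply: (can_inj (mulmxK (uM (FU Dv)))); rewrite mul0mx.
  by rewrite X0' mxE.
pose e v := (Num.sqrt (q v))^-1 *: X v.
pose ep v := e v *m M (base v).
(* By rank one, the [a]-th partial derivative is the ratio of the [j]-th entries times [X], and [X]
   is the square root of [q] times [e]. *)
pose mu a v := ('D_(basis_vec a) base v) 0 j / X v 0 j * Num.sqrt (q v).
have sMb : smooth_on D (fun v => M (base v)).
  exact: (@smooth_comp _ _ _ _ _ _ U base M).
have smooth_dot (f1 f2 : 'rV[R]_2 -> 'rV[R]_2) : smooth_on N0 f1 -> smooth_on N0 f2 ->
    smooth_on N0 (fun v => dot (f1 v) (f2 v)).
  move=> s1 s2 k; apply: Ck_add => //; apply: Ck_mul => //; exact: Ck_entry.
have sMb0 := smooth_subset N0D sMb.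
have sX0 := smooth_subset N0D sX.
have sq : smooth_on N0 q by apply: smooth_dot; exact: smooth_mulmx.
have se : smooth_on N0 e.
  apply: smooth_scale => // k; apply: Ck_inv => //.
    by move=> v Nv; rewrite gt_eqF// sqrtr_gt0 q0.
  exact: Ck_sqrt.
have sep : smooth_on N0 ep by exact: smooth_mulmx.
have sfib : smooth_on N0 (fibre_along M F).
  apply: (smooth_subset N0D).
  by apply: (@smooth_comp _ _ _ _ _ _ [set z | U (lsubmx z)] F (fibre_coord M)) => //;
    [exact: open_lift|exact: smooth_fibre_coord].
pose aa v := dot (fibre_along M F v) (ep v).
pose bb v := dot (fibre_along M F v) (ep v *m rot90).
have saa : smooth_on N0 aa by exact: smooth_dot.
have sbb : smooth_on N0 bb.
  apply: smooth_dot => //; apply: smooth_mulmx => // k; exact: Ck_cst.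
have Dx v a : N0 v -> 'D_(basis_vec a) base v = mu a v *: e v.
  move=> [Dv Xv]; rewrite /mu /e scalerA mulfK; last first.
    by rewrite gt_eqF// sqrtr_gt0 q0.
  apply/rowP => l; rewrite scalemxE; apply: (mulIf Xv).
  by rewrite (par _ _ _ Dv) mulrAC divfK.
have ep1 v : N0 v -> dot (ep v) (ep v) = 1.
  move=> Nv; rewrite /ep /e -scalemxAl /dot !scalemxE.
  have := q0 _ Nv; rewrite /q /dot -/(ep0 v).
  set t := _ + _ => t0.
  have r0 : Num.sqrt t != 0 by rewrite gt_eqF// sqrtr_gt0.
  transitivity (t / Num.sqrt t ^+ 2); first by rewrite /t; field.
  by rewrite sqr_sqrtr ?ltW// divff// gt_eqF.
have unit_e v : N0 v -> bil (G (base v)) (e v) (e v) = 1.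
  by move=> Nv; rewrite bil_frame ?ep1//; exact/FU/N0D.
have nN v : N0 v -> \forall z \near v, N0 z by move=> Nv; exact: open_nbhs_nbhs.
have bE v : N0 v -> \forall z \near v, forall a, 'D_(basis_vec a) base z = mu a z *: e z.
  by move=> /nN; apply: filterS => z Nz a; exact: Dx.
have uE v : N0 v -> \forall z \near v, bil (G (base z)) (e z) (e z) = 1.
  by move=> /nN; apply: filterS => z; exact: unit_e.
have De v a : N0 v ->
    'D_(basis_vec a) e v = mu a v *: (- Gam G (base v) (e v) (e v)).
  move=> Nv; have := base_geodesic oU sM dM0 GM oD sF FU lagF nonnullF minF
    (N0D _ Nv) (smooth_diff se Nv) (bE _ Nv) (uE _ Nv) a.
  rewrite -/(base v) Dx// /cov_deriv Gam_scalel => /eqP.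
  by rewrite addr_eq0 => /eqP ->; rewrite scalerN.
have mu0 v : N0 v -> mu a0 v != 0.
  by move=> Nv; rewrite /mu (divff Nv.2) mul1r gt_eqF// sqrtr_gt0 q0.
have DF v a (Nv : N0 v) := derive_fibre_comp oU sM dM0 GM oD sF FU lagF nonnullF minF
    (N0D _ Nv) (smooth_diff se Nv) (bE _ Nv) (uE _ Nv) a.
have RL v (Nv : N0 v) := rank_one_lagrangian oU sM dM0 GM oD sF FU lagF nonnullF
    (N0D _ Nv) (bE _ Nv).
(* The Lagrangian relation makes the differential of [aa] proportional to [mu]; the factor is read
   in the direction [a0], where [mu] does not vanish. *)
have Daa v a : N0 v -> 'D_(basis_vec a) aa v =
    mu a v * (dot (ver M F a0 v) (ep v) / mu a0 v).
  move=> Nv; rewrite (DF v a Nv).1 -/(ep v).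
  have K1 (k0 k1 m0 m1 : R) : m0 != 0 -> k1 * m0 = m1 * k0 -> k1 = m1 * (k0 / m0).
    by move=> m00 H; rewrite mulrA -H mulfK.
  apply: (K1 _ _ _ _ (mu0 _ Nv)).
  have K (m k : 'I_2 -> R) : m 1 * k 0 = m 0 * k 1 -> forall a b, k a * m b = m a * k b.
    by move=> mk; do 2!apply: forall2; lra.
  exact: (K (mu^~ v) (fun a => dot (ver M F a v) (ep v)) (RL v Nv).1).
have Nu0 : N0 u0 by [].
have det0 v : N0 v -> mu 0 v * 'D_(basis_vec 1) bb v - mu 1 v * 'D_(basis_vec 0) bb v != 0.
  move=> Nv; rewrite (DF v 0 Nv).2 (DF v 1 Nv).2; exact: (RL v Nv).2.
have [|N [s [d [h [c [a [[oN Nu NN d0 ss] [hN Nh sh] Ds [sc sa] E]]]]]]] :=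
  @rank_one_normal_form _ N0 u0 base e (fun v => - Gam G (base v) (e v) (e v)) aa bb
   (fun v => dot (ver M F a0 v) (ep v) / mu a0 v) mu j oN0 Nu0
   (smooth_subset N0D sb) se saa sbb Dx De Daa det0.
  by move=> v Nv; rewrite scalemxE mulf_neq0 ?Nv.2// invr_eq0 gt_eqF// sqrtr_gt0 q0.
exists N, s, bb, d, h, c, a; split.
- by split=> // v /NN/N0D.
- by split=> //; exact: smooth_subset sbb.
- by move=> v Nv; exists a0; rewrite (Ds v a0 Nv); apply/mu0; exact: NN.
- split=> // y By.
  have [Nl lE] := hN _ (ball_slice (bb u0) d0 By).
  have ys : s (h (pt y (bb u0))) = y.
    by move: lE => /(congr1 (fun p : 'rV[R]_2 => p 0 0)); rewrite !ptE.
  have [xE eE _] := E _ Nl; rewrite ys in xE eE.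
  by rewrite -xE -eE; apply: unit_e; exact: NN.
move=> v Nv; have [xE eE aE] := E _ Nv; split=> //.
rewrite -xE -eE -aE; have N0v := NN _ Nv; have Dv := N0D _ N0v.
have Ub := FU Dv.
apply: (can_inj (mulmxK (uM Ub))).
rewrite mulmxDl; apply: (eq_trans (frame_expand (fibre_along M F v) (ep1 _ N0v))).
apply: (f_equal2 +%R); first exact: scalemxAl.
apply: (eq_trans _ (scalemxAl _ _ _)); apply: (f_equal (GRing.scale (bb v))).
exact: (esym (jrot_frame dM0 GM (e v) Ub)).
Qed.

End RankOneLocal.

(** * Surfaces in the tangent bundle *)

Section Charts.
Context {R : realType} {n : nat} {M : manifold R n}.

Lemma cinvK (i : chart M) y : (cmap i @` cdom i) y ->
  cdom i (cinv i y) /\ cmap i (cinv i y) = y.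
Proof. by move=> [p ip <-]; rewrite cmapK. Qed.

Lemma open_chart_image (i : chart M) (O : set M) :
  open O -> O `<=` cdom i -> open (cmap i @` O).
Proof.
move=> oO Oi; rewrite openE => _ [p Op <-].
have ip := Oi _ Op; have nO : nbhs (cinv i (cmap i p)) O.
  by rewrite cmapK//; exact: open_nbhs_nbhs.
have nC : nbhs (cmap i p) (cmap i @` cdom i).
  by apply: open_nbhs_nbhs; split; [exact: ccod_open|exists p].
have nO' : nbhs (cmap i p) (cinv i @^-1` O) by exact: (cinv_continuous ip nO).
by apply: filterS2 nO' nC => y Oy /cinvK[_ yE]; exists (cinv i y).
Qed.

Lemma open_chart_preimage (i : chart M) (N : set 'rV[R]_n) :
  open N -> open (cdom i `&` cmap i @^-1` N).
Proof.
move=> oN; rewrite openE => p [ip Np]; apply: filterI.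
  by apply: open_nbhs_nbhs; split=> //; exact: cdom_open.
by apply: (cmap_continuous ip); exact: open_nbhs_nbhs.
Qed.

Lemma open_overlap (i j : chart M) : open (cmap i @` (cdom i `&` cdom j)).
Proof.
apply: open_chart_image => [|p []//]; apply: openI; exact: cdom_open.
Qed.

Lemma diff_jacobian m (f : 'rV[R]_n -> 'rV[R]_m) x v : 'd f x v = v *m 'J f x.
Proof. by rewrite mul_rV_lin1. Qed.

End Charts.

(** The normalizing factor of [jrot] scales by |det J| and J^T rot90 J = det J rot90; the two cancel
    only for a positive determinant, which is where orientation enters. *)
Lemma jrot_mulmx (R : realType) (A J : 'M[R]_2) (v : 'rV[R]_2) : 0 < \det J ->
  jrot (J *m A *m J^T) v *m J = jrot A (v *m J).
Proof.
move=> J0; rewrite /jrot -/rot90 !det_mulmx det_tr mulrAC -expr2 sqrtrM ?sqr_ge0//.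
rewrite sqrtr_sqr gtr0_norm// invfM -scalemxAl.
rewrite -!mulmxA (mulmxA J^T) rot90_conj -!scalemxAr scalerA mulmxA; congr (_ *: _).
by rewrite mulrAC mulVf ?mul1r// gt_eqF.
Qed.

Section MetricCharts.
Context {R : realType} {S : manifold R 2} (g : riemannian_metric S).

Lemma chart_frame (i : chart S) : exists M : 'rV[R]_2 -> 'M[R]_2,
  [/\ smooth_on (cmap i @` cdom i) M,
      forall x, (cmap i @` cdom i) x -> gram g i x = M x *m (M x)^T
    & forall x, (cmap i @` cdom i) x -> 0 < \det (M x)].
Proof.
apply: orthonormal_frame; first exact: ccod_open.
- exact: gram_smooth.
- by move=> _ [p ip <-]; exact: gram_sym.
- by move=> _ [p ip <-]; exact: gram_posdef.
Qed.

Lemma gram_jacobian (i j : chart S) p : cdom i p -> cdom j p ->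
  gram g i (cmap i p) = 'J (trans i j) (cmap i p) *m gram g j (cmap j p) *m
    ('J (trans i j) (cmap i p))^T.
Proof.
move=> ip jp; apply/matrixP => a b; rewrite -!bil_delta -(gram_trans g ip jp).
by rewrite bil_mulmx !diff_jacobian.
Qed.

Lemma jrot_trans (i j : chart S) p v : oriented S -> cdom i p -> cdom j p ->
  'd (trans i j) (cmap i p) (jrot (gram g i (cmap i p)) v) =
  jrot (gram g j (cmap j p)) ('d (trans i j) (cmap i p) v).
Proof.
move=> oS ip jp; rewrite !diff_jacobian (gram_jacobian ip jp).
by apply: jrot_mulmx; exact: oS.
Qed.

End MetricCharts.

Section LocalSurface.
Context {R : realType} {S : manifold R 2} {g : riemannian_metric S}.
Context {L : manifold R 2} {f : L -> tangent S}.
Hypothesis hf : smooth_immersion f.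

Lemma local_domP (k : chart L) (i : chart S) u : local_dom f k i u <->
  (cmap k @` cdom k) u /\ cdom i (foot (f (cinv k u))).
Proof.
split=> [[q [kq iq] <-]|[/cinvK[kq qE] iq]].
  by rewrite cmapK//; split=> //; exists q.
by exists (cinv k u).
Qed.

Lemma open_local_dom (k : chart L) (i : chart S) : open (local_dom f k i).
Proof.
apply: open_chart_image => [|q []//]; apply: openI; first exact: cdom_open.
by apply: open_comp => [q _|]; [exact: hf.1|exact: cdom_open].
Qed.

Lemma local_baseE (k : chart L) (i : chart S) u :
  lsubmx (local_rep f k i u) = cmap i (foot (f (cinv k u))).
Proof. by rewrite row_mxKl. Qed.

Lemma local_base_chart (k : chart L) (i : chart S) u : local_dom f k i u ->
  (cmap i @` cdom i) (lsubmx (local_rep f k i u)).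
Proof. by move=> /local_domP[_ iq]; rewrite local_baseE; exists (foot (f (cinv k u))). Qed.

Lemma lagrangian_pderiv (hlag : lagrangian g f) k i u : local_dom f k i u -> forall a b,
  Omega (gram g i) (local_rep f k i u) (pderiv (local_rep f k i) a u)
    (pderiv (local_rep f k i) b u) = 0.
Proof.
move=> Du a b; have dF := smooth_diff (hf.2 k i).1 Du.
by rewrite /pderiv !(deriveE _ dF); exact: hlag.
Qed.

Hypothesis hnull : non_null g f.
Hypothesis hlag : lagrangian g f.
Hypothesis hmin : minimal g f.

Lemma local_chart (q : L) : exists k i,
  [/\ cdom k q, cdom i (foot (f q)) & local_dom f k i (cmap k q)].
Proof.
have [k kq] := cdom_cover q; have [i iq] := cdom_cover (foot (f q)).
by exists k, i; split=> //; exists q.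
Qed.

Let base k i (u : 'rV[R]_2) : 'rV[R]_2 := lsubmx (local_rep f k i u).

Lemma smooth_local_base k i : smooth_on (local_dom f k i) (base k i).
Proof.
apply: (@smooth_base_along _ _ (local_rep f k i)); first exact: open_local_dom.
exact: (hf.2 k i).1.
Qed.

Lemma rank_zero_empty : projection_rank f 0 -> L -> False.
Proof.
move=> rk0 q; have [k [i [kq iq Du]]] := local_chart q.
have [M [sM GM dM0]] := chart_frame g i.
have oD := @open_local_dom k i; have sF := (hf.2 k i).1.
have oU : open (cmap i @` cdom i) by exact: ccod_open.
have FU := @local_base_chart k i.
set u := cmap k q in Du.
have J0 : 'J (base k i) u = 0 by apply/eqP; rewrite -mxrank_eq0 (rk0 k i u Du).
have D0 a : 'D_(basis_vec a) (base k i) u = 0.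
  by rewrite (deriveE _ (smooth_diff (@smooth_local_base k i) Du)) diff_jacobian J0 mulmx0.
have hor0 a : hor M (local_rep f k i) a u = 0.
  have := hor_base sM sF FU a Du.
  by rewrite -/(base k i) D0 mul0mx.
have := hnull Du; rewrite (_ : induced_metric _ _ _ = 0); last first.
  apply/matrixP => a b.
  apply: (eq_trans (induced_metric_frame oU sM dM0 GM FU a b Du)).
  rewrite (hor0 a) (hor0 b) [RHS]mxE /neut mul0mx.
  by rewrite /dot [(0 : 'rV[R]_2) 0 0]mxE [(0 : 'rV[R]_2) 0 1]mxE !(mul0r, mulr0, addr0, subr0).
by rewrite unitmxE det0 unitr0.
Qed.

(** [dconn_surface] gives d omega times the Jacobian determinant of the projection equal to zero,
    and that determinant is invertible in rank two. *)
Lemma rank_two_flat : projection_rank f 2 -> forall q, flat_at g (foot (f q)).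
Proof.
move=> rk2 q i iq l m a b; have [k kq] := cdom_cover q.
have Du : local_dom f k i (cmap k q) by exists q.
have [M [sM GM dM0]] := chart_frame g i.
have oD := @open_local_dom k i; have sF := (hf.2 k i).1.
have oU : open (cmap i @` cdom i) by exact: ccod_open.
have FU := @local_base_chart k i.
have H := dconn_surface oU sM dM0 GM oD sF FU (lagrangian_pderiv hlag (k := k) (i := i))
  (hnull (k := k) (i := i)) (hmin (k := k) (i := i)) Du.
have uM x : (cmap i @` cdom i) x -> M x \in unitmx.
  by move=> Ux; rewrite unitmxE unitfE gt_eqF// dM0.
have Up : (cmap i @` cdom i) (cmap i (foot (f q))) by exists (foot (f q)).
apply: (riemann_conn oU sM uM _ _ _ _ GM Up).
have Jb c m' := jacobian_entry c m' (smooth_diff (@smooth_local_base k i) Du).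
have Db c m' := derive_entry (basis_vec c) 0 m' (smooth_diff (@smooth_local_base k i) Du).
have bq : base k i (cmap k q) = cmap i (foot (f q)) by rewrite /base local_baseE cmapK.
rewrite -/(base k i) -/(base k i _) bq in H.
have J0 : \det ('J (base k i) (cmap k q)) != 0.
  by rewrite -unitfE -unitmxE -row_full_unit /row_full (rk2 k i _ Du).
rewrite det2E !Jb -/(basis_vec 0) -/(basis_vec 1) -!Db in J0.
apply/eqP; rewrite -subr_eq0; apply/eqP.
by move/eqP: H; rewrite mulf_eq0 (negPf J0) orbF => /eqP.
Qed.

Lemma rank_two_open : projection_rank f 2 -> open [set foot (f q) | q in setT].
Proof.
move=> rk2; rewrite openE => _ [q _ <-].
have [k [i [kq iq Du]]] := local_chart q.
have oD := @open_local_dom k i.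
have uJ : 'J (base k i) (cmap k q) \in unitmx.
  by rewrite -row_full_unit /row_full (rk2 k i _ Du).
have [N [d [h [[oN Nu ND d0] hN Nh sh]]]] := inverse_function oD Du (@smooth_local_base k i) uJ.
have qE : base k i (cmap k q) = cmap i (foot (f q)) by rewrite /base local_baseE cmapK.
have : nbhs (foot (f q)) (cdom i `&` cmap i @^-1` ball (cmap i (foot (f q))) d).
  apply: open_nbhs_nbhs; split; last by split=> //; exact: ballxx.
  by apply: open_chart_preimage; exact: ball_open.
apply: filterS => p [ip Bp]; rewrite -qE in Bp.
have [Nh' hE] := hN _ Bp; have /local_domP[_ ih] := ND _ Nh'.
exists (cinv k (h (cmap i p))) => //.
by rewrite -(cmapK ih) -local_baseE [lsubmx _]hE cmapK.
Qed.

(** Carries the local form from the charts [k] and [i] to the manifolds: gamma is [c] read through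
    the inverse chart, and [phi] is (s, b) read in the chart [k]. *)
Lemma rank_one_affine_normal : oriented S -> projection_rank f 1 ->
  forall q, affine_normal_near g f q.
Proof.
move=> oS rk1 q; have [k [i [kq iq Du]]] := local_chart q.
have [M [sM GM dM0]] := chart_frame g i.
have oD := @open_local_dom k i.
have oU (i' : chart S) : open (cmap i' @` cdom i') by exact: ccod_open.
have [N [s [b [d [h [c [a [[oN Nu ND d0 ss] [sb hN Nh sh] Ds [sc sa c1] E]]]]]]]] :=
  rank_one_local (oU i) sM dM0 GM oD (hf.2 k i).1 (@local_base_chart k i)
    (lagrangian_pderiv hlag (k := k) (i := i)) (hnull (k := k) (i := i))
    (hmin (k := k) (i := i)) Du (@rk1 k i).
set u0 := cmap k q in Nu hN Nh sh sc sa c1 Du.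
set I := ball (s u0) d in sc sa c1.
have oI : open I by exact: ball_open.
pose l y := h (pt y (b u0)).
have lN y : I y -> N (l y) /\ s (l y) = y.
  move=> Iy; have [Nl lE] := hN _ (ball_slice (b u0) d0 Iy); split=> //.
  by move: lE => /(congr1 (fun p : 'rV[R]_2 => p 0 0)); rewrite !ptE.
have sI v : N v -> I (s v).
  by move=> /Nh[/(ball_pt _ _ d0)[+ _] _]; rewrite !ptE /I in_ballE.
pose gamma y := cinv i (c y).
have baseE v : N v -> cmap i (foot (f (cinv k v))) = c (s v).
  by move=> Nv; have [<- _] := E _ Nv; rewrite local_baseE.
have Ui y : I y -> (cmap i @` cdom i) (c y).
  move=> /lN[Nl lE]; rewrite -[in X in _ X]lE -(baseE _ Nl).
  by have /local_domP[_ ip] := ND _ Nl; exists (foot (f (cinv k (l y)))).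
have gi y : I y -> cdom i (gamma y) /\ cmap i (gamma y) = c y.
  by move=> /Ui; exact: cinvK.
have footE v : N v -> foot (f (cinv k v)) = gamma (s v).
  by move=> Nv; have /local_domP[_ ip] := ND _ Nv; rewrite /gamma -(baseE _ Nv) cmapK.
have cgamma y : I y -> {for y, continuous gamma}.
  move=> Iy; apply: continuous_comp; first exact: (sc 0%N).
  by have [ip <-] := gi _ Iy; exact: cinv_continuous.
pose I' i' := I `&` [set y | cdom i' (gamma y)].
have oI' i' : open (I' i').
  rewrite openE => y [Iy iy]; apply: filterI; first exact: open_nbhs_nbhs.
  by apply: (cgamma _ Iy); apply: open_nbhs_nbhs; split=> //; exact: cdom_open.
pose c' i' := cmap i' \o gamma.
have sc' i' : smooth_on (I' i') (c' i').
  apply: (@smooth_comp _ _ _ _ _ _ (cmap i @` (cdom i `&` cdom i')) c (trans i i')) => //.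
  - exact: open_overlap.
  - by move=> y [Iy iy]; have [ip <-] := gi _ Iy; exists (gamma y).
  - by apply: smooth_subset sc => y [].
  - exact: trans_smooth.
have velE i' y : I y -> cdom i' (gamma y) ->
    velocity gamma i' y = 'd (trans i i') (cmap i (gamma y)) (derive1 c y).
  move=> Iy iy; have [ip cE] := gi _ Iy; rewrite /velocity !derive1E cE.
  have dT : differentiable (trans i i') (c y).
    by apply: (smooth_diff (@trans_smooth _ _ S i i')); rewrite -cE; exists (gamma y).
  have dc := smooth_diff sc Iy.
  rewrite -(deriveE _ dT). exact: (derive_comp (1 : R) dc dT).
have arc : arclength_param g I gamma.
  move=> y Iy i' iy; have [ip cE] := gi _ Iy.
  by rewrite !velE// (gram_trans g ip iy) cE; exact: c1.
pose phi p := (s (cmap k p), b (cmap k p)).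
exists (cdom k `&` cmap k @^-1` N), I, gamma, a, phi; split.
- by split; [exact: open_chart_preimage|].
- split=> // x y; rewrite /I !in_ballE !ltr_norml => /andP[x1 x2] /andP[y1 y2] z /andP[xz zy].
  by rewrite in_ballE ltr_norml; apply/andP; split; lra.
- split; [by split=> // i'; exact: (sc' i')|exact: arc| |exact: sa].
  (* The surface is parametrized anew over the chart [i'], with its own orthonormal frame, near a
     point lying above gamma y. *)
  + move=> y Iy i' iy; have [Nl lE] := lN _ Iy.
    have [M' [sM' GM' dM0']] := chart_frame g i'.
    have [e De] := Ds _ Nl.
    pose D' := local_dom f k i' `&` N.
    have Dl : D' (l y).
      split=> //; apply/local_domP; split; last by rewrite footE// lE.
      by have /local_domP[] := ND _ Nl.
    have oD' : open D' by apply: openI => //; exact: open_local_dom.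
    have sF' : smooth_on D' (local_rep f k i') by apply: smooth_subset (hf.2 k i').1 => v [].
    have Iy' : I' i' (s (l y)) by rewrite lE.
    rewrite -[in X in X = _]lE.
    apply: (@geodesic_of_factor _ _ _ _ (oU i') sM' dM0' GM' D' (local_rep f k i') oD' sF' _ _ _ _
      (l y) s (c' i') (I' i') e Dl _ (oI' i') Iy' (sc' i') _ _ De).
    * by move=> v [Dv _]; exact: local_base_chart.
    * by move=> v [Dv _]; exact: lagrangian_pderiv.
    * by move=> v [Dv _]; exact: hnull.
    * by move=> v [Dv _]; exact: hmin.
    * by apply: smooth_subset ss => v [].
    * by move=> v [Dv Nv] _; rewrite local_baseE footE.
    * by move=> z [Iz iz]; exact: arc.
- split.
  + move=> p [kp Np].
    have cs : {for p, continuous (s \o cmap k)}.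
      by apply: continuous_comp (ss 0%N _ Np); exact: cmap_continuous.
    have cb : {for p, continuous (b \o cmap k)}.
      by apply: continuous_comp (sb 0%N _ Np); exact: cmap_continuous.
    exact: (cvg_pair cs cb).
  + move=> p p' [kp Np] [kp' Np'] [sE bE].
    rewrite -(cmapK kp) -(cmapK kp'); congr (cinv k _).
    by rewrite -(Nh _ Np).2 -(Nh _ Np').2 sE bE.
  (* Openness: y |-> cinv k (h (P y)) is a continuous right inverse of [phi] near [phi p], and it
     sends [phi p] to [p]. *)
  + move=> O oO OU; rewrite openE => _ [p Op <-]; have [kp Np] := OU _ Op.
    have [Bp hp] := Nh _ Np.
    pose P (y : R * R) := pt y.1 y.2.
    have cP : {for phi p, continuous P}.
      apply: continuous_mx => e j; rewrite ord1; move: j; apply: forall2.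
        rewrite (_ : (fun y => P y 0 0) = fst); first exact: cvg_fst.
        by apply/funext => y; rewrite ptE.
      rewrite (_ : (fun y => P y 0 1) = snd); first exact: cvg_snd.
      by apply/funext => y; rewrite ptE.
    have chP : {for phi p, continuous (fun y => h (P y))}.
      by apply: continuous_comp => //; exact: (sh 0%N _ Bp).
    have cpsi : {for phi p, continuous (fun y => cinv k (h (P y)))}.
      by apply: continuous_comp => //; rewrite [h _]hp; exact: cinv_continuous.
    have nO : nbhs (phi p) ((fun y => cinv k (h (P y))) @^-1` O).
      by apply: cpsi; rewrite [h _]hp cmapK//; exact: open_nbhs_nbhs.
    have nB : nbhs (phi p) (P @^-1` ball (pt (s u0) (b u0)) d).
      by apply: cP; apply: open_nbhs_nbhs; split=> //; exact: ball_open.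
    apply: filterS2 nO nB => y Oy By; exists (cinv k (h (P y))) => //.
    have [NP hE] := hN _ By; have /local_domP[/cinvK[_ kE] _] := ND _ NP.
    rewrite /phi kE [y]surjective_pairing; congr (_, _).
      by move: hE => /(congr1 (fun p : 'rV[R]_2 => p 0 0)); rewrite !ptE.
    by move: hE => /(congr1 (fun p : 'rV[R]_2 => p 0 1)); rewrite !ptE.
move=> p [kp Np]; have pE : cinv k (cmap k p) = p by exact: cmapK.
have Iy := sI _ Np; have [ip cE] := gi _ Iy.
split=> //; split; first by rewrite -[in LHS]pE footE.
move=> i' iy.
have fE : foot (f p) = gamma (s (cmap k p)) by rewrite -[in LHS]pE footE.
(* The differential of the transition map is linear, carries velocity to velocity, and commutes with
   J by orientation, so the decomposition found in chart [i] holds in chart [i']. *)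
rewrite (@tcoord_trans _ _ _ (f p) i i') ?fE//.
have -> : tcoord (f p) i = rsubmx (local_rep f k i (cmap k p)).
  by rewrite row_mxKr pE.
rewrite (E _ Np).2 linearD; apply: (f_equal2 +%R).
  apply: (eq_trans (linearZ _ _)); apply: (f_equal (GRing.scale _)).
  exact: (esym (velE _ _ Iy iy)).
apply: (eq_trans (linearZ _ _)); apply: (f_equal (GRing.scale _)).
by rewrite (velE _ _ Iy iy) -(jrot_trans g _ oS ip iy) cE.
Qed.

End LocalSurface.

Theorem theorem1 (R : realType) (S : manifold R 2) (g : riemannian_metric S)
    (L : manifold R 2) (f : L -> tangent S)
    (hS : oriented S)
    (hf : smooth_immersion f)
    (hnull : non_null g f)
    (hmin : minimal g f)
    (hlag : lagrangian g f)
    (hrank : exists r : nat, projection_rank f r) :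
  (forall q : L, affine_normal_near g f q) \/
  [/\ projection_rank f 2,
      open [set foot (f q) | q in setT] &
      forall q : L, flat_at g (foot (f q))].
Proof.
case: hrank => -[|[|[|r]]] rk.
(* Rank zero leaves no point in L, so the first alternative holds vacuously. *)
- by left=> q; have := rank_zero_empty hf hnull rk q.
- by left; exact: (rank_one_affine_normal hf hnull hlag hmin hS rk).
- right; split=> //; first exact: (rank_two_open hf rk).
  exact: (rank_two_flat hf hnull hlag hmin rk).
(* A Jacobian with two rows cannot have rank three or more, so again L has no point. *)
left=> q; have [k [i [kq iq Du]]] := local_chart (f := f) q.
by have := rank_leq_row ('J (fun y => lsubmx (local_rep f k i y)) (cmap k q)); rewrite rk.
Qed.
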